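(* Let $F$ be a non-Archimedean local field with ring of integers $\mathcal{O}$, prime ideal $\mathfrak{p}$, and residue field $\mathcal{O}/\mathfrak{p}\cong\mathbb{F}_q$, where $q=p^l$ for a prime number $p$. Let $n\ge 1$ be an integer. Let $\mathfrak{g}$ be a finite dimensional complex simple Lie algebra with root system $\Phi$, and let $\mathbf{G}_{ad}(\mathcal{O}/\mathfrak{p}^n)=\mathbf{G}_{ad}(\mathcal{O}/\mathfrak{p}^n,\Phi)$ be the (elementary) adjoint Chevalley group associated to $\mathfrak{g}$ over the ring $\mathcal{O}/\mathfrak{p}^n$. Let $m_{\sf f}(G)$ denote the smallest dimension of a faithful finite dimensional complex representation of a finite group $G$. Then $$m_{\sf f}\left(\mathbf{G}_{ad}(\mathcal{O}/\mathfrak{p}^n)\right)\ \geq\ h_{\mathrm f}(\Phi,q,n),$$ where $h_{\mathrm f}(\Phi,q,n)$ is given, under the indicated conditions, as follows: - $\Phi={\sf A}_1$, $p\ge 3$: $h_{\mathrm f}=\frac12(q^n-q^{n-1})$; - $\Phi={\sf A}_m$, $m\ge 2$, $p\ge 3$: $h_{\mathrm f}=(q^n-q^{n-1})q^{(m-1)n}$; - $\Phi={\sf B}_m$, $m\ge 3$, $p\ge 3$: $h_{\mathrm f}=(q^n-q^{n-1})q^{(2m-3)n}$; - $\Phi={\sf C}_m$, $m\ge 2$, $p\ge 3$: $h_{\mathrm f}=\frac12(q^n-q^{n-1})q^{(m-1)n}$; - $\Phi={\sf D}_m$, $m\ge 4$, $p\ge 3$: $h_{\mathrm f}=(q^n-q^{n-1})q^{(2m-4)n}$;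 - $\Phi={\sf G}_2$, $p\ge 5$: $h_{\mathrm f}=(q^n-q^{n-1})q^{2n}$; - $\Phi={\sf F}_4$, $p\ge 3$: $h_{\mathrm f}=(q^n-q^{n-1})q^{7n}$; - $\Phi={\sf E}_6$, $p\ge 3$: $h_{\mathrm f}=(q^n-q^{n-1})q^{10n}$; - $\Phi={\sf E}_7$, $p\ge 3$: $h_{\mathrm f}=(q^n-q^{n-1})q^{16n}$; - $\Phi={\sf E}_8$, $p\ge 3$: $h_{\mathrm f}=(q^n-q^{n-1})q^{28n}$.
   Context: For a finite group $G$, $m_{\sf f}(G)$ is the minimum of $\dim V$ over all faithful representations $\rho:G\to \mathrm{GL}(V)$ on finite dimensional complex vector spaces $V$. Construction of the adjoint Chevalley group over $R=\mathcal{O}/\mathfrak{p}^n$: fix a Cartan subalgebra $\mathfrak{h}$ of $\mathfrak{g}$, the root system $\Phi\subseteq\mathfrak{h}^*$, a base $\Delta$ of $\Phi$, and a Chevalley basis $\{H_\alpha:\alpha\in\Delta\}\cup\{e_\alpha:\alpha\in\Phi\}$ of $\mathfrak{g}$. Let $\mathfrak{g}_{\mathbb{Z}}$ be the $\mathbb{Z}$-span of this basis (a Lie algebra over $\mathbb{Z}$). For $\alpha\in\Phi$ and $\xi\in\mathbb{C}$, the matrix of the automorphism $x_\alpha(\xi)=\exp(\xi\,\mathrm{ad}_{e_\alpha})$ of $\mathfrak{g}$ in the Chevalley basis has entries of the form $a\xi^i$ with $a\in\mathbb{Z}$, $i\ge 0$. For $t\in R$, let $\bar{x}_\alpha(t)$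 be the $R$-linear transformation of $\mathfrak{g}_R=\mathfrak{g}_{\mathbb{Z}}\otimes_{\mathbb{Z}}R$ whose matrix is obtained by replacing each entry $a\xi^i$ by $\bar{a}t^i$, where $\bar a$ is the image of $a$ in $R$; it is a Lie algebra automorphism of $\mathfrak{g}_R$. The (elementary) adjoint Chevalley group $\mathbf{G}_{ad}(R)=\mathbf{G}_{ad}(R,\Phi)$ is the subgroup of the automorphism group of $\mathfrak{g}_R$ generated by all $\bar{x}_\alpha(t)$, $\alpha\in\Phi$, $t\in R$. *)

(* Defs.v *)
From HB Require Import structures.
From mathcomp Require Import all_boot all_order all_algebra.
From mathcomp Require Import all_fingroup all_character.
From mathcomp Require Import boolp reals complex.

Set Implicit Arguments.
Unset Strict Implicit.
Unset Printing Implicit Defensive.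

Import Order.TTheory GRing.Theory Num.Theory.
Local Open Scope ring_scope.

(** * Non-Archimedean local fields *)

(* [valge v N x] is "v(x) >= N" with the convention v(0) = +oo; the value
   [v 0 : int] itself is never used. *)
Definition valge (F : fieldType) (v : F -> int) (N : int) (x : F) : bool :=
  (x == 0) || (N <= v x).

(* Fields complete with respect to a normalized discrete valuation and with
   finite residue field. *)
Record localField := LocalField {
  lf_field :> fieldType;
  lf_val : lf_field -> int;
  lf_valM : forall x y, x != 0 -> y != 0 ->
    lf_val (x * y) = lf_val x + lf_val y;
  lf_valD : forall N x y,
    valge lf_val N x -> valge lf_val N y -> valge lf_val N (x + y);
  lf_uniformizer : exists2 x, x != 0 & lf_val x = 1;
  lf_complete : forall u : nat -> lf_field,
    (forall N : int, exists m : nat, forall i j : nat,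
       (m <= i)%N -> (m <= j)%N -> valge lf_val N (u i - u j)) ->
    exists x, forall N : int, exists m : nat, forall i : nat,
       (m <= i)%N -> valge lf_val N (u i - x);
  lf_residue_finite : exists s : seq lf_field, forall x,
    valge lf_val 0 x -> exists2 y, y \in s & valge lf_val 1 (x - y)
}.

Definition lf_int (F : localField) : {pred F} :=
  [pred x | valge (@lf_val F) 0 x].

Lemma lf_val1 (F : localField) : @lf_val F 1 = 0.
Proof.
have := @lf_valM F 1 1 (oner_neq0 _) (oner_neq0 _); rewrite mulr1.
by move/eqP; rewrite -subr_eq0 opprD addNKr oppr_eq0 => /eqP.
Qed.

Lemma lf_valN1 (F : localField) : @lf_val F (- 1) = 0.
Proof.
have n0 : - 1 != 0 :> F by rewrite oppr_eq0 oner_eq0.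
have := @lf_valM F _ _ n0 n0; rewrite mulrNN mulr1 lf_val1 => /esym/eqP.
by rewrite -mulr2n mulrn_eq0 => /eqP.
Qed.

Fact lf_int_subring (F : localField) : subring_closed (@lf_int F).
Proof.
have intM : {in @lf_int F &, forall x y, x * y \in @lf_int F}.
  move=> x y; rewrite !inE /valge.
  have [-> _ _|x0 /= vx] := eqVneq x 0; first by rewrite mul0r eqxx.
  have [-> _|y0 /= vy] := eqVneq y 0; first by rewrite mulr0 eqxx.
  by rewrite (lf_valM x0 y0) addr_ge0 ?orbT.
split=> //; first by rewrite inE /valge lf_val1 lexx orbT.
move=> x y xO yO; rewrite inE /=; apply: lf_valD => //.
rewrite -mulN1r; apply: intM => //.
by rewrite inE /valge lf_valN1 lexx orbT.
Qed.

HB.instance Definition _ (F : localField) :=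
  GRing.isSubringClosed.Build F (@lf_int F) (@lf_int_subring F).

Record ringOfIntegers (F : localField) := RingOfIntegers {
  roi_val : F;
  roi_valP : roi_val \in @lf_int F
}.

HB.instance Definition _ (F : localField) := [isSub for @roi_val F].
HB.instance Definition _ (F : localField) :=
  [Choice of ringOfIntegers F by <:].
HB.instance Definition _ (F : localField) :=
  [SubChoice_isSubComNzRing of ringOfIntegers F by <:].

Definition primeIdeal (F : localField) (x : ringOfIntegers F) : Prop :=
  valge (@lf_val F) 1 (val x).

Definition ideal_mul (A : comNzRingType) (I J : A -> Prop) (x : A) : Prop :=
  exists2 s : seq (A * A), (forall u, u \in s -> I u.1 /\ J u.2)
    & x = \sum_(u <- s) u.1 * u.2.

Fixpoint ideal_exp (A : comNzRingType) (I : A -> Prop) (n : nat) : A -> Prop :=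
  if n is n'.+1 then ideal_mul I (ideal_exp I n') else fun=> True.

(* B, together with the projection pi, is the quotient ring A / I. *)
Definition is_quotient_ring (A B : comNzRingType) (I : A -> Prop)
    (pi : {rmorphism A -> B}) : Prop :=
  (forall b, exists a, pi a = b) /\ (forall a, pi a = 0 <-> I a).

(** * Complex simple Lie algebras *)

Record lieAlgebra (C : fieldType) := LieAlgebra {
  lie_vect :> vectType C;
  lie_br : lie_vect -> lie_vect -> lie_vect;
  lie_linearl : forall y, linear (lie_br ^~ y);
  lie_linearr : forall x, linear (lie_br x);
  lie_alt : forall x, lie_br x x = 0;
  lie_jacobi : forall x y z,
    lie_br x (lie_br y z) + lie_br y (lie_br z x) + lie_br z (lie_br x y) = 0
}.

Section LieAlgebra.

Variables (C : fieldType) (g : lieAlgebra C).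
Local Notation "[ x , y ]" := (@lie_br C g x y) : ring_scope.

Definition lie_simple : Prop :=
  (exists x y : g, [x, y] != 0) /\
  forall I : {vspace g}, (forall x y, y \in I -> [x, y] \in I) ->
    I = 0%VS \/ I = fullv.

Definition lie_prod (U V : {vspace g}) : {vspace g} :=
  <<[seq [x, y] | x <- vbasis U, y <- vbasis V]>>%VS.

Definition is_cartan_subalgebra (h : {vspace g}) : Prop :=
  [/\ (lie_prod h h <= h)%VS,
      exists k, iter k (lie_prod h) h = 0%VS
    & forall x, (forall y, y \in h -> [x, y] \in h) -> x \in h].

Definition dual (h : {vspace g}) : vectType C := 'Hom(subvs_of h, C^o).

Variable h : {vspace g}.
Implicit Types (a b : dual h).

Definition in_root_space a (x : g) : Prop :=
  forall t : subvs_of h, [vsval t, x] = (a : 'Hom(_, _)) t *: x.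

Definition is_root_system (Phi : seq (dual h)) : Prop :=
  uniq Phi /\
  forall a, a \in Phi <-> a != 0 /\ exists2 x, x != 0 & in_root_space a x.

Definition is_base (Phi Delta : seq (dual h)) : Prop :=
  [/\ {subset Delta <= Phi}, basis_of fullv Delta
    & forall a, a \in Phi -> exists c : nat -> nat,
        a = \sum_(i < size Delta) Delta`_i *+ c i \/
        a = - \sum_(i < size Delta) Delta`_i *+ c i].

Definition chevalley_seq (Phi Delta : seq (dual h))
    (H : dual h -> subvs_of h) (e : dual h -> g) : seq g :=
  [seq vsval (H a) | a <- Delta] ++ [seq e a | a <- Phi].

(* For every root a, [H a] is the coroot of a, that is, the unique element of
   the line [g_a, g_(-a)] at which a takes the value 2; hence b (H a) is the
   Cartan integer <b, a^vee>.  Only the H a with a simple belong to the basis.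
   In the last clause, r is the largest integer such that b - r a is a root. *)
Record is_chevalley_basis (Phi Delta : seq (dual h))
    (H : dual h -> subvs_of h) (e : dual h -> g) : Prop := IsChevalleyBasis {
  chev_basis : basis_of fullv (chevalley_seq Phi Delta H e);
  chev_root_space : forall a, a \in Phi -> in_root_space a (e a);
  chev_coroot : forall a, a \in Phi -> (a : 'Hom(_, _)) (H a) = 2;
  chev_br_opp : forall a, a \in Phi -> [e a, e (- a)] = vsval (H a);
  chev_br : forall a b (r : nat),
    a \in Phi -> b \in Phi -> a + b \in Phi ->
    b - a *+ r \in Phi ->
    (forall s : nat, b - a *+ s \in Phi -> (s <= r)%N) ->
    [e a, e b] = e (a + b) *+ r.+1 \/ [e a, e b] = - (e (a + b) *+ r.+1)
}.

(* The matrix (acting on columns) of exp (xi ad_x) in the basis B, as a matrix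
   of polynomials in xi.  It is used for ad-nilpotent x, for which
   (ad_x) ^ (dim g) = 0, so that all terms of the series are there. *)
Definition exp_ad_mx (B : seq g) (x : g) : 'M[{poly C}]_(size B) :=
  \matrix_(i, j) \poly_(k < size B)
    (coord (in_tuple B) i (iter k (lie_br x) B`_j) / k`!%:R).

End LieAlgebra.

(** * Types of root systems *)

Inductive dynkin :=
  | TypeA of nat | TypeB of nat | TypeC of nat | TypeD of nat
  | TypeE6 | TypeE7 | TypeE8 | TypeF4 | TypeG2.

Definition dynkin_rank (X : dynkin) : nat :=
  match X with
  | TypeA m | TypeB m | TypeC m | TypeD m => m
  | TypeE6 => 6 | TypeE7 => 7 | TypeE8 => 8 | TypeF4 => 4 | TypeG2 => 2
  end.

(* The entry <a_i, a_j^vee> of the Cartan matrix, in Bourbaki's numbering of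
   the simple roots shifted to start at 0: the last simple root is short in
   type B and long in type C, and a_0 is short in type G2. *)
Definition cartan_entry (X : dynkin) (i j : nat) : int :=
  let edges (s : seq (nat * nat)) : int :=
    if ((i, j) \in s) || ((j, i) \in s) then - 1 else 0 in
  let chain : int := if (i.+1 == j) || (j.+1 == i) then - 1 else 0 in
  let edgesE : int :=
    edges [:: (0, 2); (1, 3); (2, 3); (3, 4); (4, 5); (5, 6); (6, 7)]%N in
  if i == j then 2 else
  match X with
  | TypeA m => chain
  | TypeB m => if (i.+2 == m) && (j.+1 == m) then - 2 else chain
  | TypeC m => if (i.+1 == m) && (j.+2 == m) then - 2 else chain
  | TypeD m => edges (rcons [seq (k, k.+1) | k <- iota 0 (m - 2)] (m - 3, m - 1)%N)
  | TypeE6 | TypeE7 | TypeE8 => edgesE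
  | TypeF4 => if (i, j) == (1, 2)%N then - 2 else chain
  | TypeG2 => if (i, j) == (1, 0)%N then - 3 else chain
  end.

(* The root system with base Delta has type X: for some ordering D of Delta,
   the Cartan matrix is the one of X.  [H] gives the coroots. *)
Definition has_type (C : fieldType) (g : lieAlgebra C) (h : {vspace g})
    (Delta : seq (dual h)) (H : dual h -> subvs_of h) (X : dynkin) : Prop :=
  size Delta = dynkin_rank X /\
  exists2 D : seq (dual h), perm_eq D Delta &
    forall i j : nat, (i < dynkin_rank X)%N -> (j < dynkin_rank X)%N ->
      (D`_i : 'Hom(_, _)) (H D`_j) = (cartan_entry X i j)%:~R.

(** * Adjoint Chevalley groups *)

(* The integer a such that z = a, for z in the image of the integers. *)
Definition to_int (C : fieldType) (z : C) : int :=
  if pselect (exists a : int, a%:~R == z) is left ex then xchoose ex else 0.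

Section ChevalleyGroup.

Variables (C : fieldType) (g : lieAlgebra C) (h : {vspace g}).
Variables (Phi Delta : seq (dual h)) (H : dual h -> subvs_of h)
  (e : dual h -> g) (A : finComUnitRingType).

Local Notation B := (chevalley_seq Phi Delta H e).

(* The matrix of the automorphism xbar_a(t) of g_A: each term c xi^i in the
   entries of exp (xi ad_(e_a)), with c an integer, becomes c t^i in A. *)
Definition chevalley_mx (a : dual h) (t : A) : 'M[A]_(size B) :=
  map_mx (fun P : {poly C} => (map_poly (fun z => (to_int z)%:~R) P).[t])
    (exp_ad_mx B (e a)).

(* MathComp's [{'GL_N[A]}] consists of matrices of size N.-1.+1; [conform_mx]
   is the cast from size N = dim g > 0. *)
Definition adjoint_chevalley_group : {group {'GL_(size B)[A]}} :=
  <<[set u : {'GL_(size B)[A]} |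
      has (fun a => [exists t : A,
             GLval u == conform_mx 1%:M (chevalley_mx a t)]) Phi]>>%G.

End ChevalleyGroup.

(** * Faithful representations *)

Section MinFaithfulDim.

Variables (C : fieldType) (gT : finGroupType) (G : {group gT}).

Definition has_faithful_rep (d : nat) : bool :=
  `[< exists rG : mx_representation C G d, mx_faithful rG >].

Lemma faithful_rep_exists : exists d, has_faithful_rep d.
Proof.
exists #|G|; apply/asboolP; exists (regular_repr C G).
exact: regular_mx_faithful.
Qed.

Definition min_faithful_dim : nat := ex_minn faithful_rep_exists.

End MinFaithfulDim.

(** * The lower bound *)

Definition hf_hyp (X : dynkin) (p : nat) : bool :=
  match X with
  | TypeA m => (1 <= m)%N && (3 <= p)%N
  | TypeB m => (3 <= m)%N && (3 <= p)%N
  | TypeC m => (2 <= m)%N && (3 <= p)%N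
  | TypeD m => (4 <= m)%N && (3 <= p)%N
  | TypeG2 => (5 <= p)%N
  | TypeF4 | TypeE6 | TypeE7 | TypeE8 => (3 <= p)%N
  end.

Definition hf (X : dynkin) (q n : nat) : rat :=
  let c : rat := q%:R ^+ n - q%:R ^+ (n - 1) in
  let Q (k : nat) : rat := q%:R ^+ (k * n) in
  match X with
  | TypeA 1 => c / 2
  | TypeA m => c * Q (m - 1)%N
  | TypeB m => c * Q (2 * m - 3)%N
  | TypeC m => c / 2 * Q (m - 1)%N
  | TypeD m => c * Q (2 * m - 4)%N
  | TypeG2 => c * Q 2%N
  | TypeF4 => c * Q 7%N
  | TypeE6 => c * Q 10%N
  | TypeE7 => c * Q 16%N
  | TypeE8 => c * Q 28%N
  end.

(* Main.v *)
(** Let [b] be a long root.  The roots [a] with <a, b^vee> = 1 come in pairs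
    [a], [b - a]; choosing one root [a_i] from each of the k pairs, the root
    subgroups of [b], of the [a_i] and of the [b - a_i] generate a Heisenberg
    group over A = O/p^n whose centre contains the root subgroup of [b].

    A faithful representation contains a joint eigenvector of the root subgroups
    of [b] and of the [a_i] on which the subgroup of [b] acts through a character
    psi of (A, +) that is nontrivial on the smallest nonzero ideal of A, so that
    all the characters psi(s -) are distinct.  Torus elements carry psi to
    psi(u -), for all units u (or all squares of units, in types A_1 and C_m), and
    the elements of the subgroup of [b - a_i] shift the eigenvalues of the
    subgroup of [a_i] by the characters psi(s -).  Thus (number of such u) * |A|^k
    distinct systems of eigenvalues occur, which bounds the dimension from below.

    The relations between root elements over A hold for exponentials of
    nilpotent derivations in characteristic 0, and descend to A because the
    matrices of ad(e_a)^k / k! in the Chevalley basis are integral. *)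

Require Import Defs.
From HB Require Import structures.
From mathcomp Require Import all_boot all_order all_algebra.
From mathcomp Require Import all_fingroup all_field all_character.
From mathcomp Require Import boolp reals complex.
From mathcomp Require Import zify ring.

Set Implicit Arguments.
Unset Strict Implicit.
Unset Printing Implicit Defensive.

Import Order.TTheory GRing.Theory Num.Theory.
Local Open Scope ring_scope.

(** * Representations of Heisenberg groups *)

(** Since b is long, every root other than b pairs with b^vee to at most 1. So root vectors whose
    pairings with b^vee add up to at least 2 commute unless the roots sum to b, which yields the
    Heisenberg relations; and exp(t ad e_b) is quadratic in t, so that, 2 being invertible, the
    conjugates of e_b determine those of its whole root subgroup. Taking b simple settles the choice
    in each pair: a_i is the positive member. It has b among its simple summands, so a_i + a_j is
    never b, and it can be reached from b using the Cartan matrix alone. The number k of pairs is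
    the dual Coxeter number minus 2. The commutator of the subgroups of a_i and b - a_i involves a
    structure constant bounded by the ratio of squared lengths of b and a_i, at most 2, or 3 for
    G_2. It must be invertible, whence the conditions on p. If <b, c^vee> = -1 for some root c, then
    e_b lies in a standard representation of the SL2 of c, whose torus scales it by all units. In
    types A_1 and C_m no such c exists; the SL2 of b itself, where e_b has weight 2, gives only
    squares, whence the factor 1/2. *)

(** The existence theorem for commuting matrices is applied to their restrictions to [W], written in
    the basis [row_base W]. *)
Lemma common_eigenvector_in (C : numClosedFieldType) (n : nat)
    (W : 'M[C]_n) (As : seq 'M[C]_n) :
    W != 0 -> {in As, forall A, stablemx W A} ->
    {in As &, forall A B, comm_mx A B} ->
  exists2 v : 'rV_n, v != 0 & (v <= W)%MS /\ {in As, forall A, stablemx v A}.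
Proof.
move=> W0 stW cA.
have [||v v0 /allP vP] := @common_eigenvector C (\rank W)
    [seq conjmx (row_base W) A | A <- As].
- by rewrite lt0n mxrank_eq0.
- move=> _ _ /mapP[A Ain ->] /mapP[B Bin ->].
  rewrite /comm_mx -!conjmxM ?inE ?stablemx_row_base ?stW //.
  by rewrite (cA A B).
exists (v *m row_base W); first by rewrite mulmx_free_eq0 ?row_base_free.
split; first by rewrite mulmx_sub // eq_row_base.
move=> A Ain; rewrite -stablemx_restrict ?stW //.
by apply: vP; apply/mapP; exists A.
Qed.

(** Eigenvectors of distinct systems are linearly independent, as for a single matrix: a factor
    [M k - chi i k], at an index [k] separating i from j, kills [v i] but not [v j]. *)
Lemma leq_card_eigensystems (C : fieldType) (J K : finType) (d : nat)
    (M : K -> 'M[C]_d) (chi : J -> K -> C) :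
    (forall j, exists2 v : 'rV_d, v != 0 & forall k, v *m M k = chi j k *: v) ->
    (forall i j, i != j -> exists k, chi i k != chi j k) ->
  (#|J| <= d)%N.
Proof.
move=> ev sep.
have {ev} [v vP] : {v : J -> 'rV_d & forall j, v j != 0 /\
    forall k, v j *m M k = chi j k *: v j}.
  apply: (@choice _ _ (fun j v => v != 0 /\ forall k, v *m M k = chi j k *: v)).
  by move=> j; have [v v0 vM] := ev j; exists v.
have {sep} [s sP] : {s : J * J -> option K & forall ij, ij.1 != ij.2 ->
    exists2 k, s ij = Some k & chi ij.1 k != chi ij.2 k}.
  apply: (@choice _ _ (fun ij k => ij.1 != ij.2 -> exists2 k', k = Some k' &
    chi ij.1 k' != chi ij.2 k')) => -[i j] /=; have [/sep[k kP]|/negbNE/eqP->] := boolP (i != j).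
    by exists (Some k) => _; exists k.
  by exists None => /eqP.
pose V := \matrix_(i < #|J|) v (enum_val i).
suff: row_free V by move/eqP => <-; exact: rank_leq_col.
rewrite -kermx_eq0; apply/eqP/row_matrixP => r; rewrite row0.
set u := row r _; have uV : u *m V = 0.
  by apply: sub_kermxP; exact: row_sub.
apply/rowP => j; rewrite [RHS]mxE.
pose Tm (i : J) : 'M[C]_d := if s (enum_val j, i) is Some k
  then M k - (chi i k)%:M else 1%:M.
(* The product of the Tm i over i != j kills every v i except v j. *)
pose c (l i : J) : C := if s (enum_val j, i) is Some k
  then chi l k - chi i k else 1.
have vT l i : v l *m Tm i = c l i *: v l.
  rewrite /Tm /c; case: (s _) => [k|]; last by rewrite mulmx1 scale1r.
  by rewrite mulmxBr (vP l).2 mul_mx_scalar scalerBl.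
pose T (r : seq J) := foldr (fun i B => Tm i *m B) 1%:M r.
have vTr l rr : v l *m T rr = (\prod_(i <- rr) c l i) *: v l.
  elim: rr => [|i rr IH] /=; first by rewrite big_nil mulmx1 scale1r.
  by rewrite mulmxA vT -scalemxAl IH scalerA big_cons.
pose rr := [seq i <- enum J | i != enum_val j].
have := congr1 (mulmx^~ (T rr)) uV; rewrite mul0mx => /eqP.
rewrite -mulmxA mulmx_sum_row (bigD1 j) //= big1 => [|i ij]; last first.
  rewrite row_mul rowK vTr (bigD1_seq (enum_val i)) /=; first last.
  - by rewrite filter_uniq // enum_uniq.
  - by rewrite mem_filter mem_enum andbT (inj_eq enum_val_inj).
  rewrite /c; have [|k -> _] := sP (enum_val j, enum_val i).
    by rewrite /= (inj_eq enum_val_inj) eq_sym.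
  by rewrite subrr mul0r scale0r scaler0.
rewrite addr0 row_mul rowK vTr scalerA scaler_eq0 (negPf (vP _).1) orbF mulf_eq0.
case/orP => [/eqP//|]; rewrite prodf_seq_eq0 => /hasP[l].
rewrite mem_filter /c => /andP[lj _].
have [|k -> /=] := sP (enum_val j, l); first by rewrite /= eq_sym.
by rewrite subr_eq0 => /negPf->.
Qed.

(** * Eigenvalue systems of a Heisenberg group over a finite ring *)

Section HeisenbergBound.

Variables (C : numClosedFieldType) (A : finComUnitRingType) (I : finType).
Variables (d : nat) (x : A -> 'M[C]_d) (y z : I -> A -> 'M[C]_d).
Variables (c : I -> A) (T : {set A}) (t0 : A).

Hypotheses (x0 : x 0 = 1%:M) (xD : forall s t, x (s + t) = x s *m x t).
Hypothesis xy : forall i s t, x s *m y i t = y i t *m x s.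
Hypothesis yy : forall i j s t, y i s *m y j t = y j t *m y i s.
Hypothesis xz : forall i s t, x s *m z i t = z i t *m x s.
Hypothesis yz : forall i j s t, i != j -> y i s *m z j t = z j t *m y i s.
Hypothesis yzx : forall i s t, y i s *m z i t = x (c i * t * s) *m z i t *m y i s.
Hypothesis y_unit : forall i t, y i t \in unitmx.
Hypothesis z_unit : forall i t, z i t \in unitmx.
Hypothesis c_unit : forall i, c i \is a GRing.unit.
Hypothesis t0_socle : forall s, s != 0 -> exists r, s * r = t0.
Hypothesis T_unit : {in T, forall u, u \is a GRing.unit}.
Hypothesis T_conj : forall u, u \in T ->
  exists2 g : 'M[C]_d, g \in unitmx & forall t, g *m x t = x (u * t) *m g.
Hypothesis x_t0 : x t0 != 1%:M.

Definition x_char (psi : A -> C) (v : 'rV[C]_d) :=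
  v != 0 /\ forall t, v *m x t = psi t *: v.

Lemma x_char0 psi v : x_char psi v -> psi 0 = 1.
Proof.
case=> v0 vP; have := vP 0; rewrite x0 mulmx1 => /eqP.
rewrite -subr_eq0 -{1}[v]scale1r -scalerBl scaler_eq0 (negPf v0) orbF.
by rewrite subr_eq0 => /eqP.
Qed.

Lemma x_charD psi v s t : x_char psi v -> psi (s + t) = psi s * psi t.
Proof.
case=> v0 vP; apply/eqP; rewrite -subr_eq0; have := vP (s + t).
rewrite xD mulmxA vP -scalemxAl vP scalerA => /eqP.
rewrite eq_sym -subr_eq0 -scalerBl scaler_eq0 (negPf v0) orbF //.
Qed.

Lemma x_charN psi v t : x_char psi v -> psi t * psi (- t) = 1.
Proof. by move=> vP; rewrite -(x_charD _ _ vP) subrr (x_char0 vP). Qed.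

Lemma x_char_neq0 psi v t : x_char psi v -> psi t != 0.
Proof.
move=> vP; apply/eqP => p0; have := x_charN t vP.
by rewrite p0 mul0r => /eqP; rewrite eq_sym oner_eq0.
Qed.

(** A nonzero difference [s - s'] would divide [t0], and [psi] would be trivial at [t0]. *)
Lemma x_char_primitive psi v s s' : x_char psi v -> psi t0 != 1 ->
  (forall t, psi (s * t) = psi (s' * t)) -> s = s'.
Proof.
move=> vP pt0 ss'; apply/eqP; rewrite -subr_eq0; apply: contraNT pt0 => /t0_socle.
case=> r <-; rewrite mulrBl (x_charD _ _ vP) ss' -(x_charD _ _ vP) subrr.
by rewrite (x_char0 vP).
Qed.

(** An eigenvector in the image of [x t0 - 1] works: eigenvalue 1 there would mean a nontrivial
    Jordan block, impossible for a matrix of finite order in characteristic 0. *)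
Lemma xt0_eigenvector : exists2 v : 'rV[C]_d, v != 0 &
  exists2 a, a != 1 & v *m x t0 = a *: v.
Proof.
have W0 : x t0 - 1%:M != 0 by rewrite subr_eq0.
have [||v v0 [/submxP[w vE] st]] := @common_eigenvector_in _ _ _ [:: x t0] W0.
- by move=> B; rewrite inE => /eqP->; apply/submxP; exists (x t0);
    rewrite mulmxBl mulmxBr mulmx1 mul1mx.
- by move=> B B'; rewrite !inE => /eqP-> /eqP->.
have /eigenvectorP[a /eigenspaceP va] := st (x t0) (mem_head _ _).
exists v => //; exists a => //; apply: contra_neq v0 => a1.
move: va; rewrite a1 scale1r => va.
(* As [v = w (x t0 - 1)] is fixed by [x t0], the orbit of [w] is an arithmetic progression of
   difference [v]; the finite order of [t0] makes it return to [w]. *)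
have vn k : w *m x (t0 *+ k) = w + v *+ k.
  elim: k => [|k IH]; first by rewrite x0 mulmx1 addr0.
  rewrite mulrSr xD mulmxA IH mulmxDl -scaler_nat -scalemxAl va.
  rewrite mulrSr addrA scaler_nat addrAC; congr (_ + _).
  by rewrite vE mulmxBr mulmx1 addrC subrK.
have [n n0 nt] : exists2 n, (0 < n)%N & t0 *+ n = 0.
  exists #|A| => //; first by apply/card_gt0P; exists t0.
  (* Translation by [t0] permutes A, so adding [t0] once per element leaves the sum of all elements
     unchanged. *)
  apply: (addrI (\sum_(a : A) a)); rewrite addr0 -sumr_const -big_split /=.
  by rewrite [RHS](reindex_inj (addIr t0)).
have := vn n; rewrite nt x0 mulmx1 => /eqP.
rewrite eq_sym -subr_eq0 addrAC subrr add0r -scaler_nat scaler_eq0 pnatr_eq0.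
by rewrite -leqn0 leqNgt n0 => /eqP.
Qed.

Lemma joint_eigenvector (W : 'M[C]_d) : W != 0 ->
  (forall t, stablemx W (x t)) -> (forall i t, stablemx W (y i t)) ->
  exists2 v : 'rV[C]_d, v != 0 & (v <= W)%MS /\ exists psi chi,
    (forall t, v *m x t = psi t *: v) /\
    (forall i t, v *m y i t = chi i t *: v).
Proof.
move=> W0 Wx Wy.
pose As := [seq x t | t <- enum A] ++ [seq y p.1 p.2 | p <- enum {: I * A}].
have AsP B : B \in As -> (exists t, B = x t) \/ (exists i t, B = y i t).
  by rewrite mem_cat => /orP[] /mapP[p _ ->]; [left|right]; [exists p|exists p.1, p.2].
have xAs t : x t \in As by rewrite mem_cat map_f ?mem_enum.
have yAs i t : y i t \in As.
  by rewrite mem_cat; apply/orP; right; apply/mapP; exists (i, t); rewrite ?mem_enum.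
have xx s t : x s *m x t = x t *m x s by rewrite -!xD addrC.
have [||v v0 [vW vst]] := @common_eigenvector_in _ _ _ As W0.
- by move=> B /AsP[[t ->]|[i [t ->]]].
- move=> B B' /AsP[[t ->]|[i [t ->]]] /AsP[[t' ->]|[i' [t' ->]]];
    rewrite /comm_mx //.
exists v => //; split=> //.
have ev (K : Type) (M : K -> 'M[C]_d) : (forall k, M k \in As) ->
    {f : K -> C & forall k, v *m M k = f k *: v}.
  move=> MAs; apply: (@choice _ _ (fun k a => v *m M k = a *: v)) => k.
  by have /eigenvectorP[a /eigenspaceP va] := vst _ (MAs k); exists a.
have [psi psiP] := ev _ _ xAs.
have [chi chiP] := ev _ (fun p : I * A => y p.1 p.2) (fun p => yAs p.1 p.2).
by exists psi, (fun i t => chi (i, t)); split=> // i t; rewrite -chiP.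
Qed.

Lemma nontrivial_x_char : exists2 psi, psi t0 != 1 & exists v, x_char psi v.
Proof.
have [v v0 [a a1 va]] := xt0_eigenvector.
pose W := eigenspace (x t0) a.
have vW : (v <= W)%MS by apply/eigenspaceP.
have [|||w w0 [wW [psi [chi [psiP _]]]]] := @joint_eigenvector W.
- by apply: contraNneq v0 => W0; move: vW; rewrite W0 submx0.
- by move=> t; apply: comm_mx_stable_eigenspace; rewrite /comm_mx -!xD addrC.
- by move=> i t; apply: comm_mx_stable_eigenspace; rewrite /comm_mx xy.
exists psi; last by exists w.
suff -> : psi t0 = a by [].
move/eigenspaceP: wW; rewrite psiP => /eqP.
by rewrite -subr_eq0 -scalerBl scaler_eq0 (negPf w0) orbF subr_eq0 => /eqP.
Qed.

(** The [y i t] commute with all [x t] and therefore preserve the common eigenspace of [psi]. *)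
Lemma x_char_joint psi v : x_char psi v -> exists chi,
  exists2 w : 'rV[C]_d, x_char psi w & forall i t, w *m y i t = chi i t *: w.
Proof.
case=> v0 vP; pose W := (\bigcap_t eigenspace (x t) (psi t))%MS.
have vW : (v <= W)%MS by apply/sub_bigcapmxP => t _; apply/eigenspaceP.
have stW B : (forall t, comm_mx (x t) B) -> stablemx W B.
  move=> cB; apply/sub_bigcapmxP => t _.
  apply: submx_trans (comm_mx_stable_eigenspace (psi t) (cB t)).
  by apply: submxMr; apply: (bigcapmx_inf t).
have [|||w w0 [wW [psi' [chi [psiP chiP]]]]] := @joint_eigenvector W.
- by apply: contraNneq v0 => W0; move: vW; rewrite W0 submx0.
- by move=> t; apply: stW => s; rewrite /comm_mx -!xD addrC.
- by move=> i t; apply: stW => s; rewrite /comm_mx xy.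
exists chi, w => //; split=> // t; apply/eigenspaceP.
by apply: submx_trans wW _; apply: (bigcapmx_inf t).
Qed.

(** Multiply [w] by [z j (f j)] for one [j] after another: each factor affects only the eigenvalues
    of [y j], through the commutator [x (c j * f j * t)]. Solving for the action of [y j] inverts
    this scalar, hence the minus sign. *)
Lemma y_shift psi chi w (f : I -> A) : x_char psi w ->
    (forall i t, w *m y i t = chi i t *: w) ->
  exists2 w' : 'rV[C]_d, x_char psi w' &
    forall i t, w' *m y i t = (chi i t * psi (- (c i * f i * t))) *: w'.
Proof.
move=> wx wy.
suff: forall r : seq I, uniq r -> exists2 w' : 'rV[C]_d, x_char psi w' &
    forall i t, w' *m y i t =
      (chi i t * psi (- (if i \in r then c i * f i * t else 0))) *: w'.
  case/(_ (enum I) (enum_uniq I)) => w' w'x w'y; exists w' => // i t.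
  by rewrite w'y mem_enum.
elim=> [_|j r IH /= /andP[jr /IH[w' w'x w'y]]].
  by exists w => // i t; rewrite in_nil oppr0 (x_char0 wx) mulr1.
have w'z : x_char psi (w' *m z j (f j)).
  have [w'0 w'P] := w'x; split=> [|t]; last first.
    by rewrite -mulmxA -xz mulmxA w'P scalemxAl.
  apply: contra_neq w'0 => /(congr1 (mulmx^~ (invmx (z j (f j))))).
  by rewrite -mulmxA mulmxV // mulmx1 mul0mx.
exists (w' *m z j (f j)) => // i t; rewrite inE.
have [->|ij] := eqVneq i j; last first.
  by rewrite -mulmxA -yz // mulmxA w'y -scalemxAl.
rewrite orTb; have := w'y j t; rewrite (negPf jr) oppr0 (x_char0 wx) mulr1 => w'yj.
apply: (scalerI (x_char_neq0 (c j * f j * t) wx)); rewrite scalerA mulrCA.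
rewrite (x_charN _ wx) mulr1.
have := congr1 (mulmx w') (yzx j t (f j)); rewrite !mulmxA w'yj w'x.2 => e.
by rewrite !scalemxAl -e.
Qed.

Theorem heisenberg_bound : (#|T| * #|A| ^ #|I| <= d)%N.
Proof.
have [psi pt0 [v vx]] := nontrivial_x_char.
(* The vector [v *m g] has the character [psi (u * _)]. The dummy pair for [u] outside [T] makes the
   statement total, as [choice] requires. *)
have w_ex (u : A) : exists w : ('rV[C]_d * (I -> A -> C)), u \in T ->
    x_char (fun t => psi (u * t)) w.1 /\ forall i t, w.1 *m y i t = w.2 i t *: w.1.
  have [uT|_] := boolP (u \in T); last by exists (0, fun _ _ => 0).
  have [g g_unit gP] := T_conj uT.
  have vg : x_char (fun t => psi (u * t)) (v *m g).
    have [v0 vP] := vx; split=> [|t]; last by rewrite -mulmxA gP mulmxA vP scalemxAl.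
    apply: contra_neq v0 => /(congr1 (mulmx^~ (invmx g))).
    by rewrite -mulmxA mulmxV // mulmx1 mul0mx.
  by have [chi [w wx wy]] := x_char_joint vg; exists (w, chi).
have [w wP] := choice w_ex.
pose J := {: {u : A | u \in T} * {ffun I -> A}}.
pose sys (j : J) (k : A + I * A) : C := match k with
  | inl t => psi (val j.1 * t)
  | inr it => (w (val j.1)).2 it.1 it.2 * psi (val j.1 * - (c it.1 * j.2 it.1 * it.2))
  end.
suff: (#|J| <= d)%N by rewrite card_prod card_sig card_ffun.
apply: (@leq_card_eigensystems _ _ _ _
  (fun k => match k with inl t => x t | inr it => y it.1 it.2 end) sys).
  case=> [[u uT] f]; have [wx wy] := wP u uT.
  have [w' [w'0 w'x] w'y] := y_shift f wx wy.
  by exists w' => // -[t|[i t]] /=; rewrite ?w'x ?w'y.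
case=> [[u uT] f] [[u' u'T] f'] neq; apply/existsP; rewrite -negb_forall.
apply: contra neq => /forallP /= e.
have uu' : u = u'.
  by apply: (x_char_primitive vx pt0) => t; have /eqP := e (inl t).
subst u'; have <- : uT = u'T by exact: bool_irrelevance.
suff -> : f = f' by [].
have [wx wy] := wP u uT.
(* Primitivity of [psi] recovers the product of [u], [c i] and [f i], and the first two are
   units. *)
apply/ffunP => i; have unit_uc := T_unit uT.
apply: (mulrI (c_unit i)); apply: (mulrI unit_uc); apply: oppr_inj.
apply: (x_char_primitive vx pt0) => t.
have := e (inr (i, t)); rewrite /= -subr_eq0 -mulrBr mulf_eq0 orbC subr_eq0.
rewrite !mulNr -!mulrA !mulrN => /orP[/eqP->//|/eqP chi0].
(* A zero eigenvalue would contradict the invertibility of [y i t]. *)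
have [wv0 _] := wx; case/eqP: wv0; rewrite -[LHS]mulmx1 -(mulmxV (y_unit i t)).
by rewrite mulmxA wy chi0 scale0r mul0mx.
Qed.

End HeisenbergBound.

(** * Quotients of rings of integers *)

Section Valuation.

Variable F : localField.
Implicit Types (x y z : F) (M N : int).
Local Notation v := (@lf_val F).
Local Notation vge := (valge v).

Lemma valge0 N : vge N 0. Proof. by rewrite /valge eqxx. Qed.

Lemma valgeM M N x y : vge M x -> vge N y -> vge (M + N) (x * y).
Proof.
rewrite /valge; have [->|x0] /= := eqVneq x 0; first by rewrite mul0r eqxx.
have [->|y0] /= := eqVneq y 0; first by rewrite mulr0 eqxx.
by move=> hx hy; rewrite lf_valM // lerD ?orbT.
Qed.

Lemma valge_le M N x : M <= N -> vge N x -> vge M x.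
Proof. by move=> MN /orP[x0|Nx]; rewrite /valge ?x0 // (le_trans MN) ?orbT. Qed.

Lemma valgeN N x : vge N x -> vge N (- x).
Proof.
move=> xN; rewrite -mulN1r -[N]add0r; apply: valgeM => //.
by rewrite /valge lf_valN1 lexx orbT.
Qed.

Lemma valge_div N x y : y != 0 -> vge (v y + N) x -> vge N (x / y).
Proof.
move=> y0; rewrite /valge mulf_eq0 invr_eq0 (negPf y0) orbF.
have [//|x0] /= := eqVneq x 0.
have -> : v x = v (x / y * y) by rewrite divfK.
by rewrite lf_valM ?mulf_neq0 ?invr_eq0 // addrC lerD2r.
Qed.

Lemma lf_valX x k : x != 0 -> v (x ^+ k) = v x *+ k.
Proof.
move=> x0; elim: k => [|k IH]; first by rewrite expr0 lf_val1.
by rewrite exprS lf_valM ?expf_neq0 // IH mulrS.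
Qed.

Local Notation O := (ringOfIntegers F).

Lemma roi_val_inj : injective (@roi_val F). Proof. exact: val_inj. Qed.
Lemma roi_valM : {morph @roi_val F : a b / a * b}. Proof. exact: (rmorphM val). Qed.
Lemma roi_valD : {morph @roi_val F : a b / a + b}. Proof. exact: (rmorphD val). Qed.
Lemma roi_valB : {morph @roi_val F : a b / a - b}. Proof. exact: (rmorphB val). Qed.
Lemma roi_val1 : roi_val (1 : O) = 1. Proof. exact: (rmorph1 val). Qed.
Lemma roi_valX m : {morph @roi_val F : a / a ^+ m}.
Proof. exact: (rmorphXn val). Qed.
Lemma roi_val_sum (I : Type) (r : seq I) (P : pred I) (f : I -> O) :
  roi_val (\sum_(i <- r | P i) f i) = \sum_(i <- r | P i) roi_val (f i).
Proof. exact: (rmorph_sum val). Qed.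

Lemma roi_valge (a : O) : vge 0 (roi_val a).
Proof. by have := valP a; rewrite inE. Qed.

Lemma valge_roi x : vge 0 x -> exists a : O, roi_val a = x.
Proof. by move=> x0; have xO : x \in @lf_int F by []; exists (Sub x xO). Qed.

Lemma roi_uniformizer : exists w : O, roi_val w != 0 /\ v (roi_val w) = 1.
Proof.
have [x x0 vx] := lf_uniformizer F.
by have [|a ax] := @valge_roi x; [rewrite /valge vx orbT|exists a; rewrite ax].
Qed.

Lemma roi_div (a b : O) (N : nat) : roi_val b != 0 -> vge (v (roi_val b) + N%:Z) (roi_val a) ->
  exists2 c : O, a = b * c & vge N (roi_val c).
Proof.
move=> b0 /(valge_div b0) h.
have [|c cE] := @valge_roi (roi_val a / roi_val b); first exact: valge_le h.
exists c; last by rewrite cE.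
by apply: roi_val_inj; rewrite roi_valM cE mulrCA divff // mulr1.
Qed.

(** Division by a uniformizer lowers the valuation by one, so a single product, rather than a sum of
    several, realizes each element of large valuation. *)
Lemma ideal_expP n (a : O) : ideal_exp (@primeIdeal F) n a <-> vge n (roi_val a).
Proof.
elim: n a => [|n IH] a /=; first by split=> // _; exact: roi_valge.
split=> [[s sP ->]|an].
  rewrite roi_val_sum /=; elim: s sP => [|u s IHs] sP.
    by rewrite big_nil valge0.
  rewrite big_cons; apply: lf_valD; last first.
    by apply: IHs => u' u's; apply: sP; rewrite inE u's orbT.
  have [u1 /IH u2] := sP u (mem_head _ _).
  by rewrite intS; exact: valgeM.
have [w [w0 vw]] := roi_uniformizer.
have [|c -> cn] := @roi_div a w n w0; first by rewrite vw -intS.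
exists [:: (w, c)]; last by rewrite big_seq1.
move=> u; rewrite inE => /eqP-> /=; split; last exact/IH.
by rewrite /primeIdeal /valge vw lexx orbT.
Qed.

End Valuation.

(** * Units, smallest nonzero ideal and cardinality of O/p^n *)

Section ResidueRing.

Variables (F : localField) (p l q n : nat).
Hypotheses (p_prime : prime p) (q_def : q = (p ^ l)%N) (n_ge1 : (1 <= n)%N).
Variables (k : finFieldType) (res : {rmorphism ringOfIntegers F -> k}).
Hypotheses (res_quo : is_quotient_ring (@primeIdeal F) res) (k_card : #|k| = q).
Variables (A : finComUnitRingType) (pi : {rmorphism ringOfIntegers F -> A}).
Hypothesis pi_quo : is_quotient_ring (ideal_exp (@primeIdeal F) n) pi.

Local Notation O := (ringOfIntegers F).
Local Notation v := (@lf_val F).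
Local Notation vge := (valge v).

Lemma pi_eq0 (a : O) : pi a = 0 <-> vge n (roi_val a).
Proof. by rewrite -ideal_expP; exact: pi_quo.2. Qed.

Lemma pi_unit (a : O) : ~~ vge 1 (roi_val a) -> pi a \is a GRing.unit.
Proof.
move=> a1; have a0 : roi_val a != 0.
  by apply: contraNneq a1 => ->; exact: valge0.
have va : v (roi_val a) = 0.
  have := roi_valge a; move: a1; rewrite /valge (negPf a0) /= -ltNge => h1 h0.
  by apply/eqP; rewrite eq_le h0 andbT -ltzD1 add0r.
have [|c ac _] := @roi_div F 1 a 0 a0; first by rewrite va /valge lf_val1 orbT.
by apply/unitrPr; exists (pi c); rewrite -rmorphM -ac rmorph1.
Qed.

Lemma pi_unitE (a : O) : (pi a \is a GRing.unit) = ~~ vge 1 (roi_val a).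
Proof.
apply/idP/idP; last exact: pi_unit.
move=> /unitrPr[b]; have [c <-] := pi_quo.1 b; rewrite -rmorphM => /eqP.
rewrite -subr_eq0 -(rmorph1 pi) -rmorphB => /eqP/pi_eq0 h.
apply/negP => a1; have : vge 1 (roi_val (1 : O)).
  have -> : 1 = a * c - (a * c - 1) :> O by rewrite opprB addrC subrK.
  rewrite roi_valB; apply: lf_valD.
    by rewrite roi_valM -[1]addr0; apply: valgeM => //; exact: roi_valge.
  by apply: valgeN; apply: valge_le h; rewrite lez_nat.
by rewrite /valge roi_val1 oner_eq0 lf_val1.
Qed.

(** The non-units are the images of the elements of positive valuation, which are closed under
    addition. *)
Lemma unitr_local (a b : A) :
  a + b \is a GRing.unit -> (a \is a GRing.unit) || (b \is a GRing.unit).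
Proof.
have [x <-] := pi_quo.1 a; have [y <-] := pi_quo.1 b.
rewrite -rmorphD !pi_unitE -negb_and; apply: contra => /andP[x1 y1].
by rewrite roi_valD; exact: lf_valD.
Qed.

(** The residue field has characteristic [p], so the residue of [N] is nonzero. *)
Lemma natr_unit N : (0 < N < p)%N -> N%:R \is a @GRing.unit A.
Proof.
case/andP=> N0 Np; rewrite -(rmorph_nat pi) pi_unitE.
apply/negP => /(res_quo.2 N%:R).2/eqP; rewrite rmorph_nat.
rewrite -(dvdn_pcharf (p := p)); first by rewrite gtnNdvd.
by apply: (@card_finPcharP _ p l) => //; rewrite k_card.
Qed.

(** Take the image of [w ^+ n.-1]: an element with nonzero image has valuation at most n - 1 and
    hence divides this power. *)
Lemma socle_element : exists2 t0 : A, t0 != 0 & forall s, s != 0 -> exists r, s * r = t0.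
Proof.
have [w [w0 vw]] := roi_uniformizer F.
exists (pi (w ^+ n.-1)) => [|s].
  apply: contra_eqN (erefl true) => /eqP/pi_eq0.
  rewrite roi_valX /= /valge expf_eq0 (negPf w0) andbF lf_valX // vw natz /=.
  by rewrite lez_nat; case: (n) n_ge1 => // n' _; rewrite ltnn.
have [a <-] := pi_quo.1 s => an.
have : ~~ vge n (roi_val a) by apply: contra_neqN an => /pi_eq0.
rewrite /valge negb_or => /andP[a0]; rewrite -ltNge => va.
have [|c -> _] := @roi_div F (w ^+ n.-1) a 0 a0; last by exists (pi c); rewrite rmorphM.
rewrite roi_valX /= /valge lf_valX // vw addr0; apply/orP; right.
by rewrite natz; move: n_ge1 va; clear; lia.
Qed.

(** Expansions in powers of a uniformizer, with digits lifted by a set-theoretic section. The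
    leading digit is kept apart because a nonzero one gives a unit. Injectivity suffices for lower
    bounds on cardinalities. *)
Lemma digits_inj : exists2 f : k * {ffun 'I_n.-1 -> k} -> A, injective f &
  forall a, a.1 != 0 -> f a \is a GRing.unit.
Proof.
have [sg sgP] := choice res_quo.1.
have [w [w0 vw]] := roi_uniformizer F.
pose dig (a : k * {ffun 'I_n.-1 -> k}) (i : nat) : k :=
  if i is i'.+1 then oapp a.2 0 (insub i') else a.1.
pose g (a : k * {ffun 'I_n.-1 -> k}) : O := \sum_(i < n) sg (dig a i) * w ^+ i.
have vw_dvd z (i : nat) : vge i.+1 (roi_val (z * w ^+ i)) -> vge 1 (roi_val z).
  rewrite roi_valM roi_valX /valge mulf_eq0 expf_eq0 (negPf w0) andbF orbF.
  have [//|z0 /=] := eqVneq (roi_val z) 0.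
  by rewrite lf_valM ?expf_neq0 // lf_valX // vw natz intS lerD2r.
have wX i : vge i%:Z (roi_val (w ^+ i)).
  by rewrite roi_valX /valge lf_valX // vw natz lexx orbT.
have res1 x : res x != 0 -> ~~ vge 1 (roi_val x).
  by apply: contraNN => /(res_quo.2 x).2 ->.
exists (pi \o g) => [a b /= /eqP|a a0 /=]; last first.
  apply: pi_unit; apply: res1; rewrite /g.
  rewrite (bigD1 (Ordinal n_ge1)) //= rmorphD mulr1 sgP rmorph_sum big1 ?addr0 //.
  move=> i; case: i => -[//|i] ilt _ /=; rewrite exprS mulrCA rmorphM.
  rewrite (_ : res w = 0) ?mul0r //.
  by apply/(res_quo.2 w); rewrite /primeIdeal /valge /= vw lexx orbT.
rewrite -subr_eq0 -rmorphB /g -sumrB => /eqP/pi_eq0 gab.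
(* When the lower digits agree, only the terms of degree i survive modulo [w ^+ i.+1], so the lifted
   i-th digits have equal residues. *)
have digE i : (i < n)%N -> dig a i = dig b i.
  elim/ltn_ind: i => i IH ilt; pose j := Ordinal ilt.
  apply/eqP; rewrite -subr_eq0; apply: contraTT isT => ne0.
  rewrite -(sgP (dig a i)) -(sgP (dig b i)) -rmorphB in ne0.
  have /negP[] := res1 _ ne0; apply: (@vw_dvd _ i).
  move: gab; rewrite (bigD1 j) // -mulrBl roi_valD => gab.
  rewrite -[roi_val _](addrK (roi_val (\sum_(i0 < n | i0 != j)
     (sg (dig a i0) * w ^+ i0 - sg (dig b i0) * w ^+ i0)))).
  apply: lf_valD; first by apply: valge_le gab; rewrite lez_nat.
  apply: valgeN; rewrite roi_val_sum; elim/big_ind: _ => [||m mj].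
  - exact: valge0.
  - by move=> x y; exact: lf_valD.
  have [mi|im] := ltnP m i; first by rewrite IH // subrr; exact: valge0.
  rewrite -mulrBl roi_valM; apply: (@valge_le _ _ (0 + m%:Z)).
    by rewrite add0r lez_nat ltn_neqAle im andbT; apply: contra mj => /eqP e; apply/eqP/val_inj.
  by apply: valgeM; [exact: roi_valge | exact: wX].
case: a b {gab} digE => [a f] [b f'] digE; congr (_, _); first exact: (digE 0%N).
apply/ffunP => i; have := digE i.+1; rewrite /dig /= insubT // => ilt'.
rewrite (_ : Sub _ _ = i) /=; last exact: val_inj.
by apply; rewrite -ltn_predRL.
Qed.

Lemma card_residue_ring : (q ^ n <= #|A|)%N.
Proof.
have [f f_inj _] := digits_inj; have := leq_card f f_inj.
by rewrite card_prod card_ffun card_ord k_card -expnS prednK.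
Qed.

Lemma card_residue_units :
  (q ^ n - q ^ n.-1 <= #|[set u : A | u \is a GRing.unit]|)%N.
Proof.
have [f f_inj fU] := digits_inj.
rewrite -{1}(prednK n_ge1) expnS -{2}[(q ^ _)%N]mul1n -mulnBl.
pose D := [set a : k * {ffun 'I_n.-1 -> k} | a.1 != 0].
have -> : ((q - 1) * q ^ n.-1 = #|D|)%N.
  have -> : D = setX [set~ 0] [set: {ffun 'I_n.-1 -> k}].
    by apply/setP => a; rewrite !inE andbT.
  by rewrite cardsX cardsC1 k_card subn1 cardsT card_ffun card_ord k_card.
rewrite -(card_imset (mem D) f_inj); apply/subset_leq_card/subsetP => _ /imsetP[a aD ->].
by move: aD; rewrite !inE; exact: fU.
Qed.

(** The fibres of squaring have at most two elements: in (u - u0)(u + u0) = 0 one factor is a unit,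
    since A is local and the factors differ by the unit 2 u0. *)
Lemma card_unit_squares : (2 < p)%N ->
  (#|[set u : A | u \is a GRing.unit]| <=
   2 * #|[set u ^+ 2 | u in [set u : A | u \is a GRing.unit]]|)%N.
Proof.
move=> p2; set U := [set u : A | _].
rewrite -sum1_card (partition_big_imset (fun u => u ^+ 2)) /= mulnC -sum_nat_const.
apply: leq_sum => _ /imsetP[u0 u0U ->]; rewrite sum1dep_card.
apply: leq_trans (_ : #|[set u0; - u0]| <= _)%N; last by rewrite cards2; case: (_ != _).
apply/subset_leq_card/subsetP => u; rewrite !inE in u0U *.
case/andP=> uU /eqP e.
have e0 : (u - u0) * (u + u0) = 0 by rewrite -subr_sqr e subrr.
have : (u + u0) + - (u - u0) \is a GRing.unit.
  have -> : (u + u0) + - (u - u0) = 2%:R * u0 by ring.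
  by rewrite unitrM u0U andbT natr_unit.
case/unitr_local/orP => [h|]; last rewrite unitrN => h.
  by rewrite -subr_eq0 (_ : u - u0 = 0) ?eqxx //; apply: (mulIr h); rewrite e0 mul0r.
by rewrite -addr_eq0 (_ : u + u0 = 0) ?eqxx ?orbT //; apply: (mulrI h); rewrite e0 mulr0.
Qed.

End ResidueRing.

(** * General linear groups and divided powers *)

Section ToGL.

Variable A : finComUnitRingType.

(* The junk value is 1 when M is not invertible. *)
Definition toGL n (M : 'M[A]_n) : {'GL_n[A]} :=
  insubd (1%g : {'GL_n[A]}) (conform_mx 1%:M M).

Lemma toGLE n (M : 'M[A]_n) : (0 < n)%N -> M \in unitmx ->
  GLval (toGL M) = conform_mx 1%:M M.
Proof.
by case: n M => // n M _ uM; rewrite [LHS]val_insubd conform_mx_id;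
  rewrite -[_ \is a _]/(M \in unitmx) uM.
Qed.

Lemma toGLM n (M M' : 'M[A]_n) : (0 < n)%N -> M \in unitmx -> M' \in unitmx ->
  toGL (M *m M') = (toGL M * toGL M')%g.
Proof.
move=> n0 uM uM'; apply: val_inj.
have uMM' : M *m M' \in unitmx by rewrite unitmx_mul uM.
transitivity (GLval (toGL M) * GLval (toGL M')); last by [].
transitivity (GLval (toGL (M *m M'))); first by [].
rewrite !toGLE //; case: n M M' {uM uM' uMM'} n0 => // n M M' _.
by rewrite !conform_mx_id.
Qed.

Lemma toGL1 n : (0 < n)%N -> toGL (1%:M : 'M[A]_n) = 1%g.
Proof.
move=> n0; apply: (mulgI (toGL (1%:M : 'M[A]_n))).
by rewrite mulg1 -toGLM ?unitmx1 // mulmx1.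
Qed.

Lemma toGL_inj n (M M' : 'M[A]_n) : (0 < n)%N -> M \in unitmx -> M' \in unitmx ->
  toGL M = toGL M' -> M = M'.
Proof.
move=> n0 uM uM' /(congr1 (@GLval _ _)); rewrite !toGLE //.
by case: n M M' n0 {uM uM'} => // n M M' _; rewrite !conform_mx_id.
Qed.

End ToGL.

(** Cauchy product of truncated series: the antidiagonals of index below 2n cover the n by n square,
    and the terms outside it vanish. *)
Lemma big_triangle (V : zmodType) (n : nat) (F : nat -> nat -> V) :
  (forall i j, (n <= i)%N || (n <= j)%N -> F i j = 0) ->
  \sum_(m < n + n) \sum_(j < m.+1) F (m - j)%N j = \sum_(i < n) \sum_(j < n) F i j.
Proof.
move=> F0.
transitivity (\sum_(m < n + n) \sum_(j < n | (j <= m)%N) F (m - j)%N j).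
  apply: eq_bigr => m _.
  rewrite (big_ord_widen_cond (n + n) (fun j => j <= m)%N (fun j => F (m - j)%N j)) ?leq_addr //.
  rewrite (big_ord_widen_cond (n + n) xpredT (fun j => F (m - j)%N j)) //=.
  rewrite big_mkcond [RHS]big_mkcond.
  apply: eq_bigr => j _; rewrite ltnS; have [jm|//] := leqP j m.
  by case: ltnP => // nj; rewrite F0 // nj orbT.
rewrite (exchange_big_dep xpredT) //= [RHS]exchange_big /=.
apply: eq_bigr => j _.
have jn := ltn_ord j.
rewrite -(big_mkord (fun m => j <= m)%N (fun m => F (m - j)%N j)).
rewrite (big_cat_nat (n := j)) //=; last by rewrite (leq_trans (ltnW jn)) ?leq_addr.
rewrite big_nat_cond big_pred0 ?add0r => [|m]; last first.
  by apply/negP => /andP[/andP[_ mj]]; rewrite leqNgt mj.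
rewrite big_nat_cond (eq_bigl (fun m => (j <= m < n + n)%N)) => [|m]; last first.
  by case: (j <= m)%N; rewrite ?andbF ?andbT.
rewrite -big_nat -{1}[val j]add0n big_addn (eq_bigr (fun m => F m j)) => [|m _];
  last by rewrite addnK.
rewrite (big_cat_nat (n := n)) //=; last first.
  by rewrite leq_subRL ?(leq_trans (ltnW jn)) ?leq_addr // leq_add2r ltnW.
rewrite big_mkord [X in _ + X = _]big_nat [X in _ + X = _]big1 ?addr0 // => m /andP[nm _].
by rewrite F0 // nm.
Qed.

(** * Truncated exponentials in characteristic zero *)

Section TruncatedExp.

Variables (K : fieldType) (L : algType K) (n : nat).
Hypothesis fact_neq0 : forall k, k`!%:R != 0 :> K.

Definition texp (x : L) : L := \sum_(k < n) (k`!%:R^-1 : K) *: x ^+ k.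

(** A priori [x + y] has a larger nilpotency index than [x] and [y]; the last condition makes
    truncation at [n] harmless for it too, and then the binomial formula applies. *)
Lemma texpD (x y : L) : GRing.comm x y -> x ^+ n = 0 -> y ^+ n = 0 ->
  (x + y) ^+ n = 0 -> texp (x + y) = texp x * texp y.
Proof.
move=> cxy xn yn xyn.
have nil z k : z ^+ n = 0 -> (n <= k)%N -> z ^+ k = 0 :> L.
  by move=> zn nk; rewrite -(subnKC nk) exprD zn mul0r.
pose F i j := ((i`!%:R^-1 * j`!%:R^-1) : K) *: (x ^+ i * y ^+ j).
transitivity (\sum_(i < n) \sum_(j < n) F i j); last first.
  rewrite /texp big_distrl; apply: eq_bigr => i _ /=; rewrite big_distrr.
  by apply: eq_bigr => j _; rewrite /= /F -scalerAl -scalerAr scalerA.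
rewrite -big_triangle => [|i j]; last first.
  by case/orP => nk; rewrite /F (nil _ _ _ nk) // ?mul0r ?mulr0 scaler0.
transitivity (\sum_(m < n + n) (m`!%:R^-1 : K) *: (x + y) ^+ m).
  rewrite big_split_ord /= [X in _ = _ + X]big1 ?addr0 // => i _.
  by rewrite (nil _ _ xyn) ?scaler0 // leq_addr.
apply: eq_bigr => m _; rewrite exprDn_comm // scaler_sumr; apply: eq_bigr => j _.
rewrite -scaler_nat scalerA /F; congr (_ *: _).
have jm : (j <= m)%N by rewrite -ltnS.
have bin0 : 'C(m, j)%:R != 0 :> K.
  by apply: contraNneq (fact_neq0 m) => b0; rewrite -(bin_fact jm) natrM b0 mul0r.
by rewrite -(bin_fact jm) !natrM; field; rewrite bin0 !fact_neq0.
Qed.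

End TruncatedExp.

(* A matrix identity that is natural in the commutative ring and in two
   parameters s, t can be checked over the fraction field of Z[s, t]. *)
Lemma universal_mx_identity (m : nat) (E E' : forall S : comNzRingType, S -> S -> 'M[S]_m) :
    (forall (S S' : comNzRingType) (f : {rmorphism S -> S'}) s t,
       map_mx f (E S s t) = E S' (f s) (f t)) ->
    (forall (S S' : comNzRingType) (f : {rmorphism S -> S'}) s t,
       map_mx f (E' S s t) = E' S' (f s) (f t)) ->
    (forall (K : fieldType) (s t : K), (forall k, k`!%:R != 0 :> K) -> E K s t = E' K s t) ->
  forall S s t, E S s t = E' S s t.
Proof.
move=> natE natE' EK S s t.
(* The outer variable stands for [s], the inner one for [t]. *)
pose P := {poly {poly int}}.
have EP : E P 'X ('X%:P) = E' P 'X ('X%:P).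
  have inj : injective (map_mx (@tofrac P) : 'M_m -> 'M_m).
    move=> M M' /matrixP e1; apply/matrixP => i j; have := e1 i j.
    by rewrite !mxE => /eqP; rewrite tofrac_eq => /eqP.
  apply: inj; rewrite natE natE'; apply: EK => k.
  rewrite -(rmorph_nat (@tofrac P)) tofrac_eq0 -polyC_natr -(rmorph_nat polyC).
  by rewrite polyC_eq0 polyC_eq0 pnatr_eq0 -lt0n fact_gt0.
have ct : commr_rmorph (intmul 1 : int -> S) t by move=> x; exact: mulrC.
pose f1 := horner_morph ct.
have cs : commr_rmorph f1 s by move=> x; exact: mulrC.
pose f := horner_morph cs.
have fX : f 'X = s := horner_morphX cs.
have fY : f 'X%:P = t by rewrite [LHS](horner_morphC cs) [LHS](horner_morphX ct).
by rewrite -fX -fY -natE -natE' EP.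
Qed.

(** * Integral divided powers and their exponentials over any ring *)

Section DividedPowers.

Variable n : nat.
Implicit Types (U V W : nat -> 'M[int]_n) (M Z : 'M[int]_n) (S : comNzRingType).

(** [U k] models ad(e_a)^k / k! as an integer matrix, which has a meaning over every ring, even
    where k! is not invertible. *)
Definition divided_powers U : Prop :=
  (forall k, U 1%N ^+ k = U k *+ k`!) /\ (forall k, (n <= k)%N -> U k = 0).

Definition mxint S M : 'M[S]_n := map_mx intr M.

(** This is exp(r U_1), written without denominators. *)
Definition osum U S (r : S) : 'M[S]_n := \sum_(k < n) r ^+ k *: mxint S (U k).

Lemma mxint_tfree M M' k : (0 < k)%N -> M *+ k = M' *+ k -> M = M'.
Proof.
move=> k0 e; apply/matrixP => i j; have /matrixP/(_ i j) := e.
by rewrite !mulmxnE => /eqP; rewrite eqr_pMn2r // => /eqP.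
Qed.

Lemma mxintM S M M' : mxint S (M *m M') = mxint S M *m mxint S M'.
Proof. exact: map_mxM. Qed.

Lemma mxintD S M M' : mxint S (M + M') = mxint S M + mxint S M'.
Proof. exact: map_mxD. Qed.

Lemma mxintB S M M' : mxint S (M - M') = mxint S M - mxint S M'.
Proof. exact: map_mxB. Qed.

Lemma mxintN S M : mxint S (- M) = - mxint S M.
Proof. exact: map_mxN. Qed.

Lemma mxintMz S M (z : int) : mxint S (M *~ z) = z%:~R *: mxint S M.
Proof. by apply/matrixP => i j; rewrite -scaler_int intz !mxE rmorphM. Qed.

Lemma mxintMn S M k : mxint S (M *+ k) = k%:R *: mxint S M.
Proof. by rewrite [M *+ k]pmulrn mxintMz. Qed.

Lemma mxintX S M k : mxint S (M ^+ k) = mxint S M ^+ k.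
Proof.
elim: k => [|k IH]; first by rewrite !expr0 /mxint map_mx1.
by rewrite !exprS mxintM IH.
Qed.

Lemma osumE U S (r : S) N : divided_powers U -> (n <= N)%N ->
  osum U r = \sum_(k < N) r ^+ k *: mxint S (U k).
Proof.
move=> [_ U0] nN; rewrite -(subnKC nN) big_split_ord /= [X in _ + X]big1 ?addr0 // => k _.
by rewrite U0 ?leq_addr // /mxint map_mx0 scaler0.
Qed.

Lemma map_osum U S S' (f : {rmorphism S -> S'}) (r : S) :
  map_mx f (osum U r) = osum U (f r).
Proof.
apply/matrixP => i j; rewrite mxE !summxE rmorph_sum; apply: eq_bigr => k _.
by rewrite !mxE rmorphM rmorphXn /= rmorph_int.
Qed.

Lemma divided_powers0 U : divided_powers U -> U 0%N = 1.
Proof. by case=> Uk _; have := Uk 0%N; rewrite expr0 fact0 mulr1n. Qed.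

Lemma divided_powers_comm U M k : divided_powers U -> GRing.comm (U 1%N) M ->
  GRing.comm (U k) M.
Proof.
case=> Uk _ c1; apply: (@mxint_tfree _ _ k`!); first exact: fact_gt0.
by rewrite -mulrnAl -mulrnAr -Uk; apply: commr_sym; apply: commrX; apply: commr_sym.
Qed.

Lemma osum_comm U V S (r s : S) : divided_powers U -> divided_powers V ->
  GRing.comm (U 1%N) (V 1%N) -> osum U r *m osum V s = osum V s *m osum U r.
Proof.
move=> dU dV c1; rewrite /osum mulmx_suml mulmx_sumr; apply: eq_bigr => k _.
rewrite mulmx_suml mulmx_sumr; apply: eq_bigr => l _.
rewrite -!scalemxAl -!scalemxAr !scalerA mulrC -!mxintM; congr (_ *: mxint _ _).
apply: divided_powers_comm => //; apply: commr_sym; apply: divided_powers_comm => //.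
Qed.

(** This is U^(j+1) M = M U^(j+1) + (j+1) Z U^j for U = [U 1], divided by a factorial; the division
    is legitimate because integer matrices have no torsion. *)
Lemma divided_powers_conj U M Z k : divided_powers U ->
  U 1%N * M = M * U 1%N + Z -> GRing.comm (U 1%N) Z ->
  U k.+1 * M = M * U k.+1 + Z * U k.
Proof.
move=> dU UM UZ; have [Uk _] := dU.
suff e j : U 1%N ^+ j.+1 * M = M * U 1%N ^+ j.+1 + (Z * U 1%N ^+ j) *+ j.+1.
  apply: (@mxint_tfree _ _ k.+1`!); first exact: fact_gt0.
  rewrite mulrnDl -mulrnAl -!mulrnAr -Uk e; congr (_ + _).
  by rewrite factS mulnC mulrnA -mulrnAr -Uk mulrnAr.
elim: j => [|j IH]; first by rewrite expr1 expr0 mulr1 mulr1n.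
rewrite exprS -mulrA IH mulrDr mulrA UM mulrDl -mulrA -exprS -addrA; congr (_ + _).
by rewrite mulrnAr mulrA UZ -mulrA -exprS -mulrS.
Qed.

(** Conjugation by exp(rU) is exp(r ad U), and its series stops after the linear term because U
    commutes with Z. *)
Lemma osum_conj U M Z S (r : S) : divided_powers U ->
  U 1%N * M = M * U 1%N + Z -> GRing.comm (U 1%N) Z ->
  osum U r *m mxint S M = (mxint S M + r *: mxint S Z) *m osum U r.
Proof.
move=> dU UM UZ; rewrite mulmxDl -scalemxAl.
have e1 := osumE r dU (leqnSn n).
rewrite {1 2}e1 /osum mulmx_suml !mulmx_sumr !big_ord_recl /= -addrA; congr (_ + _).
  by rewrite -scalemxAl -scalemxAr -!mxintM divided_powers0 // mulmx1 mul1mx.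
rewrite scaler_sumr -big_split; apply: eq_bigr => k _ /=.
rewrite -scalemxAl -!scalemxAr scalerA -exprS -scalerDr -!mxintM -mxintD.
by congr (_ *: mxint _ _); exact: divided_powers_conj.
Qed.

Lemma osum0 U S : divided_powers U -> osum U (0 : S) = 1%:M.
Proof.
move=> dU; rewrite (osumE 0 dU (leqnSn n)) big_ord_recl expr0 scale1r.
rewrite big1 ?addr0 => [|k _]; last by rewrite expr0n scale0r.
by rewrite divided_powers0 // /mxint map_mx1.
Qed.

End DividedPowers.

(** * The Heisenberg relation over fields of characteristic zero *)

Section FieldOsum.

Variables (n : nat) (K : fieldType).
Hypothesis fact_neq0 : forall k, k`!%:R != 0 :> K.
Implicit Types (U V W : nat -> 'M[int]_n.+1).

Lemma osum_texp U (r : K) : divided_powers U ->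
  osum U r = texp n.+1 (r *: mxint K (U 1%N)) /\ (r *: mxint K (U 1%N)) ^+ n.+1 = 0.
Proof.
move=> [Uk U0]; have UX k : mxint K (U 1%N) ^+ k = k`!%:R *: mxint K (U k).
  by rewrite -mxintX Uk mxintMn.
split; last by rewrite exprZn UX U0 // /mxint map_mx0 !scaler0.
apply: eq_bigr => k _; rewrite exprZn UX !scalerA; congr (_ *: _); field.
exact: fact_neq0.
Qed.

Lemma osumD_field U (r s : K) : divided_powers U ->
  osum U (r + s) = osum U r *m osum U s.
Proof.
move=> dU; have [-> z1] := osum_texp (r + s) dU.
have [-> z2] := osum_texp r dU; have [-> z3] := osum_texp s dU.
rewrite scalerDl in z1 *; apply: texpD => //.
by rewrite /GRing.comm -!scalerAl -!scalerAr !scalerA mulrC.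
Qed.

(** Conjugation by exp(rU) sends sV to sV + zrsW, and the exponential of this sum factors because V
    and W commute. *)
Lemma osum_heisenberg_field U V W (z : int) (r s : K) : divided_powers U ->
    divided_powers V -> divided_powers W ->
    U 1%N * V 1%N = V 1%N * U 1%N + W 1%N *~ z -> GRing.comm (U 1%N) (W 1%N) ->
    GRing.comm (V 1%N) (W 1%N) ->
  osum U r *m osum V s = osum W (z%:~R * r * s) *m osum V s *m osum U r.
Proof.
move=> dU dV dW UV UW VW; set T := osum U r.
have T_unit : T *m osum U (- r) = 1%:M by rewrite -osumD_field // subrr osum0.
have [eV Vn] := osum_texp s dV; have [eW Wn] := osum_texp (z%:~R * r * s) dW.
set v := s *: _ in eV Vn; set w := (_ * s) *: _ in eW Wn.
have Tv : T * v = (w + v) * T.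
  have UZ : GRing.comm (U 1%N) (W 1%N *~ z).
    by rewrite /GRing.comm mulrzAr UW mulrzAl.
  rewrite -scalerAr [T * _](osum_conj r dU UV UZ) mxintMz scalerAl; congr (_ * _).
  by rewrite scalerDr !scalerA addrC /w /v; congr (_ *: _ + _); ring.
have Tvk k : T * v ^+ k = (w + v) ^+ k * T.
  elim: k => [|k IH]; first by rewrite !expr0 mulr1 mul1r.
  by rewrite exprSr mulrA IH -mulrA Tv mulrA -exprSr.
(* [w + v] is conjugate to [v], so it satisfies the nilpotency condition of [texpD]. *)
have wvn : (w + v) ^+ n.+1 = 0.
  have := Tvk n.+1; rewrite Vn mulr0 => /esym/(congr1 (fun M => M * osum U (- r))).
  by rewrite mul0r -mulrA [T * _]T_unit mulr1.
rewrite eW eV -[texp _ w *m _]texpD //; last first.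
  rewrite /GRing.comm /w /v -!scalerAl -!scalerAr !scalerA mulrC.
  by congr (_ *: _); rewrite -[_ * _](mxintM K) -[RHS](mxintM K); congr mxint; rewrite -[LHS]VW.
rewrite /texp mulmx_sumr mulmx_suml; apply: eq_bigr => k _.
by rewrite -scalemxAr -scalemxAl; congr (_ *: _); exact: Tvk.
Qed.

End FieldOsum.

Lemma osumD (n : nat) (U : nat -> 'M[int]_n) (S : comNzRingType) (r s : S) :
  divided_powers U -> osum U (r + s) = osum U r *m osum U s.
Proof.
case: n U => [|n] U dU; first by apply/matrixP => -[].
apply: (universal_mx_identity (E := fun S r s => osum U (r + s))
  (E' := fun S r s => osum U r *m osum U s)) => [S1 S2 f s1 s2|S1 S2 f s1 s2|K s1 s2 K0].
- by rewrite map_osum rmorphD.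
- by rewrite map_mxM !map_osum.
exact: osumD_field.
Qed.

Lemma osum_heisenberg (n : nat) (U V W : nat -> 'M[int]_n) (z : int)
    (S : comNzRingType) (r s : S) :
    divided_powers U -> divided_powers V -> divided_powers W ->
    U 1%N *m V 1%N = V 1%N *m U 1%N + W 1%N *~ z -> comm_mx (U 1%N) (W 1%N) ->
    comm_mx (V 1%N) (W 1%N) ->
  osum U r *m osum V s = osum W (z%:~R * r * s) *m osum V s *m osum U r.
Proof.
case: n U V W => [|n] U V W dU dV dW UV UW VW; first by apply/matrixP => -[].
apply: (universal_mx_identity (E := fun S r s => osum U r *m osum V s)
  (E' := fun S r s => osum W (z%:~R * r * s) *m osum V s *m osum U r)) =>
  [S1 S2 f s1 s2|S1 S2 f s1 s2|K s1 s2 K0].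
- by rewrite map_mxM !map_osum.
- by rewrite !map_mxM !map_osum !rmorphM rmorph_int.
exact: osum_heisenberg_field.
Qed.

(** * Conjugation by a root subgroup inside its sl2-triple *)

Section SL2.

Variables (n : nat) (U : nat -> 'M[int]_n) (M Z : 'M[int]_n).
Hypotheses (dU : divided_powers U) (UM : U 1%N * M = M * U 1%N + Z).
Hypothesis UZ : U 1%N * Z = Z * U 1%N - U 1%N *+ 2.

Lemma osum_conj_cartan (S : comNzRingType) (r : S) :
  osum U r *m mxint S Z = (mxint S Z - (2 * r) *: mxint S (U 1%N)) *m osum U r.
Proof.
have -> : mxint S Z - (2 * r) *: mxint S (U 1%N) =
    mxint S Z + r *: mxint S (- U 1%N *+ 2).
  congr (_ + _); rewrite mxintMn mxintN !scalerN scalerA; congr (- (_ *: _)).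
  exact: mulrC.
apply: osum_conj => //; first by rewrite mulNrn.
by rewrite /GRing.comm mulrnAr mulrnAl mulrN mulNr.
Qed.

(** [U], [Z], [M] play the roles of e, h, f in sl2: from [e, f] = h and [e, h] = -2e, the series
    exp(r ad e) f stops at f + r h - r^2 e. *)
Lemma osum_conj_opposite (S : comNzRingType) (r : S) :
  osum U r *m mxint S M =
  (mxint S M + r *: mxint S Z - r ^+ 2 *: mxint S (U 1%N)) *m osum U r.
Proof.
have [Uk _] := dU.
have e1 k : U 1%N ^+ k.+2 * M = M * U 1%N ^+ k.+2 + Z * U 1%N ^+ k.+1 *+ k.+2 -
    U 1%N ^+ k.+1 *+ (k.+2 * k.+1).
  elim: k => [|k IH].
    rewrite expr2 expr1 -mulrA UM mulrDr mulrA UM UZ mulrDl -mulrA.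
    by rewrite [Z * _ *+ 2]mulr2n !addrA.
  transitivity (U 1%N * (U 1%N ^+ k.+2 * M)); first by rewrite mulrA -exprS.
  rewrite IH mulrBr mulrDr (mulrA _ M) UM mulrDl -mulrA -exprS.
  rewrite !mulrnAr (mulrA _ Z) UZ mulrBl -[Z * _ * _]mulrA mulrnAl -!exprS mulrnBl -mulrnA.
  rewrite -!addrA; congr (_ + _); rewrite !addrA -mulrS -!addrA -opprD -mulrnDr.
  by do 3!congr (_ + _); congr (- (_ *+ _)); lia.
have e2 k : U k.+2 * M = M * U k.+2 + Z * U k.+1 - U 1%N * U k.
  apply: (@mxint_tfree _ _ _ k.+2`!); first exact: fact_gt0.
  rewrite mulrnBl mulrnDl -mulrnAl -2!mulrnAr -Uk e1; congr (_ + _ - _).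
    by rewrite factS mulnC mulrnA -Uk mulrnAr.
  by rewrite !factS [in RHS]mulnA [in RHS]mulnC [RHS]mulrnA -mulrnAr -Uk exprS.
(* The sums are taken with n + 2, n + 1 and n terms, all equal since [U k] vanishes from n on, so
   that the shifted indices match term by term. *)
have E2 := osumE r dU (leq_trans (leqnSn n) (leqnSn n.+1)).
have E1 := osumE r dU (leqnSn n).
have U0 : U 0%N = 1%:M by exact: divided_powers0.
pose F (X : 'M[int]_n) (m : nat) i := \sum_(k < m) r ^+ k *: mxint S (X *m U (i + k)%N).
have mF X m : mxint S X *m \sum_(k < m) r ^+ k *: mxint S (U k) = F X m 0%N.
  by rewrite mulmx_sumr; apply: eq_bigr => k _; rewrite -scalemxAr -mxintM.
have FS X m i : F X m.+1 i = mxint S (X *m U i) + r *: F X m i.+1.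
  rewrite /F big_ord_recl expr0 scale1r addn0 scaler_sumr; congr (_ + _).
  by apply: eq_bigr => k _; rewrite scalerA -exprS addSnnS.
rewrite mulmxBl mulmxDl -!scalemxAl {2}E2 {2}E1 /osum !mF !FS.
have -> : (\sum_(k < n) r ^+ k *: mxint S (U k)) *m mxint S M =
    \sum_(k < n.+2) r ^+ k *: mxint S (U k *m M).
  by rewrite -/(osum U r) E2 mulmx_suml; apply: eq_bigr => k _; rewrite -scalemxAl -mxintM.
rewrite !big_ord_recl /= expr0 expr1 !scale1r U0 mulmx1 mul1mx [U 1%N *m M]UM mxintD mulmx1.
have -> : \sum_(i < n) r ^+ (bump 0 (bump 0 i)) *: mxint S (U (bump 0 (bump 0 i)) *m M) =
    r ^+ 2 *: (F M n 2 + F Z n 1 - F (U 1%N) n 0).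
  rewrite /F -big_split -sumrB scaler_sumr; apply: eq_bigr => k _ /=.
  rewrite [_ *m M](e2 k) mxintB mxintD -scalerDr -scalerBr scalerA -exprD.
  by congr (_ ^+ _ *: _); lia.
rewrite !scalerDr !scalerN !scalerA -expr2 !addrA; congr (_ - _).
by rewrite -!addrA [X in _ = _ + (_ + X)]addrCA.
Qed.

End SL2.

(** * Long roots and Heisenberg pairs by type *)

Section Paths.

Variable X : dynkin.
Local Notation a := (cartan_entry X).

(* A sequence of indices stands for the corresponding sum of simple roots. *)
Definition pairing (s : seq nat) (j : nat) : int := foldr (fun i z => a i j + z) 0 s.

(** By the root string property, adding at most -<s, a_j^vee> copies of a_j to a root s gives roots.
    Several copies may be added at once: when the pairing is -2, it becomes 0 after one copy, which
    would not permit the second. *)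
Inductive root_path (b : nat) : seq nat -> Prop :=
  | RootPath0 : root_path b [:: b]
  | RootPathS s s' j m of root_path b s & (j < dynkin_rank X)%N & m%:Z <= - pairing s j
      & perm_eq s' (nseq m j ++ s) : root_path b s'.

Lemma pairing_cons i s j : pairing (i :: s) j = a i j + pairing s j.
Proof. by []. Qed.

Lemma root_path1 b s j : root_path b s -> (j < dynkin_rank X)%N -> pairing s j <= -1 ->
  root_path b (j :: s).
Proof. by move=> bs jr sj; apply: (@RootPathS b s (j :: s) j 1); rewrite ?perm_refl //; lia. Qed.

Lemma root_path_mem b s : root_path b s -> b \in s.
Proof.
elim=> [|{}s s' j m _ bs _ _ /perm_mem ->]; first exact: mem_head.
by rewrite mem_cat bs orbT.
Qed.

Lemma root_path_lt b s : (b < dynkin_rank X)%N -> root_path b s ->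
  {in s, forall i, (i < dynkin_rank X)%N}.
Proof.
move=> br; elim=> [i|{}s s' j m _ IH jr _ /perm_mem sE i]; first by rewrite inE => /eqP->.
by rewrite sE mem_cat => /orP[/nseqP[->]|/IH].
Qed.

(** Sorting gives each multiset a single representative, so that [undup] removes repetitions. As
    [Negz m] is -(m+1), the multiplicities run from 1 to m+1. *)
Definition root_path_step (s : seq nat) : seq (seq nat) :=
  flatten [seq [seq sort leq (nseq m j ++ s) |
    m <- iota 1 (if pairing s j is Negz m then m.+1 else 0)] | j <- iota 0 (dynkin_rank X)].

Fixpoint root_paths (fuel : nat) (todo : seq (seq nat)) : seq (seq nat) :=
  if fuel is fuel'.+1 then
    todo ++ root_paths fuel' (undup (flatten [seq root_path_step s | s <- todo]))
  else [::].

Lemma root_pathsP b fuel todo : {in todo, forall s, root_path b s} ->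
  {in root_paths fuel todo, forall s, root_path b s}.
Proof.
elim: fuel todo => // fuel IH todo todoP s; rewrite mem_cat => /orP[/todoP//|].
apply: IH => {}s; rewrite mem_undup => /flatten_mapP[s0 /todoP s0P].
case/flatten_mapP=> j; rewrite mem_iota => /= jr /mapP[m]; rewrite mem_iota => mP ->.
apply: (RootPathS s0P jr (m := m)); last by rewrite perm_sort.
by move: mP; case: (pairing s0 j) => k; rewrite ?NegzE; lia.
Qed.

(** Distinctness is required up to permutation because a list stands for the sum of its simple
    roots. *)
Definition heisenberg_paths (b k : nat) : Prop :=
  exists L : seq (seq nat), [/\ uniq L, {in L &, forall s s', perm_eq s s' -> s = s'},
    size L = k & {in L, forall s, root_path b s /\ pairing s b = 1}].

(** A breadth-first search: each level adds at least one simple root, and the fuel 40 exceeds the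
    height 29 of the highest root of E_8. *)
Lemma heisenberg_paths_compute (b k : nat) :
  let L := [seq s <- undup (root_paths 40 [:: [:: b]]) | pairing s b == 1] in
  (size L == k) && all (sorted leq) L -> heisenberg_paths b k.
Proof.
move=> L /andP[/eqP sL sorted_L]; exists L; split=> //.
- by rewrite filter_uniq ?undup_uniq.
- move=> s s' /(allP sorted_L) ss /(allP sorted_L) ss'.
  exact: (sorted_eq leq_trans anti_leq).
move=> s; rewrite mem_filter mem_undup => /andP[/eqP sb sP]; split=> //.
by apply: root_pathsP sP => s0; rewrite inE => /eqP->; exact: RootPath0.
Qed.

(* kn j stands for the inverse of the squared length of the j-th simple root. *)
Definition length_ratio (b : nat) (r : int) : Prop :=
  forall kn : nat -> int, (forall j, (j < dynkin_rank X)%N -> 0 < kn j) ->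
    (forall i j, (i < dynkin_rank X)%N -> (j < dynkin_rank X)%N ->
       a i j * kn i = a j i * kn j) ->
  forall j, (j < dynkin_rank X)%N -> kn b <= kn j /\ kn j <= r * kn b.

End Paths.

Lemma heisenberg_paths_E6 : heisenberg_paths TypeE6 0 10.
Proof. by apply: heisenberg_paths_compute; vm_compute. Qed.
Lemma heisenberg_paths_E7 : heisenberg_paths TypeE7 0 16.
Proof. by apply: heisenberg_paths_compute; vm_compute. Qed.
Lemma heisenberg_paths_E8 : heisenberg_paths TypeE8 0 28.
Proof. by apply: heisenberg_paths_compute; vm_compute. Qed.
Lemma heisenberg_paths_F4 : heisenberg_paths TypeF4 0 7.
Proof. by apply: heisenberg_paths_compute; vm_compute. Qed.
Lemma heisenberg_paths_G2 : heisenberg_paths TypeG2 1 2.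
Proof. by apply: heisenberg_paths_compute; vm_compute. Qed.

(** * Root lengths in the exceptional types *)

Section LengthRatio.

Variables (X : dynkin) (kn : nat -> int).
Hypothesis rel : forall i j, (i < dynkin_rank X)%N -> (j < dynkin_rank X)%N ->
  cartan_entry X i j * kn i = cartan_entry X j i * kn j.

Lemma single_edge i j : (i < dynkin_rank X)%N -> (j < dynkin_rank X)%N ->
  cartan_entry X i j = -1 -> cartan_entry X j i = -1 -> kn i = kn j.
Proof. by move=> ir jr ij ji; have := rel ir jr; rewrite ij ji !mulN1r => /oppr_inj. Qed.

Lemma multiple_edge (r : int) i j : (i < dynkin_rank X)%N -> (j < dynkin_rank X)%N ->
  cartan_entry X i j = - r -> cartan_entry X j i = -1 -> kn j = r * kn i.
Proof.
move=> ir jr ij ji; have := rel ir jr; rewrite ij ji mulN1r mulNr.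
by move/oppr_inj.
Qed.

End LengthRatio.

(** Edges force all values of [kn] to be equal. The constant 2 exceeds the true ratio 1, but it is
    the one of the doubly laced types and is still below [p]. *)
Lemma length_ratio_E8 : length_ratio TypeE8 0 2.
Proof.
move=> kn pos rel j /= jr; have k0 := pos 0%N isT.
have := @single_edge TypeE8 kn rel 0 2 isT isT erefl erefl.
have := @single_edge TypeE8 kn rel 1 3 isT isT erefl erefl.
have := @single_edge TypeE8 kn rel 2 3 isT isT erefl erefl.
have := @single_edge TypeE8 kn rel 3 4 isT isT erefl erefl.
have := @single_edge TypeE8 kn rel 4 5 isT isT erefl erefl.
have := @single_edge TypeE8 kn rel 5 6 isT isT erefl erefl.
have := @single_edge TypeE8 kn rel 6 7 isT isT erefl erefl.
by do 8?[case: j jr => [|j] jr; first lia]; lia.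
Qed.

Lemma length_ratio_E7 : length_ratio TypeE7 0 2.
Proof.
move=> kn pos rel j /= jr; have k0 := pos 0%N isT.
have := @single_edge TypeE7 kn rel 0 2 isT isT erefl erefl.
have := @single_edge TypeE7 kn rel 1 3 isT isT erefl erefl.
have := @single_edge TypeE7 kn rel 2 3 isT isT erefl erefl.
have := @single_edge TypeE7 kn rel 3 4 isT isT erefl erefl.
have := @single_edge TypeE7 kn rel 4 5 isT isT erefl erefl.
have := @single_edge TypeE7 kn rel 5 6 isT isT erefl erefl.
by do 7?[case: j jr => [|j] jr; first lia]; lia.
Qed.

Lemma length_ratio_E6 : length_ratio TypeE6 0 2.
Proof.
move=> kn pos rel j /= jr; have k0 := pos 0%N isT.
have := @single_edge TypeE6 kn rel 0 2 isT isT erefl erefl.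
have := @single_edge TypeE6 kn rel 1 3 isT isT erefl erefl.
have := @single_edge TypeE6 kn rel 2 3 isT isT erefl erefl.
have := @single_edge TypeE6 kn rel 3 4 isT isT erefl erefl.
have := @single_edge TypeE6 kn rel 4 5 isT isT erefl erefl.
by do 6?[case: j jr => [|j] jr; first lia]; lia.
Qed.

Lemma length_ratio_F4 : length_ratio TypeF4 0 2.
Proof.
move=> kn pos rel j /= jr; have k0 := pos 0%N isT.
have := @single_edge TypeF4 kn rel 0 1 isT isT erefl erefl.
have := @multiple_edge TypeF4 kn rel 2 1 2 isT isT erefl erefl.
have := @single_edge TypeF4 kn rel 2 3 isT isT erefl erefl.
by do 4?[case: j jr => [|j] jr; first lia]; lia.
Qed.

Lemma length_ratio_G2 : length_ratio TypeG2 1 3.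
Proof.
move=> kn pos rel j /= jr; have k1 := pos 1%N isT.
have := @multiple_edge TypeG2 kn rel 3 1 0 isT isT erefl erefl.
by do 2?[case: j jr => [|j] jr; first lia]; lia.
Qed.

(** * The classical types *)

Definition chain_entry (i j : nat) : int :=
  if i == j then 2 else if (i.+1 == j) || (j.+1 == i) then -1 else 0.

Lemma chain_entrySr i : chain_entry i i.+1 = -1.
Proof. by rewrite /chain_entry eqxx ltn_eqF. Qed.

Lemma chain_entrySl i : chain_entry i.+1 i = -1.
Proof. by rewrite /chain_entry eqxx orbT gtn_eqF. Qed.

Section Chains.

Variable X : dynkin.
Local Notation a := (cartan_entry X).
Local Notation pairing := (pairing X).

Fixpoint down_seq (k : nat) : seq nat := if k is k'.+1 then k :: down_seq k' else [:: 0%N].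

Lemma down_seqS k : down_seq k.+1 = k.+1 :: down_seq k.
Proof. by []. Qed.

Lemma size_down_seq k : size (down_seq k) = k.+1.
Proof. by elim: k => //= k ->. Qed.

Lemma mem_down_seq k j : (j \in down_seq k) = (j <= k)%N.
Proof. by elim: k => [|k IH] /=; rewrite inE ?IH ?leqn0 // [RHS]leq_eqVlt. Qed.

Lemma pairing_down_seq k j : (forall i, (i <= k)%N -> a i j = chain_entry i j) ->
  pairing (down_seq k) j = (j == 0)%N%:Z + (j == k)%:Z - (j == k.+1)%:Z.
Proof.
elim: k => [|k IH] aE /=; rewrite aE // /chain_entry.
  by do ?case: ifPn; lia.
by rewrite IH => [|i ik]; [do ?case: ifPn; lia | apply: aE; lia].
Qed.

Lemma pairing_down_seq0 k j : (forall i, (i <= k)%N -> a i j = 0) ->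
  pairing (down_seq k) j = 0.
Proof.
by elim: k => [|k IH] aE /=; rewrite aE // ?IH // => i ik; apply: aE; lia.
Qed.

Lemma root_path_down_seq k : (k < dynkin_rank X)%N ->
    (forall i j, (i < k)%N -> (j <= k)%N -> a i j = chain_entry i j) ->
  root_path X 0 (down_seq k).
Proof.
elim: k => [|k IH] kr aE /=; first exact: RootPath0.
apply: root_path1 => //; first by apply: IH => [|i j ik jk]; [lia|apply: aE; lia].
by rewrite pairing_down_seq => [|i ik]; [lia|apply: aE].
Qed.

(** In types B and D this leads from e_1 + e_m to the roots e_1 + e_j, in type C from 2 e_m to the
    roots e_j + e_m. *)
Fixpoint climb (s : seq nat) (t i : nat) : seq nat :=
  if i is i'.+1 then (t - i')%N :: climb s t i' else s.

Lemma size_climb s t i : size (climb s t i) = (size s + i)%N.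
Proof. by elim: i => [|i /= ->]; rewrite ?addn0 ?addnS. Qed.

Lemma sub_climb s t i : {subset s <= climb s t i}.
Proof. by elim: i => //= i IH j js; rewrite inE IH ?orbT. Qed.

Lemma pairing_climb s t i j : (forall i j, (i <= t)%N -> (j <= t)%N -> a i j = chain_entry i j) ->
  (i < t)%N -> (j < t - i)%N ->
  pairing (climb s t i.+1) j = pairing s j - (j == t - i.+1)%N%:Z.
Proof.
move=> aE; elim: i j => [|i IH] j it ji.
  by rewrite /= aE /chain_entry; try lia; do ?case: ifPn; lia.
by rewrite [LHS]/= [_ + pairing _ _]IH ?aE /chain_entry; try lia; do ?case: ifPn; lia.
Qed.

Lemma root_path_climb b s t k i : root_path X b s -> (t < dynkin_rank X)%N ->
    (forall i j, (i <= t)%N -> (j <= t)%N -> a i j = chain_entry i j) ->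
    pairing s t <= -1 -> (forall j, (k <= j < t)%N -> pairing s j = 0) ->
  (i + k <= t.+1)%N -> root_path X b (climb s t i).
Proof.
move=> bs tr aE st sj; elim: i => //= i IH ik; apply: root_path1; first by apply: IH; lia.
  by lia.
case: i IH ik => [|i] IH ik; first by rewrite subn0.
by rewrite pairing_climb; try lia; rewrite // sj; lia.
Qed.

End Chains.

Lemma uniq_map_inj (T T' : eqType) (f : T -> T') (s : seq T) :
  uniq (map f s) -> {in s &, injective f}.
Proof.
elim: s => //= x s IH /andP[fx us] y z; rewrite !inE.
move=> /orP[/eqP->|ys] /orP[/eqP->|zs] // e; last exact: IH.
  by move: fx; rewrite e map_f.
by move: fx; rewrite -e map_f.
Qed.

(** A permutation invariant with consecutive values along [L] shows at once that the multisets
    differ and how many there are. *)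
Lemma heisenberg_paths_uniq X b k (f : seq nat -> nat) (L : seq (seq nat)) :
    (forall s s', perm_eq s s' -> f s = f s') -> map f L = iota 2 k ->
    {in L, forall s, root_path X b s /\ pairing X s b = 1} ->
  heisenberg_paths X b k.
Proof.
move=> fP fL LP; have uL : uniq (map f L) by rewrite fL iota_uniq.
exists L; split=> //; first exact: map_uniq uL.
  by move=> s s' sL s'L /fP; exact: uniq_map_inj uL _ _ sL s'L.
by rewrite -(size_map f) fL size_iota.
Qed.

(** With b = e_1 - e_2, these are the roots e_1 - e_j for j > 2. *)
Lemma heisenberg_paths_A m : (0 < m)%N -> heisenberg_paths (TypeA m) 0 (m - 1).
Proof.
move=> m0; apply: (@heisenberg_paths_uniq _ _ _ size [seq down_seq k | k <- iota 1 (m - 1)]).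
- by move=> s s' /perm_size.
- by rewrite -map_comp (@eq_map _ _ _ (addn 1)) => [|k]; rewrite /= ?size_down_seq // -iotaDl.
move=> _ /mapP[k kP ->]; rewrite mem_iota in kP; split.
  by apply: root_path_down_seq => //=; lia.
by rewrite pairing_down_seq //; lia.
Qed.

Lemma chain_const (kn : nat -> int) K : (forall j, (j < K)%N -> kn j = kn j.+1) ->
  forall j, (j <= K)%N -> kn j = kn 0%N.
Proof. by move=> kE; elim=> // j IH jK; rewrite -kE // IH //; lia. Qed.

Lemma length_ratio_A m : (0 < m)%N -> length_ratio (TypeA m) 0 2.
Proof.
move=> m0 kn pos rel j /= jm; have k0 := pos 0%N m0.
rewrite (@chain_const kn m.-1); try lia.
move=> i im; apply: (@single_edge (TypeA m) kn rel);
  rewrite /= ?chain_entrySl ?chain_entrySr; try lia.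
  exact: chain_entrySr.
exact: chain_entrySl.
Qed.

Lemma cartan_entry_B m i j : (i <= m - 2)%N -> (j <= m - 2)%N ->
  cartan_entry (TypeB m) i j = chain_entry i j.
Proof.
move=> im jm; rewrite /cartan_entry /= /chain_entry; case: eqP => // _.
by case: ifPn => //; lia.
Qed.

(** With b = e_1 - e_2, these are e_1 and the roots e_1 - e_j, e_1 + e_j for j > 2. *)
Lemma heisenberg_paths_B m : (2 < m)%N -> heisenberg_paths (TypeB m) 0 (2 * m - 3).
Proof.
move=> m3; have t1 : (m - 2).+1 = (m - 1)%N by lia.
have aE i j : (i <= m - 2)%N -> (j <= m - 2)%N -> cartan_entry (TypeB m) i j = chain_entry i j.
  exact: cartan_entry_B.
have last_r i : (i < m - 2)%N -> cartan_entry (TypeB m) i (m - 1) = 0.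
  by move=> im; rewrite /cartan_entry /=; do ?case: ifPn; lia.
have last_l j : (j <= m - 2)%N -> cartan_entry (TypeB m) (m - 1) j = - (j == m - 2)%N%:Z.
  by move=> jm; rewrite /cartan_entry /=; do ?case: ifPn; lia.
have last2 : cartan_entry (TypeB m) (m - 2) (m - 1) = -2.
  by rewrite /cartan_entry /=; do ?case: ifPn; lia.
have p1 : pairing (TypeB m) (down_seq (m - 2)) (m - 1) = -2.
  have -> : (m - 2 = (m - 3).+1)%N by lia.
  rewrite /= -/(cartan_entry (TypeB m) _ _) pairing_down_seq0 => [|i im];
    last by apply: last_r; lia.
  by have := last2; rewrite (_ : m - 2 = (m - 3).+1)%N; [rewrite addr0|lia].
have rd k : (k <= m - 2)%N -> root_path (TypeB m) 0 (down_seq k).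
  by move=> km; apply: root_path_down_seq => /= [|i j ik jk]; [lia|apply: aE; lia].
pose s := [:: m - 1, m - 1 & down_seq (m - 2)]%N.
have rs : root_path (TypeB m) 0 s.
  (* Two copies of the short simple root e_m lead from e_1 - e_m to e_1 + e_m. *)
  apply: (RootPathS (m := 2) (rd _ (leqnn _)) (j := (m - 1)%N)).
  - by rewrite /=; lia.
  - by rewrite p1.
  exact: perm_refl.
have ps j : (j <= m - 2)%N -> pairing (TypeB m) s j = (j == 0)%N%:Z - (j == m - 2)%N%:Z.
  move=> jm; rewrite /s !pairing_cons pairing_down_seq => [|i im]; last exact: aE.
  by rewrite !last_l //; lia.
apply: (@heisenberg_paths_uniq _ _ _ size
  ([seq down_seq k | k <- iota 1 (m - 1)] ++ [seq climb s (m - 2) i | i <- iota 0 (m - 2)])).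
- by move=> s0 s' /perm_size.
- rewrite map_cat -!map_comp (@eq_map _ _ _ (addn 1)) => [|k]; last by rewrite /= size_down_seq.
  rewrite (@eq_map _ _ (_ \o _) (addn m.+1)) => [|i]; last first.
    by rewrite /= size_climb /= size_down_seq; lia.
  rewrite -!iotaDl (_ : 2 * m - 3 = (m - 1) + (m - 2))%N; last by lia.
  by rewrite iotaD; congr (_ ++ iota _ _); lia.
move=> s0; rewrite mem_cat => /orP[] /mapP[k kP ->{s0}]; rewrite mem_iota in kP.
  have [km|km] := leqP k (m - 2).
    split; first exact: rd.
    by rewrite pairing_down_seq => [|i ik]; [lia|apply: aE; lia].
  have -> : k = (m - 2).+1 by lia.
  have down1 : down_seq (m - 2).+1 = (m - 1)%N :: down_seq (m - 2) by rewrite /= t1.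
  rewrite down1; split; first by apply: root_path1 (rd _ _) _ _; rewrite ?p1 //=; lia.
  rewrite pairing_cons pairing_down_seq => [|i ik]; last exact: aE.
  by rewrite last_l //; lia.
split.
  apply: (@root_path_climb _ _ _ _ 2) => //.
  - by rewrite /=; lia.
  - by rewrite ps //; lia.
  - by move=> j /andP[j2 jm]; rewrite ps; lia.
  by lia.
case: k kP => [|k] kP; first by rewrite ps //; lia.
by rewrite pairing_climb // ?ps; lia.
Qed.

Lemma length_ratio_B m : (2 < m)%N -> length_ratio (TypeB m) 0 2.
Proof.
move=> m3 kn pos rel j; have k0 : 0 < kn 0%N by apply: pos => /=; lia.
have kc : forall i, (i <= m - 2)%N -> kn i = kn 0%N.
  apply: chain_const => i im; apply: (@single_edge (TypeB m) kn rel); rewrite ?cartan_entry_B;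
    rewrite ?chain_entrySl ?chain_entrySr /=; lia.
have kl : kn (m - 1)%N = 2 * kn (m - 2)%N.
  apply: (@multiple_edge (TypeB m) kn rel); rewrite /cartan_entry /=; try lia.
    by do ?case: ifPn; lia.
  by do ?case: ifPn; lia.
rewrite /= => jm; have [jl|jl] := leqP j (m - 2); first by rewrite kc //; lia.
by have -> : j = (m - 1)%N by [lia]; rewrite kl kc //; lia.
Qed.

Lemma cartan_entry_C m i j : (i <= m - 2)%N -> (j <= m - 2)%N ->
  cartan_entry (TypeC m) i j = chain_entry i j.
Proof.
move=> im jm; rewrite /cartan_entry /= /chain_entry; case: eqP => // _.
by case: ifPn => //; lia.
Qed.

Lemma cartan_entry_C_long m : (1 < m)%N ->
  cartan_entry (TypeC m) (m - 1) (m - 2) = -2 /\ cartan_entry (TypeC m) (m - 2) (m - 1) = -1.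
Proof. by move=> m2; split; rewrite /cartan_entry /=; do ?case: ifPn; lia. Qed.

(** With b = 2 e_m, these are the roots e_j + e_m for j < m. *)
Lemma heisenberg_paths_C m : (1 < m)%N -> heisenberg_paths (TypeC m) (m - 1) (m - 1).
Proof.
move=> m2; have [l1 l2] := cartan_entry_C_long m2.
have aE i j : (i <= m - 2)%N -> (j <= m - 2)%N -> cartan_entry (TypeC m) i j = chain_entry i j.
  exact: cartan_entry_C.
have last_l j : (j <= m - 2)%N ->
    cartan_entry (TypeC m) (m - 1) j = if j == (m - 2)%N then -2 else 0.
  by move=> jm; rewrite /cartan_entry /=; do ?case: ifPn; lia.
have last_r i : (i < m - 2)%N -> cartan_entry (TypeC m) i (m - 1) = 0.
  by move=> im; rewrite /cartan_entry /=; do ?case: ifPn; lia.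
have diag : cartan_entry (TypeC m) (m - 1) (m - 1) = 2 by rewrite /cartan_entry eqxx.
pose s := [:: (m - 1)%N].
have ps j : (j <= m - 2)%N -> pairing (TypeC m) s j = if j == (m - 2)%N then -2 else 0.
  by move=> jm; rewrite pairing_cons addr0 last_l.
have pl i : (0 < i < m)%N -> pairing (TypeC m) (climb s (m - 2) i) (m - 1) = 1.
  case: i => // i; elim: i => [|i IH] im.
    by rewrite /climb !pairing_cons subn0 l2 diag.
  have -> : climb s (m - 2) i.+2 = (m - 2 - i.+1)%N :: climb s (m - 2) i.+1 by [].
  by rewrite pairing_cons IH ?last_r; lia.
apply: (@heisenberg_paths_uniq _ _ _ size [seq climb s (m - 2) i | i <- iota 1 (m - 1)]).
- by move=> s0 s' /perm_size.
- rewrite -!map_comp (@eq_map _ _ _ (addn 1)) => [|i]; last by rewrite /= size_climb.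
  by rewrite -!iotaDl.
move=> s0 /mapP[k kP ->{s0}]; rewrite mem_iota in kP; split; last by apply: pl; lia.
apply: (@root_path_climb _ _ _ _ 0) => //.
- exact: RootPath0.
- by rewrite /=; lia.
- by rewrite ps // eqxx.
- by move=> j jm; rewrite ps; [case: eqP|]; lia.
by lia.
Qed.

Lemma length_ratio_C m : (1 < m)%N -> length_ratio (TypeC m) (m - 1) 2.
Proof.
move=> m2 kn pos rel j; have k0 : 0 < kn (m - 1)%N by apply: pos => /=; lia.
have kc : forall i, (i <= m - 2)%N -> kn i = kn 0%N.
  apply: chain_const => i im; apply: (@single_edge (TypeC m) kn rel); rewrite ?cartan_entry_C;
    rewrite ?chain_entrySl ?chain_entrySr /=; lia.
have [l1 l2] := cartan_entry_C_long m2.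
have kl : kn (m - 2)%N = 2 * kn (m - 1)%N.
  by apply: (@multiple_edge (TypeC m) kn rel) => //=; lia.
rewrite /= => jm; have [jl|jl] := leqP j (m - 2); last by have -> : j = (m - 1)%N by [lia]; lia.
by rewrite (kc j jl) -(kc (m - 2)%N) // kl; lia.
Qed.

Lemma cartan_entry_D m i j : cartan_entry (TypeD m) i j =
  if i == j then 2 else
  if [|| (j == i.+1) && (i < m - 2), (i == j.+1) && (j < m - 2),
      (i == m - 3) && (j == m - 1) | (j == m - 3) && (i == m - 1)]%N then -1 else 0.
Proof.
rewrite /cartan_entry; case: eqP => // ij.
have memE x y : ((x, y) \in rcons [seq (k, k.+1) | k <- iota 0 (m - 2)] (m - 3, m - 1)%N) =
    ((y == x.+1) && (x < m - 2) || (x == m - 3) && (y == m - 1))%N.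
  rewrite mem_rcons inE orbC xpair_eqE; congr (_ || _).
  apply/mapP/andP => [[k]|[/eqP-> xm]]; first by rewrite mem_iota => kP [-> ->]; rewrite eqxx.
  by exists x; rewrite // mem_iota.
by rewrite !memE orbACA -orbA.
Qed.

Lemma cartan_entry_D_chain m i j : (2 < m)%N -> (i <= m - 2)%N -> (j <= m - 2)%N ->
  cartan_entry (TypeD m) i j = chain_entry i j.
Proof.
move=> m3 im jm; rewrite cartan_entry_D /chain_entry; case: eqP => // ij.
by do ?case: ifPn; lia.
Qed.

(** With b = e_1 - e_2, these are the roots e_1 - e_j and e_1 + e_j for j > 2. *)
Lemma heisenberg_paths_D m : (3 < m)%N -> heisenberg_paths (TypeD m) 0 (2 * m - 4).
Proof.
move=> m4; have aE i j : (i <= m - 2)%N -> (j <= m - 2)%N ->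
    cartan_entry (TypeD m) i j = chain_entry i j by apply: cartan_entry_D_chain; lia.
have last_l j : (j <= m - 2)%N -> cartan_entry (TypeD m) (m - 1) j = - (j == m - 3)%N%:Z.
  by move=> jm; rewrite cartan_entry_D; do ?case: ifPn; lia.
have last_r i : (i < m - 3)%N -> cartan_entry (TypeD m) i (m - 1) = 0.
  by move=> im; rewrite cartan_entry_D; do ?case: ifPn; lia.
have last1 : cartan_entry (TypeD m) (m - 3) (m - 1) = -1.
  by rewrite cartan_entry_D; do ?case: ifPn; lia.
have p1 : pairing (TypeD m) (down_seq (m - 3)) (m - 1) = -1.
  have e1 : (m - 3 = (m - 4).+1)%N by lia.
  rewrite {1}e1 down_seqS pairing_cons pairing_down_seq0 => [|i im].
    by rewrite -e1 last1.
  by apply: last_r; lia.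
have rd k : (k <= m - 2)%N -> root_path (TypeD m) 0 (down_seq k).
  by move=> km; apply: root_path_down_seq => /= [|i j ik jk]; [lia|apply: aE; lia].
pose s := (m - 1 :: down_seq (m - 3))%N.
have rs : root_path (TypeD m) 0 s.
  by apply: root_path1; [apply: rd; lia | rewrite /=; lia | rewrite p1].
have ps j : (j <= m - 2)%N -> pairing (TypeD m) s j = (j == 0)%N%:Z - (j == m - 2)%N%:Z.
  move=> jm; rewrite /s pairing_cons pairing_down_seq => [|i im]; last by apply: aE; lia.
  by rewrite !last_l //; lia.
(* The length alone does not separate e_1 - e_m from e_1 + e_m, both with m - 1 summands; the last
   simple root occurs only in the second. *)
pose f (s : seq nat) := (size s + ((m - 1)%N \in s))%N.
apply: (@heisenberg_paths_uniq _ _ _ f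
  ([seq down_seq k | k <- iota 1 (m - 2)] ++ [seq climb s (m - 2) i | i <- iota 0 (m - 2)])).
- by move=> s0 s' ss'; rewrite /f (perm_size ss') (perm_mem ss').
- rewrite map_cat -!map_comp (@eq_in_map _ _ _ (addn 1) _).1 => [|k]; last first.
    by rewrite mem_iota => kP; rewrite /= /f size_down_seq mem_down_seq; lia.
  rewrite (@eq_map _ _ (_ \o _) (addn m)) => [|i]; last first.
    rewrite /= /f size_climb (@sub_climb s (m - 2) i (m - 1)%N) ?mem_head //=.
    by rewrite size_down_seq; lia.
  rewrite -!iotaDl (_ : 2 * m - 4 = (m - 2) + (m - 2))%N; last by lia.
  by rewrite iotaD; congr (_ ++ iota _ _); lia.
move=> s0; rewrite mem_cat => /orP[] /mapP[k kP ->{s0}]; rewrite mem_iota in kP.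
  split; first by apply: rd; lia.
  by rewrite pairing_down_seq => [|i ik]; [lia|apply: aE; lia].
split.
  apply: (@root_path_climb _ _ _ _ 2) => //.
  - by rewrite /=; lia.
  - by rewrite ps //; lia.
  - by move=> j /andP[j2 jm]; rewrite ps; lia.
  by lia.
case: k kP => [|k] kP; first by rewrite ps //; lia.
by rewrite pairing_climb // ?ps; lia.
Qed.

Lemma length_ratio_D m : (3 < m)%N -> length_ratio (TypeD m) 0 2.
Proof.
move=> m4 kn pos rel j; have k0 : 0 < kn 0%N by apply: pos => /=; lia.
have kc : forall i, (i <= m - 2)%N -> kn i = kn 0%N.
  apply: chain_const => i im; apply: (@single_edge (TypeD m) kn rel);
    rewrite ?cartan_entry_D_chain ?chain_entrySl ?chain_entrySr /=; lia.
have kl : kn (m - 3)%N = kn (m - 1)%N.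
  by apply: (@single_edge (TypeD m) kn rel); rewrite ?cartan_entry_D /=; try lia;
    do ?case: ifPn; lia.
rewrite /= => jm; have [jl|jl] := leqP j (m - 2); first by rewrite kc //; lia.
by have -> : j = (m - 1)%N by [lia]; rewrite -kl kc //; lia.
Qed.

(** * Root systems and Chevalley groups *)

Lemma to_intK (C : numFieldType) (a : int) : to_int (a%:~R : C) = a.
Proof.
rewrite /to_int; case: pselect => [ex|[]]; last by exists a.
by have /eqP/intr_inj := xchooseP ex.
Qed.

Section LieBracket.

Variables (C : fieldType) (g : lieAlgebra C).
Local Notation "[ x , y ]" := (@lie_br C g x y) : ring_scope.
Implicit Types x y z : g.

Lemma lie_brDl x x' y : [x + x', y] = [x, y] + [x', y].
Proof. by have := lie_linearl y 1 x x'; rewrite !scale1r. Qed.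
Lemma lie_brDr x y y' : [x, y + y'] = [x, y] + [x, y'].
Proof. by have := lie_linearr x 1 y y'; rewrite !scale1r. Qed.
Lemma lie_br0l y : [0, y] = 0.
Proof. by apply: (addrI [0, y]); rewrite -lie_brDl !addr0. Qed.
Lemma lie_br0r x : [x, 0] = 0.
Proof. by apply: (addrI [x, 0]); rewrite -lie_brDr !addr0. Qed.
Lemma lie_brZl c x y : [c *: x, y] = c *: [x, y].
Proof. by have := lie_linearl y c x 0; rewrite lie_br0l !addr0. Qed.
Lemma lie_brZr c x y : [x, c *: y] = c *: [x, y].
Proof. by have := lie_linearr x c y 0; rewrite lie_br0r !addr0. Qed.
Lemma lie_brNr x y : [x, - y] = - [x, y].
Proof. by rewrite -scaleN1r lie_brZr scaleN1r. Qed.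
Lemma lie_brNl x y : [- x, y] = - [x, y].
Proof. by rewrite -scaleN1r lie_brZl scaleN1r. Qed.
Lemma lie_brC x y : [x, y] = - [y, x].
Proof.
apply/eqP; rewrite -addr_eq0; have := lie_alt (x + y).
by rewrite lie_brDl !lie_brDr !lie_alt add0r addr0 => ->.
Qed.
Lemma lie_br_der x y z : [x, [y, z]] = [[x, y], z] + [y, [x, z]].
Proof.
have := lie_jacobi x y z => /eqP; rewrite -addrA addr_eq0 => /eqP ->.
by rewrite opprD addrC (lie_brC z x) lie_brNr opprK (lie_brC z [x, y]) opprK.
Qed.
End LieBracket.

Lemma inj_mem_bounded (T : eqType) (f : nat -> T) (s : seq T) :
  injective f -> exists N, forall j, f j \in s -> (j < N)%N.
Proof.
move=> inj; elim: s => [|c s [N NP]]; first by exists 0%N.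
have [[j0 j0P]|nex] := pselect (exists j0, f j0 = c).
  exists (maxn j0.+1 N) => j; rewrite inE -j0P leq_max => /orP[/eqP/inj ->|/NP->].
    by rewrite ltnSn.
  by rewrite orbT.
exists N => j; rewrite inE => /orP[/eqP jc|/NP//].
by case: nex; exists j.
Qed.

(** * Root strings and integrality of the Cartan numbers *)

Section RootSystem.

Variables (C : numFieldType) (g : lieAlgebra C) (h : {vspace g}).
Variables (Phi Delta : seq (dual h)) (H : dual h -> subvs_of h) (e : dual h -> g).
Hypotheses (Phi_roots : is_root_system Phi) (Delta_base : is_base Phi Delta).
Hypothesis chev : is_chevalley_basis Phi Delta H e.

Local Notation "[ x , y ]" := (@lie_br C g x y) : ring_scope.
Implicit Types (a b c : dual h) (t : subvs_of h) (x y : g).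

Definition rv a t : C := (a : 'Hom(subvs_of h, C^o)) t.

Lemma rvD a b t : rv (a + b) t = rv a t + rv b t.
Proof. rewrite /rv. exact: (@add_lfunE _ _ _ a b t). Qed.
Lemma rvN a t : rv (- a) t = - rv a t.
Proof. exact: (@opp_lfunE _ _ _ a t). Qed.
Lemma rv0 t : rv 0 t = 0.
Proof. by apply: (addrI (rv 0 t)); rewrite -rvD !addr0. Qed.
Lemma rvMn a k t : rv (a *+ k) t = rv a t *+ k.
Proof.
elim: k => [|k IH]; first exact: rv0.
by rewrite !mulrS rvD IH.
Qed.
Lemma rvDr a t t' : rv a (t + t') = rv a t + rv a t'.
Proof. by rewrite /rv linearD. Qed.
Lemma rvZr a k t : rv a (k *: t) = k * rv a t.
Proof. by rewrite /rv linearZ. Qed.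
Lemma rvNr a t : rv a (- t) = - rv a t.
Proof. by rewrite -scaleN1r rvZr mulN1r. Qed.
Lemma rvBr a t t' : rv a (t - t') = rv a t - rv a t'.
Proof. by rewrite rvDr rvNr. Qed.
Lemma rvB a b t : rv (a - b) t = rv a t - rv b t.
Proof. by rewrite rvD rvN. Qed.
Lemma rvMz a (k : int) t : rv (a *~ k) t = rv a t *~ k.
Proof. by case: k => k; rewrite ?NegzE ?mulrNz -?pmulrn ?rvN rvMn. Qed.
Lemma rvZ k a t : rv (k *: a) t = k * rv a t.
Proof. exact: (@scale_lfunE _ _ _ k a t). Qed.

Lemma root_spaceE a x t : in_root_space a x -> [vsval t, x] = rv a t *: x.
Proof. exact. Qed.

Lemma root_space_br a b x y :
  in_root_space a x -> in_root_space b y -> in_root_space (a + b) [x, y].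
Proof.
move=> ax by_ t; rewrite -/(rv _ _) lie_br_der (root_spaceE t ax) (root_spaceE t by_).
by rewrite lie_brZl lie_brZr -scalerDl rvD.
Qed.

Lemma root_neq0 a : a \in Phi -> a != 0.
Proof. by move/(Phi_roots.2 a) => []. Qed.

Lemma root_space_eq0 a x : a \notin Phi -> a != 0 -> in_root_space a x -> x = 0.
Proof.
move=> aP a0 ax; apply/eqP; apply: contraNT aP => x0.
by apply/(Phi_roots.2 a); split=> //; exists x.
Qed.

Lemma br_root_space_eq0 a b x y : a + b \notin Phi -> a + b != 0 ->
  in_root_space a x -> in_root_space b y -> [x, y] = 0.
Proof. by move=> ab ab0 ax bY; apply: root_space_eq0 ab ab0 (root_space_br ax bY). Qed.

Lemma chev_free : free (chevalley_seq Phi Delta H e).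
Proof. exact: basis_free (chev_basis chev). Qed.

Lemma root_vec_neq0 a : a \in Phi -> e a != 0.
Proof.
move=> aP; have := chev_free; rewrite cat_free => /and3P[_ fE _].
by apply: free_not0 fE _; exact: map_f.
Qed.

Lemma rv_coroot a : a \in Phi -> rv a (H a) = 2.
Proof. exact: chev_coroot chev _. Qed.

Lemma coroot_neq0 a : a \in Phi -> H a != 0.
Proof.
move=> aP; apply/eqP => Ha0; have := rv_coroot aP.
by rewrite Ha0 -(scale0r 0) rvZr mul0r => /eqP; rewrite eq_sym pnatr_eq0.
Qed.

Lemma span_coroots : <<[seq vsval (H a) | a <- Delta]>>%VS = h.
Proof.
apply: span_basis; rewrite basisEfree.
have := chev_free; rewrite cat_free => /and3P[-> _ _] /=.
have [_ Db _] := Delta_base; apply/andP; split.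
  by apply/span_subvP => _ /mapP[a _ ->]; exact: subvsP.
rewrite size_map; have := size_basis (Db : basis_of fullv (in_tuple Delta)).
by rewrite /= => <-; rewrite dimvf /dim /= muln1.
Qed.

Lemma rv_sep t : (forall a, a \in Delta -> rv a t = 0) -> t = 0.
Proof.
move=> ta; have all_a a : rv a t = 0.
  have [_ Db _] := Delta_base.
  rewrite (coord_basis (Db : basis_of fullv (in_tuple Delta)) (memvf a)).
  elim/big_ind: _ => [|b b' b0 b'0|i _]; first exact: rv0.
    by rewrite rvD b0 b'0 addr0.
  by rewrite rvZ ta ?mulr0 // mem_nth.
rewrite (coord_vbasis (memvf t)) big1 // => i _.
have := all_a (linfun (coord (vbasis {:subvs_of h}) i : subvs_of h -> C^o) : 'Hom(subvs_of h, C^o)).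
by rewrite /rv lfunE /= => ->; rewrite scale0r.
Qed.

Lemma mulrn_root_inj a b : a \in Phi -> injective (fun j => b + a *+ j).
Proof.
move=> aP i j /addrI/(congr1 (rv^~ (H a))); rewrite !rvMn rv_coroot // -!mulrnA.
by move/eqP; rewrite eqr_nat; lia.
Qed.

Lemma chain_bound a b : a \in Phi -> exists N, forall j, b + a *+ j \in Phi -> (j < N)%N.
Proof.
by move=> aP; apply: inj_mem_bounded (mulrn_root_inj (b := b) aP). Qed.

Lemma chain_top a b : a \in Phi -> b \in Phi -> exists m,
  (forall j, (j <= m)%N -> b + a *+ j \in Phi) /\ b + a *+ m.+1 \notin Phi.
Proof.
move=> aP bP; have [N NP] := chain_bound b aP.
have ex : exists j, b + a *+ j \notin Phi.
  by exists N; apply/negP => /NP; rewrite ltnn.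
have := ex_minnP ex; case: ex_minnP => -[|m]; first by rewrite mulr0n addr0 bP.
move=> mP mmin _; exists m; split=> // j jm.
by apply: contraLR jm => /mmin; rewrite -ltnNge.
Qed.

Lemma root_string_bottom a b : a \in Phi -> b \in Phi -> exists r,
  (forall j, b - a *+ j \in Phi -> (j <= r)%N) /\ b - a *+ r \in Phi.
Proof.
move=> aP bP; have inj : injective (fun j => b - a *+ j).
  by move=> i j /addrI/oppr_inj e1; apply: (mulrn_root_inj (b := b) aP); rewrite /= e1.
have [N NP] := inj_mem_bounded Phi inj.
have ex : exists j, b - a *+ j \in Phi by exists 0%N; rewrite mulr0n subr0.
by case: (ex_maxnP ex (fun j jP => ltnW (NP j jP))) => r rP rmax; exists r.
Qed.

Lemma br_root_vecs a b : a \in Phi -> b \in Phi -> a + b \in Phi -> exists r s,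
  (forall j, b - a *+ j \in Phi -> (j <= r)%N) /\ b - a *+ r \in Phi /\
  [e a, e b] = (-1) ^+ s *: (e (a + b) *+ r.+1).
Proof.
move=> aP bP abP; have [r [rmax rP]] := root_string_bottom aP bP; exists r.
have [->|->] := chev_br chev aP bP abP rP rmax.
  by exists 0%N; rewrite expr0 scale1r.
by exists 1%N; rewrite expr1 scaleN1r.
Qed.

Lemma chev_ind (P : g -> Prop) : P 0 -> (forall x y, P x -> P y -> P (x + y)) ->
  (forall k x, P x -> P (k *: x)) -> (forall c, c \in Delta -> P (vsval (H c))) ->
  (forall b, b \in Phi -> P (e b)) -> forall x, P x.
Proof.
move=> P0 PD PZ PH Pe x.
rewrite (coord_basis (chev_basis chev : basis_of _ (in_tuple _)) (memvf x)).
elim/big_ind: _ => // i _; apply: PZ.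
have : (chevalley_seq Phi Delta H e)`_i \in chevalley_seq Phi Delta H e by rewrite mem_nth.
by rewrite mem_cat => /orP[] /mapP[c cP ->]; [exact: PH | exact: Pe].
Qed.

Lemma root_vecP a : a \in Phi -> in_root_space a (e a).
Proof. exact (chev_root_space chev (a := a)). Qed.

Lemma br_root_coroot a t : a \in Phi -> [e a, vsval t] = - rv a t *: e a.
Proof. by move=> aP; rewrite lie_brC (root_spaceE t (root_vecP aP)) scaleNr. Qed.

(** Otherwise ad e_a would map everything into the span of the root vectors. As H_a = [e_a, e_(-a)]
    also lies in h, which meets that span trivially, H_a would be 0, against a(H_a) = 2. *)
Lemma root_opp a : a \in Phi -> - a \in Phi.
Proof.
move=> aP; apply: contraT => naP.
pose E := <<[seq e b | b <- Phi]>>%VS.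
have eE b : b \in Phi -> e b \in E by move=> bP; apply: memv_span; exact: map_f.
have adE x : [e a, x] \in E.
  elim/chev_ind: x => [|x y xE yE|k x xE|c cP|b bP].
  - by rewrite lie_br0r mem0v.
  - by rewrite lie_brDr memvD.
  - by rewrite lie_brZr memvZ.
  - by rewrite br_root_coroot // memvZ // eE.
  have [abP|abP] := boolP (a + b \in Phi).
    have [r [s [_ [_ ->]]]] := br_root_vecs aP bP abP.
    by rewrite memvZ // rpredMn // eE.
  rewrite (br_root_space_eq0 abP _ (root_vecP aP) (root_vecP bP)) ?mem0v //.
  by apply: contraNneq naP => /eqP; rewrite addrC addr_eq0 => /eqP <-.
have := chev_free; rewrite cat_free => /and3P[_ _ /directv_addP cap0].
have : vsval (H a) \in (<<[seq vsval (H a) | a <- Delta]>> :&: E)%VS.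
  by rewrite memv_cap span_coroots subvsP -(chev_br_opp chev aP) adE.
rewrite cap0 memv0 => /eqP Ha0; case/eqP: (coroot_neq0 aP).
by apply: val_inj; rewrite /= Ha0.
Qed.

Lemma root_oppE a : (- a \in Phi) = (a \in Phi).
Proof. by apply/idP/idP => /root_opp; rewrite ?opprK. Qed.

Lemma coroot_opp a : a \in Phi -> H (- a) = - H a.
Proof.
move=> aP; apply: val_inj; rewrite /= -(chev_br_opp chev (root_opp aP)) opprK.
by rewrite lie_brC (chev_br_opp chev aP).
Qed.

(** Otherwise [e_a, e_a] would be a nonzero multiple of the root vector of 2a. *)
Lemma root_double a : a \in Phi -> a *+ 2 \notin Phi.
Proof.
move=> aP; apply/negP => a2P.
have [r [s [_ [_ /eqP]]]] := br_root_vecs aP aP (a2P : a + a \in Phi).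
rewrite lie_alt eq_sym scaler_eq0 signr_eq0 /= -scaler_nat scaler_eq0 pnatr_eq0 /=.
by rewrite (negPf (root_vec_neq0 _)).
Qed.

Lemma br_chain_neq0 a b : a \in Phi -> b \in Phi -> a + b \in Phi ->
  exists2 k : C, k != 0 & [e a, e b] = k *: e (a + b).
Proof.
move=> aP bP abP; have [r [s [_ [_ ->]]]] := br_root_vecs aP bP abP.
exists ((-1) ^+ s * r.+1%:R); first by rewrite mulf_neq0 ?signr_eq0 // pnatr_eq0.
by rewrite -scalerA scaler_nat.
Qed.

(* Telescoping the sl2-relation along the chain b, b + a, ..., b + m a. *)
Lemma root_chain a b m : a \in Phi -> (forall j, (j <= m)%N -> b + a *+ j \in Phi) ->
    b - a \notin Phi -> b != a -> b + a *+ m.+1 \notin Phi -> b + a *+ m.+1 != 0 ->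
  rv b (H a) = - m%:R.
Proof.
move=> aP chP bot bota top top0; pose E j := e (b + a *+ j).
have step j : (j <= m)%N -> [e (- a), [e a, E j]] =
    [e a, [e (- a), E j]] - (rv b (H a) + j%:R *+ 2) *: E j.
  move=> jm; rewrite lie_br_der addrC (lie_brC (e (- a)) (e a)) (chev_br_opp chev aP).
  rewrite lie_brNl (root_spaceE _ (root_vecP (chP j jm))).
  by rewrite rvD rvMn rv_coroot // -[2]/(1 *+ 2) -mulrnA mulnC mulrnA.
have main j : (j <= m)%N -> [e a, [e (- a), E j]] =
    - (j%:R * rv b (H a) + j%:R * (j%:R - 1)) *: E j.
  elim: j => [_|j IH jm].
    have bP : b \in Phi by have := chP 0%N isT; rewrite mulr0n addr0.
    have -> : [e (- a), E 0%N] = 0.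
      rewrite /E mulr0n addr0; apply: (@br_root_space_eq0 (- a) b).
      + by rewrite addrC.
      + by rewrite addrC subr_eq0.
      + exact (root_vecP (root_opp aP)).
      + exact (root_vecP bP).
    by rewrite lie_br0r !mul0r addr0 oppr0 scale0r.
  have [k k0 kE] : exists2 k, k != 0 & [e a, E j] = k *: E j.+1.
    have := @br_chain_neq0 a (b + a *+ j) aP (chP _ (ltnW jm)).
    by rewrite addrCA -mulrS; apply; exact: chP.
  have st := step j (ltnW jm).
  apply: (scalerI k0); rewrite -!lie_brZr -kE st IH ?(ltnW jm) //.
  rewrite -scalerBl lie_brZr kE scalerA [RHS]scalerA; congr (_ *: _).
  by rewrite -natr1; ring.
have st := step m (leqnn m).
have top_br : [e a, E m] = 0.
  apply: (@br_root_space_eq0 a (b + a *+ m)); rewrite ?[a + _]addrCA -?mulrS //.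
    exact (root_vecP aP).
  by exact (root_vecP (chP m (leqnn m))).
move: st; rewrite top_br lie_br0r main // -scalerBl => /esym/eqP.
rewrite scaler_eq0 (negPf (root_vec_neq0 (chP m (leqnn m)))) orbF => /eqP e0.
have : (m%:R + 1) * (rv b (H a) + m%:R) = 0.
  by rewrite -(oppr0) -e0; ring.
move/eqP; rewrite mulf_eq0 natr1 pnatr_eq0 /= addr_eq0 => /eqP //.
Qed.

Lemma root_mulrn_eq0 a j : a \in Phi -> (a *+ j == 0) = (j == 0)%N.
Proof.
move=> aP; apply/eqP/eqP => [|->//]; rewrite -[LHS]add0r -[RHS](addr0 0).
by rewrite -[X in _ = _ + X](mulr0n a) => /(mulrn_root_inj aP).
Qed.

(** The least root ja with j > 2 would be the bottom of an a-string, so its pairing with a^vee,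
    which is 2j, would be nonpositive. *)
Lemma root_multiple a j : a \in Phi -> (1 < j)%N -> a *+ j \notin Phi.
Proof.
move=> aP j1; apply/negP => ajP.
have ex : exists j, (1 < j)%N && (a *+ j \in Phi) by exists j; rewrite j1.
case: (ex_minnP ex) => -[//|[//|[|i]]] /andP[_ iP] imin.
  by rewrite (negPf (root_double aP)) in iP.
have [m [chP top]] := chain_top aP iP.
have e1 : rv (a *+ i.+3) (H a) = - m%:R.
  apply: root_chain => //.
  - rewrite mulrSr addrK; apply/negP => aP'.
    by have := imin i.+2; rewrite aP' ltnn => /(_ isT).
  - by rewrite mulrSr -subr_eq0 addrK root_mulrn_eq0.
  - by rewrite -mulrnDr root_mulrn_eq0 // addnS.
move: e1; rewrite rvMn rv_coroot // => /eqP.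
by rewrite -addr_eq0 -mulrnA -natrD pnatr_eq0.
Qed.

Lemma chain_neq0 a b j : a \in Phi -> b \in Phi -> b != - a -> b + a *+ j != 0.
Proof.
move=> aP bP bNa; case: j => [|[|j]].
- by rewrite mulr0n addr0 root_neq0.
- by rewrite mulr1n addr_eq0.
rewrite addr_eq0; apply: contraTneq bP => ->.
by rewrite root_oppE root_multiple.
Qed.

Lemma root_string a b : a \in Phi -> b \in Phi -> b != a -> b != - a ->
  exists r m, [/\ forall j, (j <= r)%N -> b - a *+ j \in Phi,
    forall j, (j <= m)%N -> b + a *+ j \in Phi & rv b (H a) = r%:R - m%:R].
Proof.
move=> aP bP ba bNa; have naP := root_opp aP.
have [m [upP top]] := chain_top aP bP.
have [r [downP bot]] := chain_top naP bP.
exists r, m; split=> // [j jr|]; first by rewrite -mulNrn downP.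
have e1 : rv (b - a *+ r) (H a) = - (r + m)%:R.
  apply: root_chain => // [j jrm||||].
  - have [jr|rj] := leqP j r.
      have -> : b - a *+ r + a *+ j = b - a *+ (r - j).
        by rewrite mulrnBr // opprB [a *+ j - _]addrC addrA.
      by rewrite -mulNrn downP // leq_subr.
    have -> : b - a *+ r + a *+ j = b + a *+ (j - r).
      by rewrite (mulrnBr _ (ltnW rj)) addrAC addrA.
    by apply: upP; rewrite leq_subLR.
  - by rewrite -addrA -opprD -mulrSr -mulNrn.
  - rewrite -subr_eq0 -addrA -opprD -mulrSr -mulNrn.
    by apply: chain_neq0 naP bP _; rewrite opprK.
  - by rewrite -addnS mulrnDr addrA subrK.
  - by rewrite -addnS mulrnDr addrA subrK chain_neq0.
move: e1; rewrite rvB rvMn rv_coroot // => /eqP.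
rewrite subr_eq => /eqP ->; rewrite natrD -mulrnA natrM; ring.
Qed.

Definition cart b a : int := to_int (rv b (H a)).

Lemma cartE b a : a \in Phi -> b \in Phi -> (cart b a)%:~R = rv b (H a).
Proof.
move=> aP bP; suff [z zE] : exists z : int, rv b (H a) = z%:~R by rewrite /cart zE to_intK.
have [->|ba] := eqVneq b a; first by exists 2; rewrite rv_coroot.
have [->|bNa] := eqVneq b (- a); first by exists (- 2); rewrite rvN rv_coroot // rmorphN.
have [r [m [_ _ ->]]] := root_string aP bP ba bNa.
by exists (r%:Z - m%:Z); rewrite rmorphB.
Qed.

Lemma cart_eq b a (z : int) : rv b (H a) = z%:~R -> cart b a = z.
Proof. by rewrite /cart => ->; rewrite to_intK. Qed.

Lemma cart_diag a : a \in Phi -> cart a a = 2.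
Proof. by move=> aP; apply: cart_eq; rewrite rv_coroot. Qed.

Lemma cart_oppl a b : a \in Phi -> b \in Phi -> cart (- b) a = - cart b a.
Proof. by move=> aP bP; apply: cart_eq; rewrite rvN rmorphN /= cartE. Qed.

Lemma cart_oppr a b : a \in Phi -> b \in Phi -> cart b (- a) = - cart b a.
Proof. by move=> aP bP; apply: cart_eq; rewrite coroot_opp // rvNr rmorphN /= cartE. Qed.

Lemma root_add a b j : a \in Phi -> b \in Phi -> b != - a -> j%:Z <= - cart b a ->
  b + a *+ j \in Phi.
Proof.
move=> aP bP bNa jle.
have [ba|ba] := eqVneq b a; first by move: jle; rewrite ba cart_diag //; lia.
have [r [m [_ upP bE]]] := root_string aP bP ba bNa.
apply: upP; have : cart b a = r%:Z - m%:Z by apply: cart_eq; rewrite bE rmorphB.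
by move: jle; lia.
Qed.

(** * Reflections and the invariant form *)

Definition refl a b : dual h := b - a *~ cart b a.

Lemma rv_refl a b t : a \in Phi -> b \in Phi ->
  rv (refl a b) t = rv b t - rv b (H a) * rv a t.
Proof. by move=> aP bP; rewrite rvB rvMz -cartE // -mulrzl. Qed.

Lemma mulrz2 a : a *~ 2 = a + a.
Proof. by rewrite -mulr2n pmulrn. Qed.

Lemma refl_root a b : a \in Phi -> b \in Phi -> refl a b \in Phi.
Proof.
move=> aP bP; rewrite /refl.
have [->|ba] := eqVneq b a.
  by rewrite cart_diag // mulrz2 opprD addrA subrr add0r root_opp.
have [->|bNa] := eqVneq b (- a).
  by rewrite cart_oppl // cart_diag // mulrNz opprK mulrz2 addKr.
case cE: (cart b a) => [k|k]; rewrite ?NegzE.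
  rewrite -pmulrn -mulNrn; apply: root_add => //; first exact: root_opp.
    by rewrite opprK.
  by rewrite cart_oppr // opprK cE.
rewrite mulrNz opprK -pmulrn; apply: root_add => //.
by rewrite cE NegzE opprK.
Qed.

Lemma cart_refl a b : a \in Phi -> b \in Phi -> cart (refl a b) a = - cart b a.
Proof.
move=> aP bP; apply: cart_eq.
by rewrite rv_refl // rv_coroot // rmorphN /= cartE //; ring.
Qed.

Lemma reflK a b : a \in Phi -> b \in Phi -> refl a (refl a b) = b.
Proof.
move=> aP bP; rewrite {1}/refl cart_refl // /refl mulrNz opprK subrK //.
Qed.

Definition reflh a t := t - rv a t *: H a.

Lemma rv_reflh a b t : a \in Phi -> b \in Phi -> rv b (reflh a t) = rv (refl a b) t.
Proof. by move=> aP bP; rewrite rv_refl // rvBr rvZr; ring. Qed.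

Lemma reflhK a : a \in Phi -> involutive (reflh a).
Proof.
move=> aP t; rewrite /reflh rvBr rvZr rv_coroot // -addrA -opprD -scalerDl.
by rewrite (_ : rv a t + (rv a t - rv a t * 2) = 0) ?scale0r ?subr0 //; ring.
Qed.

Lemma perm_refl a : a \in Phi -> perm_eq [seq refl a b | b <- Phi] Phi.
Proof.
move=> aP; have uP := Phi_roots.1; apply: uniq_perm => //.
  rewrite map_inj_in_uniq // => b b' bP b'P e1.
  by rewrite -(reflK aP bP) e1 reflK.
move=> b; apply/mapP/idP => [[b' b'P ->]|bP]; first exact: refl_root.
by exists (refl a b); rewrite ?refl_root ?reflK.
Qed.

(** The Killing form on h; as a sum over the roots it is invariant under reflections, which permute
    them. *)
Definition kform t t' : C := \sum_(b <- Phi) rv b t * rv b t'.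

Lemma kform_reflh a t t' : a \in Phi -> kform (reflh a t) (reflh a t') = kform t t'.
Proof.
move=> aP; rewrite /kform -[RHS](perm_big _ (perm_refl aP)) /= big_map.
by apply: eq_big_seq => b bP; rewrite !rv_reflh.
Qed.

Lemma kformDr t t1 t2 : kform t (t1 + t2) = kform t t1 + kform t t2.
Proof. by rewrite -big_split; apply: eq_bigr => b _; rewrite rvDr mulrDr. Qed.
Lemma kformZr t k t' : kform t (k *: t') = k * kform t t'.
Proof. by rewrite mulr_sumr; apply: eq_bigr => b _; rewrite rvZr; ring. Qed.
Lemma kformC t t' : kform t t' = kform t' t.
Proof. by apply: eq_bigr => b _; rewrite mulrC. Qed.
Lemma kformDl t t1 t2 : kform (t1 + t2) t = kform t1 t + kform t2 t.
Proof. by rewrite ![kform _ t]kformC kformDr. Qed.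
Lemma kformZl t k t' : kform (k *: t') t = k * kform t' t.
Proof. by rewrite ![kform _ t]kformC kformZr. Qed.

(** The reflection in a preserves the form and changes the sign of H_a; expanding the invariance at
    (H_a, t) gives the relation. *)
Lemma kform_coroot a t : a \in Phi ->
  2 * kform (H a) t = rv a t * kform (H a) (H a).
Proof.
move=> aP; have := kform_reflh (H a) t aP.
have -> : reflh a (H a) = (-1) *: H a.
  by rewrite /reflh rv_coroot // -[X in X - _]scale1r -scalerBl; congr (_ *: _); ring.
rewrite kformZl /reflh -scaleN1r scalerA kformDr kformZr => kE.
by rewrite mulr_natl mulr2n -{1}kE; ring.
Qed.

(* This is inversely proportional to the squared length of the root. *)
Definition knorm a : int := \sum_(b <- Phi) cart b a ^+ 2.

Lemma knormE a : a \in Phi -> (knorm a)%:~R = kform (H a) (H a).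
Proof.
move=> aP; rewrite rmorph_sum; apply: eq_big_seq => b bP.
by rewrite rmorphXn /= cartE.
Qed.

Lemma knorm_gt0 a : a \in Phi -> 0 < knorm a.
Proof.
move=> aP; rewrite /knorm (big_rem a) //= cart_diag //.
by apply: ltr_wpDr => //; apply: sumr_ge0 => b _; exact: sqr_ge0.
Qed.

Lemma cart_knorm a b : a \in Phi -> b \in Phi ->
  cart a b * knorm a = cart b a * knorm b.
Proof.
move=> aP bP; apply: (@intr_inj C); rewrite !rmorphM /= !cartE // !knormE //.
by rewrite -!kform_coroot // kformC.
Qed.

Lemma knorm_opp a : a \in Phi -> knorm (- a) = knorm a.
Proof.
by move=> aP; apply: eq_big_seq => b bP; rewrite cart_oppr // sqrrN.
Qed.

Lemma rv_sep_roots t : (forall a, a \in Phi -> rv a t = 0) -> t = 0.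
Proof. by have [sDP _ _] := Delta_base => h0; apply: rv_sep => a /sDP; exact: h0. Qed.

(** The form determines a coroot up to a scalar from the functional it represents, and the value 2
    of the root on it fixes the scalar. *)
Lemma coroot_refl a b : a \in Phi -> b \in Phi ->
  H (refl a b) = reflh a (H b) /\ knorm (refl a b) = knorm b.
Proof.
move=> aP bP; set b' := refl a b; have b'P : b' \in Phi by exact: refl_root.
pose y := reflh a (H b).
have yE t : 2 * kform y t = rv b' t * kform (H b) (H b).
  by rewrite /y -{1}(reflhK aP t) kform_reflh // kform_coroot // rv_reflh.
have b'y : rv b' y = 2 by rewrite -rv_reflh // reflhK // rv_coroot.
(* The two terms represent opposite functionals, so [w] is orthogonal to every coroot. *)
pose w := kform (H b') (H b') *: y + (- kform (H b) (H b)) *: H b'.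
have w0 : w = 0.
  apply: rv_sep_roots => c cP.
  have kc0 : kform (H c) (H c) != 0 by rewrite -knormE // intr_eq0 gt_eqF // knorm_gt0.
  apply: (mulIf kc0); rewrite -kform_coroot // kformC mul0r kformDl !kformZl.
  by rewrite mulrDr !(mulrCA 2) yE kform_coroot //; ring.
have kE : kform (H b') (H b') = kform (H b) (H b).
  have : rv b' w = 0 by rewrite w0 -(scale0r 0) rvZr mul0r.
  rewrite rvDr !rvZr b'y rv_coroot // -mulrDl => /eqP.
  by rewrite mulf_eq0 pnatr_eq0 orbF subr_eq0 => /eqP.
split; last by apply: (@intr_inj C); rewrite !knormE.
have kb0 : kform (H b) (H b) != 0 by rewrite -knormE // intr_eq0 gt_eqF // knorm_gt0.
apply/eqP; rewrite eq_sym -subr_eq0; move/eqP: w0.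
by rewrite /w kE scaleNr -scalerBr scaler_eq0 (negPf kb0).
Qed.

Lemma base_root c : c \in Delta -> c \in Phi.
Proof. by have [sDP _ _] := Delta_base; exact: sDP. Qed.

Lemma base_comb_inj (u v : 'I_(size Delta) -> int) :
  \sum_(i < size Delta) Delta`_i *~ u i = \sum_(i < size Delta) Delta`_i *~ v i -> u =1 v.
Proof.
have [_ Db _] := Delta_base; move=> e1 i; have := congr1 (coord (in_tuple Delta) i) e1.
have cE (w : 'I_(size Delta) -> int) :
    coord (in_tuple Delta) i (\sum_(i < size Delta) Delta`_i *~ w i) = (w i)%:~R.
  rewrite -(coord_sum_free (fun j => (w j)%:~R) i (basis_free Db : free (in_tuple Delta))).
  by congr coord; apply: eq_bigr => j _; rewrite scaler_int.
by rewrite !cE => /intr_inj.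
Qed.

(** Induction on the height of a positive root a: some simple d with positive coefficient in a has
    <a, d^vee> > 0, and reflecting in d lowers the height unless a = d. *)
Lemma root_ind (P : dual h -> Prop) : (forall c, c \in Delta -> P c) ->
  (forall a, a \in Phi -> P a -> P (- a)) ->
  (forall c a, c \in Delta -> a \in Phi -> P a -> P (refl c a)) ->
  forall a, a \in Phi -> P a.
Proof.
move=> PD PN Ps; have [sDP Db Dc] := Delta_base.
suff pos N (c : nat -> nat) a : (\sum_(i < size Delta) c i < N)%N -> a \in Phi ->
    a = \sum_(i < size Delta) Delta`_i *+ c i -> P a.
  move=> a aP; have [c [|] aE] := Dc a aP; first exact: pos (ltnSn _) aP aE.
  rewrite -[a]opprK; apply: PN; first exact: root_opp.
  by apply: pos (ltnSn _) (root_opp aP) _; rewrite aE opprK.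
have iP (i : 'I_(size Delta)) : Delta`_i \in Phi.
  by apply: sDP; apply: mem_nth.
elim: N c a => [//|N IH] c a cN aP aE.
have [i ci0 ai0] : exists2 i : 'I_(size Delta), (0 < c i)%N & 0 < cart a Delta`_i.
  have [/existsP[i /andP[ci ai]]|] :=
      boolP [exists i : 'I_(size Delta), (0 < c i)%N && (0 < cart a Delta`_i)].
    by exists i.
  rewrite negb_exists => /forallP npos.
  (* Without such a simple root, a(H_a) = 2 would be a sum of nonpositive terms; [cart_knorm]
     carries the sign of <a, d^vee> over to <d, a^vee>. *)
  have : rv a (H a) <= 0.
    rewrite {1}aE; elim/big_rec: _ => [|i b _ b0]; first by rewrite rv0.
      rewrite rvD rvMn -cartE // -[X in _ <= X]addr0 lerD //.
      have := npos i; rewrite negb_and lt0n negbK -leNgt => /orP[/eqP->|ai].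
        by rewrite mulr0n.
      apply: mulrn_wle0; rewrite lerz0.
      have := cart_knorm (iP i) aP.
      have := knorm_gt0 (iP i); have := knorm_gt0 aP.
      by move: ai; clear; nia.
  by rewrite rv_coroot // lern0.
set d := Delta`_i in ai0; have dD : d \in Delta by exact: mem_nth.
have dP := sDP d dD.
have [m mE] : exists m : nat, cart a d = m.+1.
  by case: (cart a d) ai0 => [[|m]|m] //; exists m.
have a'E : refl d a =
    \sum_(j < size Delta) Delta`_j *~ ((c j)%:Z - (if j == i then m.+1%:Z else 0)).
  rewrite /refl mE {1}aE (bigD1 i) //= [RHS](bigD1 i) //= eqxx mulrzBr -!pmulrn.
  rewrite -/d addrAC; congr (_ + _); apply: eq_bigr => j ji.
  by rewrite (negPf ji) subr0.
have a'P := refl_root dP aP.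
have [mc|cm] := leqP m.+1 (c i).
  rewrite -[a](reflK dP) //; apply: Ps => //.
  apply: (IH (fun j => c j - (if j == i :> nat then m.+1 else 0))%N) => //.
    rewrite (bigD1 i) //= eqxx (eq_bigr (fun j : 'I_ _ => c j)) => [|j ji]; last first.
      by rewrite (_ : (j == i :> nat) = (j == i)) // (negPf ji) subn0.
    move: cN; rewrite (bigD1 i) //= ltnS; apply: leq_trans.
    by rewrite ltn_add2r ltn_subrL ci0.
  rewrite a'E; apply: eq_bigr => j _; rewrite (_ : (j == i :> nat) = (j == i)) //.
  case: eqP => [->|_]; last by rewrite subn0 subr0 pmulrn.
  by rewrite pmulrn; congr (_ *~ _); lia.
(* The reflected root now has a negative coefficient at d. As its coefficients all have one sign and
   the others are unchanged, these vanish and a is a multiple of d. *)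
have cj0 (j : 'I_(size Delta)) : j != i -> c j = 0%N.
  move=> ji; pose w (j : 'I_(size Delta)) := (c j)%:Z - (if j == i then m.+1%:Z else 0).
  have [c' [|] cE] := Dc _ a'P.
    have : w =1 (fun j => (c' j)%:Z).
      by apply: base_comb_inj; rewrite -a'E cE; apply: eq_bigr => j' _; rewrite pmulrn.
    by move/(_ i); rewrite /w eqxx; lia.
  have : w =1 (fun j => - (c' j)%:Z).
    apply: base_comb_inj; rewrite -a'E cE -sumrN; apply: eq_bigr => j' _.
    by rewrite mulrNz pmulrn.
  by move/(_ j); rewrite /w (negPf ji); lia.
have aE1 : a = d *+ c i.
  by rewrite aE (bigD1 i) //= big1 ?addr0 // => j /cj0 ->; rewrite mulr0n.
have [c1|] := leqP (c i) 1; last by move/(root_multiple dP); rewrite -aE1 aP.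
have c1' : c i = 1%N by apply/eqP; rewrite eqn_leq c1.
by rewrite aE1 c1' mulr1n; exact: PD.
Qed.

(** Only simple coroots belong to the basis, so this is what makes [e_a, e_(-a)] integral for every
    root a. *)
Lemma coroot_comb a : a \in Phi -> exists z : nat -> int,
  H a = \sum_(i < size Delta) H Delta`_i *~ z i.
Proof.
elim/root_ind => {a} [c cD|a aP [z zE]|c a cD aP [z zE]].
- exists (fun i => (i == index c Delta)%:Z).
  have cl : (index c Delta < size Delta)%N by rewrite index_mem.
  rewrite (bigD1 (Ordinal cl)) //= eqxx nth_index // big1 ?addr0 // => i.
  by rewrite -val_eqE /= => /negPf->.
- exists (fun i => - z i); rewrite coroot_opp // zE -sumrN.
  by apply: eq_bigr => i _; rewrite mulrNz.
have cP := base_root cD; have cl : (index c Delta < size Delta)%N by rewrite index_mem.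
exists (fun i => z i - cart c a *~ (i == index c Delta)).
rewrite (coroot_refl cP aP).1 /reflh -cartE // scaler_int zE.
rewrite (bigD1 (Ordinal cl)) //= [RHS](bigD1 (Ordinal cl)) //= eqxx mulrzBr nth_index //.
rewrite addrAC; congr (_ + _); apply: eq_bigr => i.
by rewrite -val_eqE /= => /negPf->; rewrite mulr0z subr0.
Qed.

Lemma knorm_base a : a \in Phi -> exists2 c, c \in Delta & knorm a = knorm c.
Proof.
elim/root_ind => {a} [c cD|a aP [c cD aE]|c a cD aP [c' c'D aE]]; first by exists c.
  by exists c => //; rewrite knorm_opp.
by exists c' => //; rewrite (coroot_refl (base_root cD) aP).2.
Qed.

(** The form at H_c - H_b is [knorm c + knorm b - cart c b * knorm c], at most [knorm b - knorm c]
    and so nonpositive. Being a sum of squares, it vanishes; hence H_c = H_b and c = b. *)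
Lemma long_root_max b c : b \in Phi -> (forall a, a \in Phi -> knorm b <= knorm a) ->
  c \in Phi -> 2 <= cart c b -> c = b.
Proof.
move=> bP bmin cP cb2.
pose D : int := \sum_(a <- Phi) (cart a c - cart a b) ^+ 2.
pose X : int := \sum_(a <- Phi) cart a c * cart a b.
have DE : D = knorm c + knorm b - 2 * X.
  rewrite /D /knorm /X mulr_sumr -big_split -sumrB; apply: eq_bigr => a _; rewrite /=; ring.
have XE : 2 * X = cart c b * knorm c.
  apply: (@intr_inj C); rewrite !rmorphM /= cartE // knormE // -kform_coroot //.
  congr (_ * _); rewrite rmorph_sum; apply: eq_big_seq => a aP.
  by rewrite rmorphM /= !cartE.
have D0 : D == 0.
  rewrite eq_le sumr_ge0 ?andbT => [|a _]; last exact: sqr_ge0.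
  rewrite DE XE; have := knorm_gt0 cP; have := bmin c cP; move: cb2; clear; nia.
have HE : H c = H b.
  apply/eqP; rewrite -subr_eq0; apply/eqP/rv_sep_roots => a aP.
  move: D0; rewrite psumr_eq0 => [/allP/(_ a aP)|? _]; last exact: sqr_ge0.
  by rewrite /= sqrf_eq0 rvBr -!cartE // -rmorphB => /eqP ->.
have kb0 : kform (H b) (H b) != 0 by rewrite -knormE // intr_eq0 gt_eqF // knorm_gt0.
apply/lfunP => t; apply: (mulIf kb0).
by rewrite -[RHS]kform_coroot // -{1 2}HE -[LHS]kform_coroot // HE.
Qed.

(** * Integrality of the divided powers of ad e_a *)

Implicit Type v : g.
Local Notation B := (chevalley_seq Phi Delta H e).
Local Notation N := (size B).
Local Notation co := (coord (in_tuple B)).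

Definition ad_mx x : 'M[C]_N := \matrix_(i, j) co i [x, B`_j].

Lemma coB v : v = \sum_(i < N) co i v *: B`_i.
Proof. exact: (coord_basis (chev_basis chev : basis_of _ (in_tuple B)) (memvf v)). Qed.

Lemma coE (i j : 'I_N) : co i B`_j = (i == j)%:R.
Proof. by rewrite eq_sym; exact: (coord_free j i (chev_free : free (in_tuple B))). Qed.

Lemma lie_brMn x y k : [x, y *+ k] = [x, y] *+ k.
Proof. by rewrite -!scaler_nat lie_brZr. Qed.

Lemma lie_br_sumr x (I : Type) (r : seq I) (f : I -> g) :
  [x, \sum_(i <- r) f i] = \sum_(i <- r) [x, f i].
Proof.
elim: r => [|i r IH]; first by rewrite !big_nil lie_br0r.
by rewrite !big_cons lie_brDr IH.
Qed.

Lemma ad_mx_mul x (f : nat -> g) :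
  ad_mx x *m (\matrix_(i < N, j < N) co i (f j)) = \matrix_(i < N, j < N) co i [x, f j].
Proof.
apply/matrixP => i j; rewrite !mxE [in RHS](coB (f j)) lie_br_sumr linear_sum.
by apply: eq_bigr => l _; rewrite !mxE lie_brZr linearZ /= mulrC.
Qed.

Lemma ad_mx_iter x k : ad_mx x ^+ k = \matrix_(i < N, j < N) co i (iter k (@lie_br C g x) B`_j).
Proof.
elim: k => [|k IH].
  by apply/matrixP => i j; rewrite expr0 !mxE /= coE.
by rewrite exprS IH [LHS](ad_mx_mul x (fun j => iter k (@lie_br C g x) B`_j)).
Qed.

Lemma ad_mx_br x y : ad_mx x *m ad_mx y = ad_mx y *m ad_mx x + ad_mx [x, y].
Proof.
rewrite (ad_mx_mul x (fun j => [y, B`_j])) (ad_mx_mul y (fun j => [x, B`_j])).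
by apply/matrixP => i j; rewrite !mxE lie_br_der linearD addrC.
Qed.

Lemma ad_mxZ k x : ad_mx (k *: x) = k *: ad_mx x.
Proof. by apply/matrixP => i j; rewrite !mxE lie_brZl linearZ. Qed.

Definition integral_vec v := forall i, exists z : int, co i v = z%:~R.

Lemma integral_vec0 : integral_vec 0.
Proof. by move=> i; exists 0; rewrite linear0. Qed.

Lemma integral_vecD v v' : integral_vec v -> integral_vec v' -> integral_vec (v + v').
Proof.
by move=> iv iv' i; have [z zE] := iv i; have [z' zE'] := iv' i; exists (z + z');
  rewrite linearD rmorphD /= zE zE'.
Qed.

Lemma integral_vecZ v (k : int) : integral_vec v -> integral_vec (k%:~R *: v).
Proof.
by move=> iv i; have [z zE] := iv i; exists (k * z); rewrite linearZ rmorphM /= zE.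
Qed.

Lemma integral_basis v : v \in B -> integral_vec v.
Proof.
move=> vB i; have vl : (index v B < N)%N by rewrite index_mem.
exists (i == Ordinal vl)%:Z; rewrite -[X in co i X](nth_index 0 vB).
by rewrite (coE i (Ordinal vl)); case: eqP.
Qed.

Lemma integral_root_vec a : a \in Phi -> integral_vec (e a).
Proof. by move=> aP; apply: integral_basis; rewrite mem_cat map_f ?orbT. Qed.

Lemma integral_coroot a : a \in Phi -> integral_vec (vsval (H a)).
Proof.
move=> aP; have [z ->] := coroot_comb aP.
rewrite linear_sum; elim/big_ind: _ => //; first exact: integral_vec0.
  exact: integral_vecD.
move=> i _; rewrite /= -scaler_int linearZ; apply: integral_vecZ.
apply: integral_basis; rewrite mem_cat; apply/orP; left.
by apply/mapP; exists Delta`_i; rewrite ?mem_nth.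
Qed.

Lemma ad_coroot_iter a c k : a \in Phi -> c \in Phi ->
  iter k.+2 (lie_br (e a)) (vsval (H c)) = 0.
Proof.
move=> aP cP; rewrite !iterSr br_root_coroot // lie_brZr lie_alt scaler0.
by elim: k => [//|k IH]; rewrite iterS IH lie_br0r.
Qed.

(** If the string goes r steps below b, the structure constants multiply to (r+1)...(r+k) up to
    sign, so [m] is the binomial coefficient of r + k over k. *)
Lemma ad_root_iter a b k : a \in Phi -> b \in Phi -> b != a -> b != - a ->
  iter k (lie_br (e a)) (e b) = 0 \/ (forall j, (j <= k)%N -> b + a *+ j \in Phi) /\
  exists m s, iter k (lie_br (e a)) (e b) =
    ((-1) ^+ s *: e (b + a *+ k)) *+ m *+ k`!.
Proof.
move=> aP bP ba bNa.
have [r [rmax rP]] := root_string_bottom aP bP.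
suff : iter k (lie_br (e a)) (e b) = 0 \/ (forall j, (j <= k)%N -> b + a *+ j \in Phi) /\
  exists s, iter k (lie_br (e a)) (e b) = ((-1) ^+ s *: e (b + a *+ k)) *+ 'C(r + k, k) *+ k`!.
  by case=> [->|[rts [s ->]]]; [left|right; split=> //; exists 'C(r + k, k), s].
elim: k => [|k IH].
  right; split=> [j|]; first by rewrite leqn0 => /eqP->; rewrite mulr0n addr0.
  by exists 0%N; rewrite mulr0n addr0 expr0 scale1r bin0 fact0.
case: IH => [e0|[rts [s E]]]; first by left; rewrite iterS e0 lie_br0r.
have bkP := rts k (leqnn k).
rewrite iterS E !lie_brMn lie_brZr.
have abk : a + (b + a *+ k) = b + a *+ k.+1 by rewrite addrCA -mulrS.
have [abP|abP] := boolP (a + (b + a *+ k) \in Phi); last first.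
  left; rewrite (br_root_space_eq0 abP) ?scaler0 ?mul0rn //.
  - by rewrite abk chain_neq0.
  - exact (root_vecP aP).
  - exact (root_vecP bkP).
right; split=> [j|].
  by rewrite leq_eqVlt ltnS => /orP[/eqP->|/rts//]; rewrite -abk.
have [r' [s' [r'max [r'P ->]]]] := br_root_vecs aP bkP abP.
exists (s' + s)%N.
have kr : (r + k <= r')%N.
  by apply: r'max; rewrite mulrnDr opprD addrACA subrr addr0.
(* Each step up the string lengthens the part below by one. *)
have r'E : r' = (r + k)%N.
  apply/eqP; rewrite eqn_leq kr andbT addnC -leq_subLR; apply: rmax.
  have kr' : (k <= r')%N by rewrite (leq_trans _ kr) ?leq_addl.
  by rewrite mulrnBr // opprB addrA.
have binE : ('C(r + k, k) * k`! * (r + k).+1 = 'C(r + k.+1, k.+1) * k.+1`!)%N.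
  by rewrite factS mulnA [('C(r + k.+1, _) * _)%N]mulnC addnS -mul_bin_diag /=; lia.
rewrite abk r'E; move: (e _) => w; rewrite -!scaler_nat !scalerA; congr (_ *: _).
transitivity ((-1) ^+ (s' + s) * ('C(r + k, k) * k`! * (r + k).+1)%:R : C).
  by rewrite exprD !natrM; ring.
by rewrite binE natrM; ring.
Qed.

(** Chevalley's integrality theorem. Besides root strings, the basis vectors to examine are the
    coroots, e_a and e_(-a), where the series stops after at most two steps. *)
Lemma ad_iter_divisible a x k : a \in Phi -> x \in B ->
  exists2 v, integral_vec v & iter k (lie_br (e a)) x = v *+ k`!.
Proof.
move=> aP; rewrite mem_cat => /orP[] /mapP[b bP ->].
  case: k => [|[|k]].
  - exists (vsval (H b)); last by rewrite fact0.
    exact: integral_coroot (base_root bP).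
  - exists ((- cart a b)%:~R *: e a); last first.
      by rewrite (_ : 1`! = 1%N) // mulr1n /= br_root_coroot // rmorphN /= cartE // base_root.
    exact/integral_vecZ/integral_root_vec.
  exists 0; first exact: integral_vec0.
  by rewrite (ad_coroot_iter k aP (base_root bP)) mul0rn.
have [->|ba] := eqVneq b a.
  case: k => [|k]; first by exists (e a); rewrite ?fact0 //; exact: integral_root_vec.
  exists 0; first exact: integral_vec0.
  by rewrite mul0rn iterSr lie_alt; elim: k => // k; rewrite iterS => ->; rewrite lie_br0r.
have [->|bNa] := eqVneq b (- a).
  case: k => [|[|[|k]]].
  - by exists (e (- a)); rewrite ?fact0 //; apply: integral_root_vec; rewrite root_oppE.
  - exists (vsval (H a)); first exact: integral_coroot.
    by rewrite (_ : 1`! = 1%N) // mulr1n /= (chev_br_opp chev).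
  - exists ((-1)%:~R *: e a); first exact/integral_vecZ/integral_root_vec.
    rewrite /= (chev_br_opp chev) // br_root_coroot // rv_coroot //.
    by rewrite -scaler_nat scalerA rmorphN1; congr (_ *: _); rewrite mulrN1.
  exists 0; first exact: integral_vec0.
  by rewrite mul0rn iterSr (chev_br_opp chev) // ad_coroot_iter.
have [->|[rts [m [s ->]]]] := ad_root_iter k aP bP ba bNa.
  by exists 0; [exact: integral_vec0|rewrite mul0rn].
exists (((-1) ^+ s *: e (b + a *+ k)) *+ m) => //.
rewrite -scaler_nat scalerA.
have -> : m%:R * (-1) ^+ s = (m%:Z * (-1) ^+ s)%:~R :> C.
  by rewrite rmorphM rmorphXn /= rmorphN1.
by apply/integral_vecZ/integral_root_vec/rts.
Qed.

Lemma size_chevalley a : a \in Phi -> (2 < N)%N.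
Proof.
move=> aP; have [c cD _] := knorm_base aP.
have aNa : a != - a.
  by rewrite -addr_eq0 -mulr2n root_mulrn_eq0.
rewrite size_cat !size_map -(ltn_predK (_ : 0 < size Delta)%N); last by case: (Delta) cD.
have : (size [:: a; - a] <= size Phi)%N.
  apply: uniq_leq_size; first by rewrite /= inE aNa.
  by move=> b; rewrite !inE => /orP[] /eqP->; rewrite ?root_oppE.
by rewrite /= addSn ltnS => /leq_trans; apply; exact: leq_addl.
Qed.

Lemma ad_iter_eq0 a x k : a \in Phi -> x \in B -> (2 < k)%N ->
    (forall b, b \in Phi -> b != - a -> exists2 j, (j <= k)%N & b + a *+ j \notin Phi) ->
  iter k (lie_br (e a)) x = 0.
Proof.
move=> aP + k2 out; have [k' kE] : exists k', k = k'.+3 by exists (k - 3)%N; rewrite -addn3 subnK.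
rewrite mem_cat => /orP[] /mapP[b bP ->].
  by rewrite kE (ad_coroot_iter _ aP (base_root bP)).
have [->|ba] := eqVneq b a.
  rewrite kE iterSr lie_alt; elim: (k'.+2) => // j; rewrite iterS => ->; exact: lie_br0r.
have [->|bNa] := eqVneq b (- a).
  by rewrite kE iterSr (chev_br_opp chev) // ad_coroot_iter.
have [//|[rts _]] := ad_root_iter k aP bP ba bNa.
by have [j /rts ->] := out b bP bNa.
Qed.

(** A string of k + 1 distinct roots does not fit into [Phi]. *)
Lemma ad_iter_nilpotent a x k : a \in Phi -> x \in B -> (N <= k)%N ->
  iter k (lie_br (e a)) x = 0.
Proof.
move=> aP xB Nk; apply: ad_iter_eq0 => // [|b bP bNa].
  exact: leq_trans (size_chevalley aP) Nk.
case/boolP: [exists j : 'I_k.+1, b + a *+ j \notin Phi] => [/existsP[j jP]|].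
  by exists j => //; rewrite -ltnS.
rewrite negb_exists => /forallP rts.
have : (size (mkseq (fun j => b + a *+ j)%R k.+1) <= size Phi)%N.
  apply: uniq_leq_size; first by rewrite mkseq_uniq //; exact: mulrn_root_inj.
  move=> _ /mapP[j jk ->]; rewrite mem_iota in jk.
  by have := rts (Ordinal (jk : (j < k.+1)%N)); rewrite negbK.
rewrite size_mkseq => /(leq_trans (leq_ltn_trans Nk (ltnSn k))).
by rewrite size_cat !size_map ltnNge leq_addl.
Qed.

Definition div_ad a k : 'M[int]_N :=
  \matrix_(i < N, j < N) to_int (co i (iter k (lie_br (e a)) B`_j) / k`!%:R).

Lemma mxint_div_ad a k : a \in Phi ->
  mxint C (div_ad a k) *+ k`! = ad_mx (e a) ^+ k.
Proof.
move=> aP; rewrite ad_mx_iter; apply/matrixP => i j; rewrite mulmxnE !mxE.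
have [|v iv ->] := @ad_iter_divisible a B`_j k aP; first exact: mem_nth.
have [z zE] := iv i; have f0 : k`!%:R != 0 :> C by rewrite pnatr_eq0 -lt0n fact_gt0.
by rewrite raddfMn /= zE -[z%:~R *+ _]mulr_natr mulfK // to_intK mulr_natr.
Qed.

Lemma mxint_div_ad1 a : a \in Phi -> mxint C (div_ad a 1%N) = ad_mx (e a).
Proof. by move=> aP; have := mxint_div_ad 1 aP; rewrite mulr1n expr1. Qed.

Lemma mxint_inj : injective (@mxint N C).
Proof.
move=> M M' /matrixP e1; apply/matrixP => i j; have := e1 i j.
by rewrite !mxE => /intr_inj.
Qed.

Lemma divided_powers_ad a : a \in Phi -> divided_powers (div_ad a).
Proof.
move=> aP; split=> [k|k Nk].
  apply: mxint_inj; rewrite mxintX mxint_div_ad1 // -mxint_div_ad // mxintMn.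
  by rewrite scaler_nat.
apply/matrixP => i j; rewrite !mxE ad_iter_nilpotent ?mem_nth // linear0 mul0r.
exact: (to_intK C 0).
Qed.

Lemma div_ad_br a b c (z : int) : a \in Phi -> b \in Phi -> c \in Phi ->
    [e a, e b] = z%:~R *: e c ->
  div_ad a 1%N *m div_ad b 1%N = div_ad b 1%N *m div_ad a 1%N + div_ad c 1%N *~ z.
Proof.
move=> aP bP cP abE; apply: mxint_inj.
by rewrite mxintD mxintMz !mxintM !mxint_div_ad1 // ad_mx_br abE ad_mxZ.
Qed.

Lemma div_ad_comm a b : a \in Phi -> b \in Phi -> [e a, e b] = 0 ->
  GRing.comm (div_ad a 1%N) (div_ad b 1%N).
Proof.
move=> aP bP abE; rewrite /GRing.comm -[LHS]/(_ *m _) (@div_ad_br a b a 0) //.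
  by rewrite mulr0z addr0.
by rewrite abE scale0r.
Qed.

Lemma div_ad_sl2 a : a \in Phi ->
  let Z := div_ad a 1%N * div_ad (- a) 1%N - div_ad (- a) 1%N * div_ad a 1%N in
  div_ad a 1%N * Z = Z * div_ad a 1%N - div_ad a 1%N *+ 2.
Proof.
move=> aP Z; have naP := root_opp aP.
have ZE : mxint C Z = ad_mx (vsval (H a)).
  rewrite /Z mxintB ![mxint _ (_ * _)]mxintM !mxint_div_ad1 // ad_mx_br.
  by rewrite (chev_br_opp chev) // addrC addKr.
apply: mxint_inj; rewrite mxintB ![mxint _ (_ * _)]mxintM ZE mxintMn mxint_div_ad1 //.
by rewrite ad_mx_br br_root_coroot // rv_coroot // ad_mxZ scaleNr.
Qed.

Variable A : finComUnitRingType.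

Lemma chevalley_mxE a (t : A) : a \in Phi ->
  chevalley_mx Phi Delta H e a t = osum (div_ad a) t.
Proof.
move=> aP; apply/matrixP => i j; rewrite !mxE summxE.
have f0 : (to_int (0 : C))%:~R = 0 :> A by rewrite (to_intK C 0).
have -> : map_poly (fun z : C => (to_int z)%:~R : A)
    (\poly_(k < N) (co i (iter k (lie_br (e a)) B`_j) / k`!%:R)) =
    \poly_(k < N) (to_int (co i (iter k (lie_br (e a)) B`_j) / k`!%:R))%:~R.
  by apply/polyP => k; rewrite coef_map_id0 // !coef_poly; case: ifP.
by rewrite horner_poly; apply: eq_bigr => k _; rewrite !mxE mulrC.
Qed.

(** * Heisenberg relations and torus elements at a long root *)

Section LongRoot.

Variable b : dual h.
Hypotheses (bP : b \in Phi) (bmin : forall a, a \in Phi -> knorm b <= knorm a).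

Lemma cartDl a a' c : a \in Phi -> a' \in Phi -> c \in Phi ->
  cart (a + a') c = cart a c + cart a' c.
Proof. by move=> aP a'P cP; apply: cart_eq; rewrite rvD rmorphD /= !cartE. Qed.

Lemma cart_mulrn a a' c j : a \in Phi -> a' \in Phi -> c \in Phi ->
  cart (a + a' *+ j) c = cart a c + cart a' c *+ j.
Proof.
by move=> aP a'P cP; apply: cart_eq; rewrite rvD rvMn rmorphD rmorphMn /= !cartE.
Qed.

Lemma long_cart_le1 c : c \in Phi -> c != b -> cart c b <= 1.
Proof.
move=> cP; apply: contraNT; rewrite -ltNge => c1; apply/eqP.
exact: (long_root_max bP bmin cP).
Qed.

Lemma long_add a a' : a \in Phi -> a' \in Phi -> 2 <= cart a b + cart a' b ->
  a + a' \in Phi -> a + a' = b.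
Proof. by move=> aP a'P h2 aaP; apply: (long_root_max bP bmin aaP); rewrite cartDl. Qed.

Lemma br_long0 a a' : a \in Phi -> a' \in Phi -> 2 <= cart a b + cart a' b ->
  a + a' != b -> [e a, e a'] = 0.
Proof.
move=> aP a'P h2 aab; apply: br_root_space_eq0 (root_vecP aP) (root_vecP a'P).
  by apply: contra aab => /(long_add aP a'P h2)/eqP.
apply: contraTneq h2 => aa0; rewrite -cartDl // aa0 (@cart_eq _ _ 0) //.
by rewrite rv0.
Qed.

Lemma heis_opp a : a \in Phi -> cart a b = 1 -> b - a \in Phi /\ cart (b - a) b = 1.
Proof.
move=> aP ab1; have Hb : b - a \in Phi.
  by rewrite -root_oppE opprB; have := refl_root bP aP; rewrite /refl ab1 mulr1z.
by split=> //; rewrite cartDl ?root_oppE // cart_diag // cart_oppl // ab1.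
Qed.

(** The constant r + 1 is at most <b, a^vee>, the ratio of squared lengths of b and a: otherwise the
    reflection in a of the root b - (r+1)a would pair with b^vee to more than 2. *)
Lemma heis_br a : a \in Phi -> cart a b = 1 -> exists r s : nat,
  [e a, e (b - a)] = ((-1) ^+ s * r.+1%:Z)%:~R *: e b /\ r.+1%:Z * knorm b <= knorm a.
Proof.
move=> aP ab1; have [baP ba1] := heis_opp aP ab1.
have aba : a + (b - a) = b by rewrite addrC subrK.
have [|r [s [rmax [rP E]]]] := br_root_vecs aP baP; first by rewrite aba.
exists r, s; split.
  by rewrite E aba -scaler_nat scalerA rmorphM rmorphXn /= rmorphN1.
have kE : cart b a * knorm b = knorm a by rewrite cart_knorm // ab1 mul1r.
have kb0 := knorm_gt0 bP; have ka0 := knorm_gt0 aP.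
rewrite -kE ler_pM2r // leNgt; apply/negP => lt.
set d := b - a - a *+ r in rP.
have dE : d = b - a *+ r.+1 by rewrite /d mulrS opprD addrA.
have dNa : d != - a.
  apply/eqP => da; have bE : b = a *+ r.
    by apply/eqP; rewrite -subr_eq0 -[b](subrK a) addrAC -/d da addNr.
  case: r {rmax rP E lt d dE da} bE => [|[|r]] bE.
  - by have := root_neq0 bP; rewrite bE mulr0n eqxx.
  - by move: ab1; rewrite bE mulr1n cart_diag.
  - by have := @root_multiple a r.+2 aP isT; rewrite -bE bP.
have db : cart d a = cart b a - r.+1%:Z * 2.
  apply: cart_eq; rewrite dE rvB rvMn rv_coroot // -cartE // rmorphB rmorphM /=.
  by rewrite mulr_natl.
(* Adding [j] copies of a reflects d in a. *)
pose j := absz (cart b a - r.+1%:Z * 2)%R.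
have jE : j%:Z = r.+1%:Z * 2 - cart b a by rewrite /j; lia.
have djP : d + a *+ j \in Phi by apply: root_add => //; rewrite db jE; lia.
have : cart (d + a *+ j) b <= 2.
  have [->|/(long_cart_le1 djP)] := eqVneq (d + a *+ j) b; first by rewrite cart_diag.
  by move/le_trans; apply.
have -> : cart (d + a *+ j) b = 2 - r.+1%:Z + j%:Z.
  apply: cart_eq; rewrite dE rvD rvB !rvMn rv_coroot // -cartE // ab1.
  by rewrite rmorphD rmorphB.
by rewrite jE; lia.
Qed.

(** Three steps along b raise the pairing with b^vee by 6, from at least -1 to beyond its maximum
    2. *)
Lemma long_cube k : (2 < k)%N -> div_ad b k = 0.
Proof.
move=> k2; apply/matrixP => i j; rewrite !mxE ad_iter_eq0 ?mem_nth //.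
  by rewrite linear0 mul0r; exact: (to_intK C 0).
move=> c cP cNb; exists 3%N => //; apply/negP => c3P.
have : cart (- c) b <= 1.
  by apply: long_cart_le1; rewrite ?root_oppE // eqr_oppLR.
have : cart (c + b *+ 3) b <= 2.
  have [->|/(long_cart_le1 c3P)] := eqVneq (c + b *+ 3) b; first by rewrite cart_diag.
  by move/le_trans; apply.
rewrite cart_mulrn // cart_oppl // cart_diag //; lia.
Qed.

(** Only the divided powers of degree 0, 1 and 2 survive, and the last is half the square of the
    first, so the relation in degree 1 implies the one in degree 2. *)
Lemma long_root_conj (M : 'M[A]_N) (u t : A) : 2 \is a @GRing.unit A ->
    M *m mxint A (div_ad b 1%N) = u *: mxint A (div_ad b 1%N) *m M ->
  M *m osum (div_ad b) t = osum (div_ad b) (u * t) *m M.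
Proof.
move=> u2 M1; have dU := divided_powers_ad bP; have [Uk _] := dU.
have M2 : M *m mxint A (div_ad b 2) = u ^+ 2 *: mxint A (div_ad b 2) *m M.
  have X2 : mxint A (div_ad b 1%N) *m mxint A (div_ad b 1%N) = 2 *: mxint A (div_ad b 2).
    by rewrite -mxintM -[_ *m _]/(_ * _) -expr2 Uk mxintMn.
  have s2I : injective (fun X : 'M[A]_N => (2 : A) *: X).
    by apply: (can_inj (g := fun X => 2^-1 *: X)) => X; rewrite scalerA mulVr // scale1r.
  apply: s2I; rewrite /= scalemxAr -X2 mulmxA M1 -!scalemxAl -mulmxA M1.
  rewrite -scalemxAl -scalemxAr !mulmxA X2 -!scalemxAl !scalerA; congr (_ *: _).
  by ring.
have oE r : osum (div_ad b) r =
    1%:M + (r *: mxint A (div_ad b 1%N) + r ^+ 2 *: mxint A (div_ad b 2)).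
  rewrite (osumE r dU (leq_addl 3 N)) !big_ord_recl /= big1 ?addr0 => [|i _]; last first.
    by rewrite long_cube // /mxint map_mx0 scaler0.
  by rewrite expr0 expr1 scale1r divided_powers0 // /mxint map_mx1.
rewrite !oE !mulmxDr !mulmxDl mulmx1 mul1mx -!scalemxAr M1 M2 -!scalemxAl !scalerA.
by rewrite exprMn [u * t]mulrC [u ^+ 2 * _]mulrC.
Qed.

Local Notation X a t := (osum (div_ad a) (t : A)).
Local Notation G := (adjoint_chevalley_group Phi Delta H e A).

(** Invertibility is part of the condition because [toGL] sends singular matrices to the
    identity. *)
Definition inG (M : 'M[A]_N) : Prop := M \in unitmx /\ toGL M \in G.

Lemma inG_gen a (t : A) : a \in Phi -> inG (X a t).
Proof.
move=> aP; have dU := divided_powers_ad aP.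
have uX : X a t \in unitmx.
  by have /mulmx1_unit[] : X a t *m X a (- t) = 1%:M by rewrite -osumD // subrr osum0.
split=> //; apply: mem_gen; rewrite inE; apply/hasP; exists a => //.
apply/existsP; exists t; rewrite chevalley_mxE // toGLE //.
exact: ltnW (ltnW (size_chevalley bP)).
Qed.

Lemma inGM M M' : inG M -> inG M' -> inG (M *m M').
Proof.
move=> [uM GM] [uM' GM']; split; first by rewrite unitmx_mul uM.
by rewrite toGLM ?groupM // (ltnW (ltnW (size_chevalley bP))).
Qed.

Local Notation E a := (mxint A (div_ad a 1%N)).

Lemma conj_comm a c (t : A) : a \in Phi -> c \in Phi -> [e a, e c] = 0 ->
  X a t *m E c = E c *m X a t.
Proof.
move=> aP cP ac0; have dU := divided_powers_ad aP.
rewrite (osum_conj t dU (Z := 0)) ?addr0 /GRing.comm ?mulr0 ?mul0r //.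
  by rewrite /mxint map_mx0 scaler0 addr0.
exact: div_ad_comm.
Qed.

Lemma conj_add a c d (z : int) (t : A) : a \in Phi -> c \in Phi -> d \in Phi ->
    [e a, e c] = z%:~R *: e d -> [e a, e d] = 0 ->
  X a t *m E c = (E c + (t * z%:~R) *: E d) *m X a t.
Proof.
move=> aP cP dP acE ad0; have dU := divided_powers_ad aP.
rewrite (osum_conj t dU (Z := div_ad d 1%N *~ z)); last 2 first.
- exact: div_ad_br.
- by rewrite /GRing.comm mulrzAr mulrzAl div_ad_comm.
by rewrite mxintMz scalerA.
Qed.

Lemma br_root_int a c : a \in Phi -> c \in Phi -> a + c \in Phi ->
  exists z : int, [e a, e c] = z%:~R *: e (a + c).
Proof.
move=> aP cP acP; have [r [s [_ [_ ->]]]] := br_root_vecs aP cP acP.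
exists ((-1) ^+ s * r.+1%:Z).
by rewrite -scaler_nat scalerA rmorphM rmorphXn /= rmorphN1.
Qed.

(** The vectors e_b and e_(b+c) span a standard representation of the SL2 of c, whose torus scales
    e_b by any unit. *)
Lemma torus_conj c (u : A) : c \in Phi -> cart b c = -1 -> u \is a GRing.unit ->
  exists2 M, inG M & M *m E b = u *: E b *m M.
Proof.
move=> cP bc1 uu; have ncP := root_opp cP.
have cb0 : cart c b < 0.
  have := cart_knorm cP bP; rewrite bc1; have := knorm_gt0 bP; have := knorm_gt0 cP.
  by clear; nia.
have cNb : c != - b by apply/eqP => cb; move: bc1; rewrite cb cart_oppr // cart_diag.
have cb1 : cart c b = -1.
  have : cart (- c) b <= 1 by apply: long_cart_le1; rewrite // eqr_oppLR.
  by rewrite cart_oppl //; move: cb0; clear; lia.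
set d := c + b.
have bNc : b != - c by rewrite -eqr_oppLR eq_sym.
have dP : d \in Phi by rewrite /d addrC -[c]mulr1n root_add // bc1.
have ncbb : - c + b != b.
  by rewrite -subr_eq0 addrK oppr_eq0 root_neq0.
have ncb2 : 2 <= cart (- c) b + cart b b by rewrite cart_oppl // cb1 cart_diag.
have ncb0 : [e (- c), e b] = 0 by exact: br_long0.
have dc1 : cart d c = 1 by rewrite /d cartDl // bc1 cart_diag.
have cd0 : [e c, e d] = 0.
  apply: br_root_space_eq0 (root_vecP cP) (root_vecP dP).
    (* If b + 2c were a root, it would pair with c^vee to 3, so b - c would be a root as well; but b
       - c pairs with b^vee to 3, which only b itself could do. *)
    apply: contra ncbb => cdP; apply/eqP; apply: long_add => //.
    have -> : - c + b = c + d + (- c) *+ 3.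
      rewrite /d mulNrn mulrS opprD addrA [c + (c + b)]addrC addrK.
      by rewrite mulr2n opprD addrA [c + b]addrC addrK addrC.
    apply: root_add => //; last by rewrite cart_oppr // opprK cartDl // dc1 cart_diag.
    by rewrite opprK -subr_eq0 addrAC subrr add0r root_neq0.
  by rewrite addrC addr_eq0; apply: contra_eqN dc1 => /eqP ->; rewrite cart_oppl // cart_diag.
have ncdb : - c + d = b by rewrite /d addKr.
have [z cbE] : exists z : int, [e c, e b] = z%:~R *: e d by exact: br_root_int.
have [z' ncdE] : exists z' : int, [e (- c), e d] = z'%:~R *: e b.
  by have := br_root_int ncP dP; rewrite ncdb; apply.
(* By Jacobi, ad(e_(-c)) ad(e_c) acts on e_b as -<b, c^vee> = 1. *)
have zz' : z * z' = 1.
  apply: (@intr_inj C); have := lie_br_der (e (- c)) (e c) (e b).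
  rewrite ncb0 lie_br0r addr0 (lie_brC (e (- c)) (e c)) (chev_br_opp chev) // lie_brNl.
  rewrite (root_spaceE _ (root_vecP bP)) -cartE // bc1 cbE lie_brZr ncdE scalerA.
  rewrite -scaleNr => /eqP; rewrite -subr_eq0 -scalerBl scaler_eq0.
  rewrite (negPf (root_vec_neq0 bP)) orbF subr_eq0 rmorphM => /eqP ->.
  by rewrite rmorphN1 opprK.
pose Q := (z%:~R : A) *: E d.
have cB (t : A) : X c t *m E b = (E b + t *: Q) *m X c t.
  by rewrite (conj_add t cP bP dP cbE cd0) scalerA.
have cQ (t : A) : X c t *m Q = Q *m X c t.
  by rewrite -scalemxAr (conj_comm t cP dP cd0) scalemxAl.
have nB (t : A) : X (- c) t *m E b = E b *m X (- c) t by exact: conj_comm.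
have nQ (t : A) : X (- c) t *m Q = (Q + t *: E b) *m X (- c) t.
  rewrite -scalemxAr (conj_add t ncP dP bP ncdE ncb0) scalemxAl scalerDr scalerA.
  by congr ((_ + _ *: _) *m _); rewrite mulrCA -rmorphM zz' mulr1.
(* In SL2 the first column of this word is the one of diag(u, u^-1). *)
exists (X c (- u^-1) *m (X (- c) (u - 1) *m X c 1)).
  by apply: inGM; [exact: inG_gen|apply: inGM; exact: inG_gen].
have s1 : X c 1 *m E b = (E b + Q) *m X c 1 by rewrite cB scale1r.
have s2 : X (- c) (u - 1) *m (E b + Q) = (u *: E b + Q) *m X (- c) (u - 1).
  rewrite mulmxDr nB nQ -mulmxDl; congr (_ *m _).
  by rewrite scalerBl scale1r addrCA addrC addrCA subrr addr0 addrC.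
have s3 : X c (- u^-1) *m (u *: E b + Q) = (u *: E b) *m X c (- u^-1).
  rewrite mulmxDr -scalemxAr cB cQ scalemxAl -mulmxDl; congr (_ *m _).
  by rewrite scalerDr scalerA mulrN mulrV // scaleN1r subrK.
move: s1 s2 s3; set W3 := X c 1; set W1 := X c _; set W2 := X (- c) _ => s1 s2 s3.
by rewrite -!mulmxA s1 (mulmxA W2) s2 -(mulmxA _ W2) [LHS]mulmxA s3 -!mulmxA.
Qed.

(** The word of [torus_conj] with c = -b, now in the adjoint representation of the SL2 of b, where
    e_b has weight 2; hence the square. *)
Lemma torus_conj_sqr (u : A) : u \is a GRing.unit ->
  exists2 M, inG M & M *m E b = u ^+ 2 *: E b *m M.
Proof.
move=> uu; have nbP := root_opp bP.
pose Z0 := div_ad b 1%N * div_ad (- b) 1%N - div_ad (- b) 1%N * div_ad b 1%N.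
pose Z := mxint A Z0.
have dU := divided_powers_ad bP; have dV := divided_powers_ad nbP.
have UM : div_ad b 1%N * div_ad (- b) 1%N = div_ad (- b) 1%N * div_ad b 1%N + Z0.
  by rewrite addrC subrK.
have VM : div_ad (- b) 1%N * div_ad b 1%N = div_ad b 1%N * div_ad (- b) 1%N + (- Z0).
  by rewrite opprB addrC subrK.
have UZ : div_ad b 1%N * Z0 = Z0 * div_ad b 1%N - div_ad b 1%N *+ 2 := div_ad_sl2 bP.
have VZ : div_ad (- b) 1%N * (- Z0) = (- Z0) * div_ad (- b) 1%N - div_ad (- b) 1%N *+ 2.
  by have := div_ad_sl2 nbP; rewrite /= opprK opprB.
have bB (t : A) : X b t *m E b = E b *m X b t by apply: conj_comm; rewrite ?lie_alt.
have bZ (t : A) : X b t *m Z = (Z - (2 * t) *: E b) *m X b t by exact: osum_conj_cartan.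
have bV (t : A) : X b t *m E (- b) = (E (- b) + t *: Z - t ^+ 2 *: E b) *m X b t.
  exact: osum_conj_opposite.
have vV (t : A) : X (- b) t *m E (- b) = E (- b) *m X (- b) t.
  by apply: conj_comm; rewrite ?lie_alt.
have vZ (t : A) : X (- b) t *m Z = (Z + (2 * t) *: E (- b)) *m X (- b) t.
  have := osum_conj_cartan dV VZ t; rewrite mxintN mulmxN => /(congr1 -%R).
  by rewrite opprK -mulNmx opprD !opprK.
have vB (t : A) : X (- b) t *m E b = (E b - t *: Z - t ^+ 2 *: E (- b)) *m X (- b) t.
  by have := osum_conj_opposite dV VM VZ t; rewrite mxintN scalerN.
pose W1 := X (- b) (- u^-1); pose W2 := X b (u - 1); pose W3 := X (- b) 1.
have s1 : W3 *m E b = (E b - Z - E (- b)) *m W3.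
  by rewrite vB expr1n !scale1r.
have s2 : W2 *m (E b - Z - E (- b)) = (u ^+ 2 *: E b - u *: Z - E (- b)) *m W2.
  rewrite !mulmxBr bB bZ bV -!mulmxBl; congr (_ *m _).
  have gen (Y1 Y2 Y3 : 'M[A]_N) : Y1 - (Y2 - (2 * (u - 1)) *: Y1) -
      (Y3 + (u - 1) *: Y2 - (u - 1) ^+ 2 *: Y1) = u ^+ 2 *: Y1 - u *: Y2 - Y3.
    by apply/matrixP => i j; rewrite !mxE; ring.
  exact: gen.
have s3 : W1 *m (u ^+ 2 *: E b - u *: Z - E (- b)) = (u ^+ 2 *: E b) *m W1.
  rewrite !mulmxBr -!scalemxAr vB vZ vV !scalemxAl -!mulmxBl; congr (_ *m _).
  have ut : u * - u^-1 = -1 by rewrite mulrN mulrV.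
  have gen (t : A) (Y1 Y2 Y3 : 'M[A]_N) : u * t = -1 ->
      u ^+ 2 *: (Y1 - t *: Y2 - t ^+ 2 *: Y3) - u *: (Y2 + (2 * t) *: Y3) - Y3 =
      u ^+ 2 *: Y1.
    move=> e1; apply/matrixP => i j; rewrite !mxE.
    transitivity (u ^+ 2 * Y1 i j - (u * t + 1) * u * Y2 i j - (u * t + 1) ^+ 2 * Y3 i j).
      by ring.
    by rewrite e1; ring.
  exact: gen.
exists (W1 *m (W2 *m W3)).
  by apply: inGM; [exact: inG_gen|apply: inGM; exact: inG_gen].
by rewrite -!mulmxA s1 (mulmxA W2) s2 -(mulmxA _ W2) [LHS]mulmxA s3 -!mulmxA.
Qed.

(** The entry in row e_b and column H_b is -2t; H_b is a basis vector because b is simple. *)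
Lemma osum_neq1 (t : A) : b \in Delta -> t != 0 -> 2 \is a @GRing.unit A -> X b t != 1%:M.
Proof.
move=> bD t0 u2; have dU := divided_powers_ad bP.
have ebB : e b \in B by rewrite mem_cat map_f ?orbT.
have HbB : vsval (H b) \in B.
  by rewrite mem_cat; apply/orP; left; apply/mapP; exists b.
have il : (index (e b) B < N)%N by rewrite index_mem.
have jl : (index (vsval (H b)) B < N)%N by rewrite index_mem.
pose i := Ordinal il; pose j := Ordinal jl.
have coi : co i (e b) = 1 by rewrite -(nth_index 0 ebB) (coE i i) eqxx.
have e1 : iter 1 (lie_br (e b)) B`_j = (- 2) *: e b.
  by rewrite /= nth_index // br_root_coroot // rv_coroot.
apply/eqP => /matrixP/(_ i j); rewrite (osumE t dU (leq_addl 2 N)) summxE.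
rewrite !big_ord_recl big1 ?addr0 => [|k _]; last first.
  by rewrite !mxE nth_index // ad_coroot_iter // linear0 mul0r (to_intK C 0) mulr0.
rewrite !mxE e1 linearZ /= coi nth_index //.
have ij : (i == j) = false.
  apply/eqP => ij; have eH : e b = vsval (H b).
    by rewrite -(nth_index 0 ebB) -(nth_index 0 HbB) -/i -[index (e b) B]/(val i) ij.
  have := br_root_coroot (H b) bP; rewrite -eH lie_alt rv_coroot // => /esym/eqP.
  by rewrite scaler_eq0 oppr_eq0 pnatr_eq0 (negPf (root_vec_neq0 bP)).
have coj : co i (vsval (H b)) = 0.
  by rewrite -(nth_index 0 HbB) (coE i j) ij.
rewrite coj ij mul0r (to_intK C 0) mulr0 add0r expr1 => /eqP.
have -> : to_int ((-2) * 1 / (bump 0 0)`!%:R : C) = -2.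
  by rewrite mulr1 divr1; exact: (to_intK C (-2)).
rewrite mulrC rmorphN mulNr oppr_eq0 => /eqP t2; case/eqP: t0.
by apply: (mulrI u2); rewrite mulr0.
Qed.

Theorem heisenberg_rep_bound (I : finType) (al : I -> dual h) (T : {set A}) (t0 : A)
    (K : numClosedFieldType) (d : nat) (rG : mx_representation K G d) :
    mx_faithful rG -> b \in Delta -> t0 != 0 ->
    (forall s : A, s != 0 -> exists r, s * r = t0) -> 2 \is a @GRing.unit A ->
    (forall i, al i \in Phi) -> (forall i, cart (al i) b = 1) -> injective al ->
    (forall i j, al i + al j != b) ->
    (forall i m, m.+1%:Z * knorm b <= knorm (al i) -> m.+1%:R \is a @GRing.unit A) ->
    {in T, forall u, u \is a GRing.unit} ->
    {in T, forall u, exists2 M, inG M & M *m E b = u *: E b *m M} ->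
  (#|T| * #|A| ^ #|I| <= d)%N.
Proof.
move=> faith bD t0_neq0 t0_soc u2 alP al1 al_inj alD al_unit T_unit T_conj.
have N0 : (0 < N)%N := ltnW (ltnW (size_chevalley bP)).
pose rho (M : 'M[A]_N) := rG (toGL M).
have rhoM M M' : inG M -> inG M' -> rho (M *m M') = rho M *m rho M'.
  by move=> [uM GM] [uM' GM']; rewrite /rho toGLM // repr_mxM.
have rhoU M : inG M -> rho M \in unitmx by case=> _ GM; exact: repr_mx_unit.
have alP' i : b - al i \in Phi := (heis_opp (alP i) (al1 i)).1.
have al1' i : cart (b - al i) b = 1 := (heis_opp (alP i) (al1 i)).2.
have [c cP] : {c : I -> int & forall i, [e (al i), e (b - al i)] = (c i)%:~R *: e b /\
    (c i)%:~R \is a @GRing.unit A}.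
  apply: (@choice _ _ (fun i z => [e (al i), e (b - al i)] = z%:~R *: e b /\
    z%:~R \is a @GRing.unit A)) => i.
  have [r [s [E1 E2]]] := heis_br (alP i) (al1 i); eexists; split; first exact: E1.
  rewrite rmorphM rmorphXn /= rmorphN1 unitrM unitrX ?unitrN1 //=.
  exact: al_unit E2.
have comm0 a a' : a \in Phi -> a' \in Phi -> 2 <= cart a b + cart a' b -> a + a' != b ->
    forall s t : A, rho (X a s) *m rho (X a' t) = rho (X a' t) *m rho (X a s).
  move=> aP a'P h2 aab s t; rewrite -!rhoM; try exact: inG_gen.
  congr rho; apply: osum_comm; try exact: divided_powers_ad.
  by apply: div_ad_comm => //; exact: br_long0.
have addb a : a \in Phi -> b + a != b.
  by move=> aP; rewrite -subr_eq0 addrAC subrr add0r root_neq0.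
apply: (@heisenberg_bound K A I d (fun t : A => rho (X b t))
  (fun i (t : A) => rho (X (al i) t)) (fun i (t : A) => rho (X (b - al i) t))
  (fun i => (c i)%:~R) T t0).
- by rewrite /rho osum0 ?toGL1 ?repr_mx1 //; exact: divided_powers_ad.
- by move=> s t; rewrite (osumD _ _ (divided_powers_ad bP)) rhoM //; exact: inG_gen.
- by move=> i s t; apply: comm0; rewrite ?cart_diag ?al1 ?addb.
- by move=> i j s t; apply: comm0; rewrite ?al1.
- by move=> i s t; apply: comm0; rewrite ?cart_diag ?al1' ?addb.
- move=> i j s t ij; apply: comm0; rewrite ?al1 ?al1' //.
  by rewrite addrCA -subr_eq0 addrAC subrr add0r subr_eq0 (inj_eq al_inj).
- move=> i s t; have [cE _] := cP i.
  have G1 := inG_gen s (alP i); have G2 := inG_gen t (alP' i).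
  have G3 := inG_gen ((c i)%:~R * t * s) bP.
  rewrite -(rhoM _ _ G1 G2) -(rhoM _ _ G3 G2) -(rhoM _ _ (inGM G3 G2) G1).
  congr rho; rewrite [_ * t * s]mulrAC; apply: osum_heisenberg; try exact: divided_powers_ad.
  - exact: div_ad_br.
  - by apply: div_ad_comm => //; apply: br_long0; rewrite ?al1 ?cart_diag // addrC addb.
  - by apply: div_ad_comm => //; apply: br_long0; rewrite ?al1' ?cart_diag // addrC addb.
- by move=> i t; apply: rhoU; exact: inG_gen.
- by move=> i t; apply: rhoU; exact: inG_gen.
- by move=> i; have [] := cP i.
- exact: t0_soc.
- exact: T_unit.
- move=> u uT; have [M inM ME] := T_conj u uT; exists (rho M); first exact: rhoU.
  move=> t; rewrite -!rhoM //; try exact: inG_gen.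
  by congr rho; exact: long_root_conj.
apply: contraNneq (osum_neq1 bD t0_neq0 u2) => rho1; apply/eqP.
have [uX GX] := inG_gen t0 bP; apply: toGL_inj; rewrite ?unitmx1 // toGL1 //.
by apply: (mx_faithful_inj faith); rewrite // repr_mx1.
Qed.

End LongRoot.

(** * From the Cartan matrix to the bound *)

Section TypedBase.

Variables (X : dynkin) (D : seq (dual h)).
Hypotheses (size_Delta : size Delta = dynkin_rank X) (D_Delta : perm_eq D Delta).
Hypothesis D_cartan : forall i j, (i < dynkin_rank X)%N -> (j < dynkin_rank X)%N ->
  rv D`_i (H D`_j) = (cartan_entry X i j)%:~R.

Local Notation rk := (dynkin_rank X).

Lemma size_typed_base : size D = rk.
Proof. by rewrite (perm_size D_Delta). Qed.

Lemma typed_base_mem j : (j < rk)%N -> D`_j \in Delta.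
Proof. by move=> jr; rewrite -(perm_mem D_Delta) mem_nth // size_typed_base. Qed.

Lemma typed_base_root j : (j < rk)%N -> D`_j \in Phi.
Proof. by move/typed_base_mem/base_root. Qed.

Definition wt (s : seq nat) : dual h := \sum_(i <- s) D`_i.

Lemma wt_inj s s' : {in s, forall i, (i < rk)%N} -> {in s', forall i, (i < rk)%N} ->
  wt s = wt s' -> perm_eq s s'.
Proof.
move=> sr s'r wE; have [_ Db _] := Delta_base.
have fD : free (in_tuple D) by rewrite /= (perm_free D_Delta) (basis_free Db).
have cE (i : 'I_(size D)) r : {in r, forall i, (i < rk)%N} ->
    coord (in_tuple D) i (wt r) = (count_mem (val i) r)%:R.
  elim: r => [|j r IH] jr; first by rewrite /wt big_nil linear0.
  have jD : (j < size D)%N by rewrite size_typed_base jr ?mem_head.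
  rewrite /wt big_cons linearD /= -/(wt r) IH => [|l lr]; last by rewrite jr // inE lr orbT.
  have -> : coord (in_tuple D) i D`_j = (j == i)%:R := coord_free (Ordinal jD) i fD.
  by rewrite natrD.
apply/allP => i; rewrite mem_cat /= => iss'.
have iD : (i < size D)%N by rewrite size_typed_base; case/orP: iss' => [/sr|/s'r].
have := congr1 (coord (in_tuple D) (Ordinal iD)) wE.
by rewrite !cE //= => /eqP; rewrite eqr_nat.
Qed.

Lemma rv_wt s j : {in s, forall i, (i < rk)%N} -> (j < rk)%N ->
  rv (wt s) (H D`_j) = (pairing X s j)%:~R.
Proof.
elim: s => [|i s IH] sr jr; first by rewrite /wt big_nil rv0.
rewrite /wt big_cons rvD -/(wt s) IH // => [|l ls]; last by rewrite sr // inE ls orbT.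
by rewrite (D_cartan (sr i (mem_head _ _)) jr) -rmorphD.
Qed.

Lemma wt_root (b : nat) s : (b < rk)%N -> root_path X b s -> wt s \in Phi.
Proof.
move=> br; elim=> [|{}s s' j m bs sP jr ms s'E].
  by rewrite /wt big_seq1 typed_base_root.
have sr := root_path_lt br bs.
rewrite /wt (perm_big _ s'E) big_cat big_nseq iter_addr_0 /= addrC.
apply: root_add => //; first exact: typed_base_root.
  rewrite -addr_eq0; apply/negP => /eqP w0.
  have /perm_size : perm_eq (j :: s) [::].
    apply: wt_inj => // [i|]; first by rewrite inE => /orP[/eqP->|/sr].
    by rewrite /wt big_cons big_nil addrC.
  by [].
by rewrite (@cart_eq _ _ (pairing X s j)) // rv_wt.
Qed.

(** Every root has the length of some simple root, and the Cartan matrix relates the lengths of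
    these. *)
Lemma typed_base_long (b : nat) r : (b < rk)%N -> length_ratio X b r ->
  forall a, a \in Phi -> knorm D`_b <= knorm a /\ knorm a <= r * knorm D`_b.
Proof.
move=> br lr a aP; have [c cD ->] := knorm_base aP.
have cj : (index c D < rk)%N by rewrite -size_typed_base index_mem (perm_mem D_Delta).
have -> : c = D`_(index c D) by rewrite nth_index // (perm_mem D_Delta).
apply: (lr (fun j => knorm D`_j)) => // [j jr|i j ir jr].
  exact: knorm_gt0 (typed_base_root jr).
have cE l l' : (l < rk)%N -> (l' < rk)%N -> cart D`_l D`_l' = cartan_entry X l l'.
  by move=> ltl ltl'; apply: cart_eq; exact: D_cartan.
by rewrite -!cE // cart_knorm // typed_base_root.
Qed.

Section Bound.

Variables (b k p : nat) (r : int) (t0 : A).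
Hypotheses (br : (b < rk)%N) (paths : heisenberg_paths X b k) (ratio : length_ratio X b r).
Hypotheses (rp : r < p%:Z) (p3 : (2 < p)%N).
Hypothesis natr_unit : forall m, (0 < m < p)%N -> m%:R \is a @GRing.unit A.
Hypotheses (t0_neq0 : t0 != 0) (t0_soc : forall s : A, s != 0 -> exists r, s * r = t0).
Variables (K : numClosedFieldType) (d : nat).
Variable rG : mx_representation K (adjoint_chevalley_group Phi Delta H e A) d.
Hypothesis faith : mx_faithful rG.

Lemma typed_rep_bound (T : {set A}) :
    {in T, forall u, u \is a GRing.unit} ->
    {in T, forall u, exists2 M, inG M &
       M *m mxint A (div_ad D`_b 1%N) = u *: mxint A (div_ad D`_b 1%N) *m M} ->
  (#|T| * #|A| ^ k <= d)%N.
Proof.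
move=> T_unit T_conj; have bP := typed_base_root br.
have long := typed_base_long br ratio.
have [L [uL permL <- LP]] := paths.
have u2 : 2 \is a @GRing.unit A by exact: natr_unit.
pose al (i : 'I_(size L)) := wt (nth [::] L i).
have LP' (i : 'I_(size L)) := LP _ (mem_nth [::] (ltn_ord i)).
have alr (i : 'I_(size L)) := root_path_lt br (LP' i).1.
have alP i : al i \in Phi := wt_root br (LP' i).1.
have := @heisenberg_rep_bound D`_b bP (fun a aP => (long a aP).1) 'I_(size L) al T t0 K d rG.
rewrite card_ord; apply => //.
- exact: typed_base_mem.
- by move=> i; apply: cart_eq; rewrite rv_wt ?(LP' i).2.
- move=> i j /wt_inj e1; apply: val_inj; apply/eqP.
  rewrite -(nth_uniq [::] (ltn_ord i) (ltn_ord j) uL); apply/eqP/permL; rewrite ?mem_nth //.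
  exact: e1.
(* Both roots have b as a summand, so their sum has at least two simple summands. *)
- move=> i j; apply/negP => /eqP.
  rewrite -[al i + _]big_cat -[D`_b](big_seq1 +%R b (fun j => D`_j)).
  move=> /wt_inj e1; have : perm_eq (nth [::] L i ++ nth [::] L j) [:: b].
    apply: e1 => l; last by rewrite inE => /eqP->.
    by rewrite mem_cat => /orP[/alr|/alr].
  have size0 (l : 'I_(size L)) : (0 < size (nth [::] L l))%N.
    by rewrite -has_predT; apply/hasP; exists b; [exact (root_path_mem (LP' l).1)|].
  by move/perm_size; rewrite size_cat => ss; have := leq_add (size0 i) (size0 j); rewrite ss.
(* The structure constant is at most the length ratio [r], hence below [p]. *)
move=> i m /le_trans/(_ (long _ (alP i)).2); rewrite ler_pM2r ?knorm_gt0 // => mr.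
by apply: natr_unit; lia.
Qed.

Lemma typed_unit_bound c : c \in Phi -> cart D`_b c = -1 ->
  (#|[set u : A | u \is a GRing.unit]| * #|A| ^ k <= d)%N.
Proof.
move=> cP bc; have long := typed_base_long br ratio.
apply: typed_rep_bound => u; rewrite inE // => uu.
exact: (torus_conj (typed_base_root br) (fun a aP => (long a aP).1) cP bc uu).
Qed.

Lemma typed_square_bound :
  (#|[set u ^+ 2 | u in [set u : A | u \is a GRing.unit]]| * #|A| ^ k <= d)%N.
Proof.
apply: typed_rep_bound => _ /imsetP[u uu ->]; rewrite inE in uu; first by rewrite unitrX.
exact: (torus_conj_sqr (typed_base_root br) uu).
Qed.

End Bound.

End TypedBase.

End RootSystem.

(** * The lower bound *)

Lemma hf_unit_bound (q n k cu cA d : nat) : (0 < q)%N ->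
    (q ^ n - q ^ n.-1 <= cu)%N -> (q ^ n <= cA)%N -> (cu * cA ^ k <= d)%N ->
  (q%:R ^+ n - q%:R ^+ (n - 1)) * q%:R ^+ (k * n) <= d%:R :> rat.
Proof.
move=> q0 hu hA hd; rewrite subn1 -!natrX -natrB ?leq_pexp2l ?leq_pred // -natrM ler_nat.
apply: leq_trans hd; apply: leq_mul => // {hu cu}.
by rewrite mulnC expnM; case: k {d} => // k; rewrite leq_exp2r.
Qed.

Theorem theorem1
  (* the local field F, its residue field k, and the ring A = O / p^n *)
  (F : localField) (p l q n : nat)
  (p_prime : prime p) (q_def : q = (p ^ l)%N) (n_ge1 : (1 <= n)%N)
  (k : finFieldType) (res : {rmorphism ringOfIntegers F -> k})
  (res_quo : is_quotient_ring (@primeIdeal F) res) (k_card : #|k| = q)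
  (A : finComUnitRingType) (pi : {rmorphism ringOfIntegers F -> A})
  (pi_quo : is_quotient_ring (ideal_exp (@primeIdeal F) n) pi)
  (* the complex simple Lie algebra g and its Chevalley basis *)
  (R : realType) (g : lieAlgebra R[i]) (g_simple : lie_simple g)
  (h : {vspace g}) (h_cartan : is_cartan_subalgebra h)
  (Phi : seq (dual h)) (Phi_roots : is_root_system Phi)
  (Delta : seq (dual h)) (Delta_base : is_base Phi Delta)
  (H : dual h -> subvs_of h) (e : dual h -> g)
  (chev : is_chevalley_basis Phi Delta H e)
  (X : dynkin) (Phi_type : has_type Delta H X) (X_hyp : hf_hyp X p) :
  hf X q n <=
    (min_faithful_dim R[i] (adjoint_chevalley_group Phi Delta H e A))%:R.
Proof.
rewrite /min_faithful_dim; case: ex_minnP => d /asboolP[rG faith] _.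
have [size_Delta [D D_Delta D_cartan]] := Phi_type.
have [t0 t0_neq0 t0_soc] := socle_element n_ge1 pi_quo.
have natU := natr_unit p_prime q_def n_ge1 res_quo k_card pi_quo.
have cA := card_residue_ring n_ge1 res_quo k_card pi_quo.
have cU := card_residue_units n_ge1 res_quo k_card pi_quo.
have q0 : (0 < q)%N by rewrite q_def expn_gt0 prime_gt0.
have unit_bound b m r c : (b < dynkin_rank X)%N -> heisenberg_paths X b m ->
    length_ratio X b r -> r < p%:Z -> (2 < p)%N -> c \in Phi -> cart H D`_b c = -1 ->
    (q%:R ^+ n - q%:R ^+ (n - 1)) * q%:R ^+ (m * n) <= d%:R :> rat.
  move=> br paths ratio rp p3 cP bc.
  apply: (hf_unit_bound q0 cU cA).
  exact: (typed_unit_bound Phi_roots Delta_base chev size_Delta D_Delta D_cartan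
    br paths ratio rp p3 natU t0_neq0 t0_soc faith cP bc).
have square_bound b m r : (b < dynkin_rank X)%N -> heisenberg_paths X b m ->
    length_ratio X b r -> r < p%:Z -> (2 < p)%N ->
    (q%:R ^+ n - q%:R ^+ (n - 1)) / 2 * q%:R ^+ (m * n) <= d%:R :> rat.
  move=> br paths ratio rp p3.
  have := typed_square_bound Phi_roots Delta_base chev size_Delta D_Delta D_cartan
    br paths ratio rp p3 natU t0_neq0 t0_soc faith.
  have cS := card_unit_squares p_prime q_def n_ge1 res_quo k_card pi_quo p3.
  set S := #|_| in cS *; move=> hS.
  (* At least half as many squares as units: clearing the denominator reduces to the count for
     units. *)
  rewrite mulrAC ler_pdivrMr // -natrM [(d * 2)%N]mulnC.
  apply: (hf_unit_bound q0 (leq_trans cU cS) cA).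
  by rewrite -mulnA leq_mul2l hS.
have entry i j (ir : (i < dynkin_rank X)%N) (jr : (j < dynkin_rank X)%N) :
    cart H D`_i D`_j = cartan_entry X i j.
  by apply: cart_eq; exact: D_cartan.
have D_root i : (i < dynkin_rank X)%N -> D`_i \in Phi.
  exact: (typed_base_root Delta_base size_Delta D_Delta).
have edge_bound b m r j : (b < dynkin_rank X)%N -> (j < dynkin_rank X)%N ->
    cartan_entry X b j = -1 -> heisenberg_paths X b m ->
    length_ratio X b r -> r < p%:Z -> (2 < p)%N ->
    (q%:R ^+ n - q%:R ^+ (n - 1)) * q%:R ^+ (m * n) <= d%:R :> rat.
  move=> br jr bj paths ratio rp p3; apply: (unit_bound b m r D`_j) => //; first exact: D_root.
  by rewrite entry.
case: X X_hyp {Phi_type size_Delta D_cartan} unit_bound square_bound entry D_root edge_bound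
    => [m|m|m|m|||||] /= hyp unit_bound square_bound entry D_root edge_bound.
- case/andP: hyp => m0 p3; case: m m0 unit_bound square_bound entry D_root edge_bound
    => [//|[|m]] m0 unit_bound square_bound entry D_root edge_bound.
    (* In type A_1 there are no pairs, and only the subgroup of b remains. *)
    have := square_bound 0%N 0%N 2 isT (@heisenberg_paths_A 1 isT) (@length_ratio_A 1 isT).
    by rewrite mul0n expr0 mulr1; apply; lia.
  apply: (edge_bound 0%N (m.+2 - 1)%N 2 1%N) => //; try lia.
    exact: heisenberg_paths_A.
  exact: length_ratio_A.
- case/andP: hyp => m3 p3; apply: (edge_bound 0%N (2 * m - 3)%N 2 1%N); try lia.
  + by rewrite cartan_entry_B //; lia.
  + exact: heisenberg_paths_B.
  + exact: length_ratio_B.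
- case/andP: hyp => m2 p3; apply: (square_bound (m - 1)%N (m - 1)%N 2); try lia.
  + exact: heisenberg_paths_C.
  + exact: length_ratio_C.
- case/andP: hyp => m4 p3; apply: (edge_bound 0%N (2 * m - 4)%N 2 1%N); try lia.
  + by rewrite cartan_entry_D_chain //; lia.
  + exact: heisenberg_paths_D.
  + exact: length_ratio_D.
- by apply: (edge_bound 0%N 10 2 2) => //; [exact: heisenberg_paths_E6 | exact: length_ratio_E6].
- by apply: (edge_bound 0%N 16 2 2) => //; [exact: heisenberg_paths_E7 | exact: length_ratio_E7].
- by apply: (edge_bound 0%N 28 2 2) => //; [exact: heisenberg_paths_E8 | exact: length_ratio_E8].
- by apply: (edge_bound 0%N 7 2 1%N) => //; [exact: heisenberg_paths_F4 | exact: length_ratio_F4].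
(* The simple neighbour of b = a_1 has <a_1, a_0^vee> = -3. Its reflection c = a_1 + 3 a_0 is a long
   root with <b, c^vee> = -1. *)
have D0 := D_root 0%N isT; have D1 := D_root 1%N isT.
have cP := refl_root Phi_roots Delta_base chev D0 D1; set c := refl H _ _ in cP.
apply: (unit_bound 1%N 2 3 c) => //; try lia; first exact: heisenberg_paths_G2.
  exact: length_ratio_G2.
have [_ kE] := coroot_refl Phi_roots Delta_base chev D0 D1.
have := cart_knorm Phi_roots Delta_base chev cP D1; rewrite -/c kE.
have k0 := knorm_gt0 chev D1; move/(mulIf (lt0r_neq0 k0)) => <-.
apply: cart_eq; rewrite (rv_refl Phi_roots Delta_base chev) // (rv_coroot chev) //.
rewrite -!(cartE Phi_roots Delta_base chev) // !entry //.
by rewrite -rmorphM -[2]/(2%:~R) -rmorphB.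
Qed.
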